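(* Let $A$ be a Hermitian unital Banach $\ast$-algebra and $\psi:A\to\mathbb{C}$ a positive normalized linear functional. Let $f$ be analytic in an open subset $G$ of $\mathbb{C}$, let $I\subset G$ be a real interval, and let $m<M$ be real numbers with $[m,M]\subset I$. Suppose there exist constants $K>k\ge0$ such that $K\ge f''(z)\ge k$ for every $z\in[m,M]$. Then for every selfadjoint element $c\in A$ with $\sigma(c)\subseteq[m,M]$, $$\frac12K\left[\psi(c^2)-\psi^2(c)\right]\ge\psi(f(c))-f(\psi(c))\ge\frac12k\left[\psi(c^2)-\psi^2(c)\right]$$ and $$\frac12K\left[\psi(c^2)-\psi^2(c)\right]\ge\psi(cf'(c))-\psi(c)\psi(f'(c))+f(\psi(c))-\psi(f(c))\ge\frac12k\left[\psi(c^2)-\psi^2(c)\right].$$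
   Context: A unital Banach $\ast$-algebra $A$ (complex, with unit $1$) is called Hermitian if every selfadjoint element $a$ ($a^\ast=a$) has real spectrum $\sigma(a)\subset\mathbb{R}$. An element $a\in A$ is nonnegative, written $a\ge 0$, if $a^\ast=a$ and $\sigma(a)\subset[0,\infty)$. A linear functional $\psi:A\to\mathbb{C}$ is positive if $\psi(a)\ge0$ whenever $a\ge0$, and normalized if $\psi(1)=1$. For $g$ analytic on an open set $G\supset\sigma(c)$, $g(c)\in A$ is defined by the holomorphic functional calculus, $g(c)=\frac{1}{2\pi i}\int_\gamma g(z)(z-c)^{-1}dz$, where $\gamma$ is a closed rectifiable curve in $G$ with $\sigma(c)$ in its inside; the result does not depend on the choice of $\gamma$. Here $f'$ and $f''$ are the complex derivatives of $f$, and $\psi^2(c)$ means $(\psi(c))^2$. An inequality between scalars includes the assertion that they are real. *)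

(* Defs.v *)
From HB Require Import structures.
From mathcomp Require Import all_boot all_order all_algebra.
From mathcomp Require Import all_classical all_reals all_analysis.
From mathcomp Require Import complex.

Set Implicit Arguments.
Unset Strict Implicit.
Unset Printing Implicit Defensive.

Import Order.TTheory GRing.Theory Num.Theory.
Import numFieldNormedType.Exports.

Local Open Scope classical_set_scope.
Local Open Scope ring_scope.
Local Open Scope complex_scope.

(* [R[i]] as a normed space over itself, with the topology of the modulus. *)
HB.instance Definition _ (R : realType) :=
  GRing.ComAlgebra.copy R[i] R[i]^o.
HB.instance Definition _ (R : realType) :=
  NormedModule.copy R[i] R[i]^o.

(* The norm is a field of the structure because the class of normed modules
   cannot be joined with that of unit rings (both are inherited by number
   domains).  As for [`|x|] in a normed module over [K], it is [K]-valued; its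
   nonnegativity follows from the axioms.
   Neither a norm-one unit nor continuity of the involution is required, so
   that the various conventions for Banach *-algebras are all covered.  Using
   a [unitAlgType] is no restriction classically; it makes [x^-1] available. *)
HB.mixin Record hasBanachNorm (K : numClosedFieldType) A
    of GRing.UnitAlgebra K A := {
  bnorm : A -> K;
  bnormD : forall x y : A, bnorm (x + y) <= bnorm x + bnorm y;
  bnormZ : forall (a : K) (x : A), bnorm (a *: x) = `|a| * bnorm x;
  bnorm0_eq0 : forall x : A, bnorm x = 0 -> x = 0;
  bnormM : forall x y : A, bnorm (x * y) <= bnorm x * bnorm y;
  bnorm_complete : forall u : nat -> A,
    (forall e : K, 0 < e -> exists N : nat, forall i j : nat,
       (N <= i)%N -> (N <= j)%N -> bnorm (u i - u j) < e) ->
    exists l : A, forall e : K, 0 < e -> exists N : nat, forall i : nat,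
       (N <= i)%N -> bnorm (u i - l) < e
}.

#[short(type="banachAlgType")]
HB.structure Definition BanachAlgebra (K : numClosedFieldType) :=
  { A of GRing.UnitAlgebra K A & hasBanachNorm K A }.

HB.mixin Record hasInvolution (K : numClosedFieldType) A
    of BanachAlgebra K A := {
  star : A -> A;
  starK : involutive star;
  starD : {morph star : x y / x + y};
  starZ : forall (a : K) (x : A), star (a *: x) = Num.conj a *: star x;
  starM : forall x y : A, star (x * y) = star y * star x
}.

#[short(type="banachStarAlgType")]
HB.structure Definition BanachStarAlgebra (K : numClosedFieldType) :=
  { A of BanachAlgebra K A & hasInvolution K A }.

Definition spectrum (R : realType) (A : banachAlgType R[i]) (a : A) :
    set R[i] :=
  [set z | z%:A - a \isn't a GRing.unit].

Definition selfadjoint (R : realType) (A : banachStarAlgType R[i]) (a : A) :=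
  star a = a.

Definition hermitian_algebra (R : realType) (A : banachStarAlgType R[i]) :=
  forall a : A, selfadjoint a -> spectrum a `<=` [set z | z \is Num.real].

(* In [R[i]], [0 <= z] means that [z] is real and nonnegative. *)
Definition nonnegative (R : realType) (A : banachStarAlgType R[i]) (a : A) :=
  selfadjoint a /\ spectrum a `<=` [set z | 0 <= z].

Definition positive_functional (R : realType) (A : banachStarAlgType R[i])
    (psi : {scalar A}) :=
  forall a : A, nonnegative a -> 0 <= psi a.

Definition analytic_on (R : realType) (G : set R[i]) (f : R[i] -> R[i]) :=
  forall z, G z -> derivable f z 1.

(* Curves are parametrized by [0, 1]; values outside [0, 1] are irrelevant. *)
Section curves.
Variable R : realType.
Implicit Types (gamma : R -> R[i]) (s : seq R) (t : nat -> R).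

Definition trace gamma : set R[i] := gamma @` `[0, 1].

(* The subdivision points are x_0 = 0 and x_(i+1) = s`_i, see
   [itv_partition]. *)
Definition curve_variation gamma s : R[i] :=
  let x := nth 1 (0 :: s) in
  \sum_(0 <= i < size s) `|gamma (x i.+1) - gamma (x i)|.

Definition rectifiable gamma :=
  exists L : R, forall s, itv_partition 0 1 s ->
    curve_variation gamma s <= L%:C.

Definition closed_rectifiable_curve gamma :=
  [/\ {within `[0, 1], continuous gamma}, gamma 0 = gamma 1
    & rectifiable gamma].

(* [t i] is the tag of the i-th subinterval; [d] bounds the mesh. *)
Definition tagged_partition (d : R) s t :=
  let x := nth 1 (0 :: s) in
  itv_partition 0 1 s /\
  forall i, (i < size s)%N ->
    x i.+1 - x i < d /\ x i <= t i <= x i.+1.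

Section integral.
Variables (V : lmodType R[i]) (nrm : V -> R[i]).
Implicit Type F : R[i] -> V.

Definition riemann_stieltjes_sum gamma F s t : V :=
  let x := nth 1 (0 :: s) in
  \sum_(0 <= i < size s) (gamma (x i.+1) - gamma (x i)) *: F (gamma (t i)).

Definition is_curve_integral gamma F (v : V) :=
  forall e : R, 0 < e -> exists2 d : R, 0 < d &
    forall s t, tagged_partition d s t ->
      nrm (v - riemann_stieltjes_sum gamma F s t) < e%:C.

Definition curve_integral gamma F : V := xget 0 (is_curve_integral gamma F).

End integral.

Definition two_pi_i : R[i] := (2 * pi)%:C * 'i%C.

Definition winding_number gamma (w : R[i]) : R[i] :=
  two_pi_i^-1 *
  curve_integral (V := R[i]) Num.norm gamma (fun z => (z - w)^-1).

Definition inside gamma : set R[i] :=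
  [set w | ~ trace gamma w /\ winding_number gamma w = 1].

Definition outside gamma : set R[i] :=
  [set w | ~ trace gamma w /\ winding_number gamma w = 0].

End curves.

(* The condition on the complement of [G] is what makes the Cauchy integral
   independent of the curve when [G] is not simply connected. *)
Definition surrounds (R : realType) (G S : set R[i]) (gamma : R -> R[i]) :=
  [/\ closed_rectifiable_curve gamma, trace gamma `<=` G,
      S `<=` inside gamma & ~` G `<=` outside gamma].

Definition cauchy_integral (R : realType) (A : banachAlgType R[i])
    (gamma : R -> R[i]) (g : R[i] -> R[i]) (c : A) : A :=
  (two_pi_i R)^-1 *:
  curve_integral (@bnorm _ A) gamma (fun z => g z *: (z%:A - c)^-1).

(* g(c), for g analytic on the open set G. *)
Definition holo_calc (R : realType) (A : banachAlgType R[i])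
    (G : set R[i]) (g : R[i] -> R[i]) (c : A) : A :=
  xget 0 [set b | exists2 gamma, surrounds G (spectrum c) gamma
                               & b = cauchy_integral gamma g c].

(* Main.v *)
Require Import Defs.
From HB Require Import structures.
From mathcomp Require Import all_boot all_order all_algebra.
From mathcomp Require Import all_classical all_reals all_analysis.
From mathcomp Require Import complex ring lra.
Import Order.TTheory GRing.Theory Num.Theory.
Import numFieldNormedType.Exports.

(** Let [t = psi c]. Everything follows from one fact: if [h] is analytic near
    the spectrum of [c] and [0 <= h] on that spectrum, then [0 <= psi (h c)]
    ([function_of_nonneg]). Applied to [z - m] and [M - z] it shows that [t]
    lies in [m, M]. If [g] is convex on [m, M], the functions
      [g z - g t - g' t * (z - t)]  and  [g t - g z - g' z * (t - z)]
    are nonnegative there, since the graph of [g] is above its tangents at [t]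
    and at [z]; applying the functional gives Jensen's inequality and its
    reverse for [g] ([jensen_gap_ge0], [reverse_jensen_gap_ge0]). The four
    inequalities are these two for [f z - k / 2 * z ^ 2] and for
    [K / 2 * z ^ 2 - f z], which are convex by the bounds on the second
    derivative of [f].

    The proof of the fact has an algebraic and an analytic half, which meet in
    the relation [function_of]: an element [b] and a function [h] are related
    if the same rational functions [q] of [c] approximate [b] in norm and [h]
    uniformly on the spectrum of [c].

    Algebra. The spectrum of a rational function [q] of [c] consists of its
    values on the spectrum of [c], and the real and imaginary parts of [q] are
    rational functions of [c] too; so [psi q] is almost nonnegative as soon as
    the values of [q] are ([rational_approx]). To pass to the limit one needs
    that [psi] is small on the error [e = b - q], although the involution may
    be discontinuous. But [e] is normal, the spectrum of [star e] is conjugate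
    to that of [e], and the spectral radius is subadditive on commuting
    elements ([sum_resolvent]), so the spectrum of the selfadjoint element
    [e + star e] is in a small interval, and positivity bounds [psi] on it
    ([psi_normal_bound]). The required part of the spectral radius formula is
    [power_small], which is proved by averaging resolvents over roots of unity
    ([mean_root]) instead of integrating them.

    Analysis. The rational functions come from the Cauchy integral that defines
    [h c]: its Riemann sums are combinations of resolvents of [c], and their
    values at [w] are Riemann sums of the scalar integral of [h z / (z - w)].
    The sums converge uniformly in [w] because the curve stays away from the
    spectrum, and the limit is [h w] by Cauchy's formula for a closed
    rectifiable curve of index 1 about the spectrum and of index 0 about every
    point outside of the domain ([cauchy_homology]). That formula is obtained
    by Dixon's argument: the integrals of the difference quotients of [h]
    extend to an entire function that vanishes at infinity. It rests on the
    local theory: Goursat's theorem ([goursat]), Cauchy's formula on a circle,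
    here as a limit of averages over roots of unity ([cauchy_formula]), the
    differentiability of derivatives ([holomorphic_deriv]) and Liouville's
    theorem ([liouville]).

    Last, the Cauchy integral is a meaningful value of the functional calculus
    only if a surrounding curve exists. A thin ellipse with foci [m] and [M] is
    one; its index about a point is computed in the coordinate of the Joukowski
    map, again by averages over roots of unity ([ellipse_surrounds]). *)

Local Open Scope classical_set_scope.
Local Open Scope ring_scope.
Local Open Scope complex_scope.
Set Implicit Arguments.
Unset Strict Implicit.
Unset Printing Implicit Defensive.
Local Notation Re := (@complex.Re _).
Local Notation Im := (@complex.Im _).

(** * The real-valued modulus *)

Section modulus.
Variable R : realType.
Implicit Types (z w : R[i]) (x : R).

(** Real-valued, unlike [`|z|], so that estimates take place in an ordered
    field. *)
Definition cabs z : R := Re `|z|.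

Lemma cabsE z : `|z| = (cabs z)%:C.
Proof. by rewrite /cabs normc_def. Qed.

Lemma cabs_sqrt z : cabs z = Num.sqrt (Re z ^+ 2 + Im z ^+ 2).
Proof. by rewrite /cabs normc_def. Qed.

Lemma cabs_ge0 z : 0 <= cabs z.
Proof. by rewrite cabs_sqrt sqrtr_ge0. Qed.

Lemma cabs0 : cabs 0 = 0. Proof. by rewrite /cabs normr0. Qed.
Lemma cabs1 : cabs 1 = 1. Proof. by rewrite /cabs normr1. Qed.
Lemma cabsN z : cabs (- z) = cabs z. Proof. by rewrite /cabs normrN. Qed.
Lemma cabsB z w : cabs (z - w) = cabs (w - z).
Proof. by rewrite -cabsN opprB. Qed.

Lemma cabsM z w : cabs (z * w) = cabs z * cabs w.
Proof. by apply: (@complexI R); rewrite rmorphM /= -!cabsE normrM. Qed.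

Lemma cabsV z : cabs z^-1 = (cabs z)^-1.
Proof. by apply: (@complexI R); rewrite fmorphV /= -!cabsE normfV. Qed.

Lemma cabsX z n : cabs (z ^+ n) = cabs z ^+ n.
Proof. by apply: (@complexI R); rewrite rmorphXn /= -!cabsE normrX. Qed.

Lemma cabsD z w : cabs (z + w) <= cabs z + cabs w.
Proof. by rewrite -(lecR (cabs _)) rmorphD /= -!cabsE ler_normD. Qed.

Lemma cabs_eq0 z : (cabs z == 0) = (z == 0).
Proof.
by rewrite -(normr_eq0 z) cabsE -[0 in RHS]/(0%:C) (inj_eq (@complexI R)).
Qed.

Lemma cabs_gt0 z : (0 < cabs z) = (z != 0).
Proof. by rewrite lt_neqAle cabs_ge0 andbT eq_sym cabs_eq0. Qed.

Lemma cabs_real x : cabs x%:C = `|x|.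
Proof. by rewrite cabs_sqrt /= expr0n addr0 sqrtr_sqr. Qed.

Lemma cabs_nat n : cabs n%:R = n%:R.
Proof. by rewrite -(rmorph_nat (real_complex R)) cabs_real normr_nat. Qed.

Lemma Re_le_cabs z : `|Re z| <= cabs z.
Proof. by rewrite -lecR -cabsE normc_ge_Re. Qed.

Lemma cabs_i : cabs 'i%C = 1.
Proof. by rewrite cabs_sqrt /= expr0n add0r expr1n sqrtr1. Qed.

Lemma Im_le_cabs z : `|Im z| <= cabs z.
Proof. by rewrite -normrN -ReiNIm (le_trans (Re_le_cabs _))// cabsM cabs_i mulr1. Qed.

Lemma cabs_le z : cabs z <= `|Re z| + `|Im z|.
Proof.
rewrite {1}(complexE z) (le_trans (cabsD _ _))// cabsM !cabs_real cabs_i.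
by rewrite mul1r.
Qed.

Lemma cabs_dist z w : cabs z - cabs w <= cabs (z - w).
Proof. by rewrite lerBlDr (le_trans _ (cabsD _ _))// subrK. Qed.

Lemma cabs_sum I (r : seq I) (P : pred I) (F : I -> R[i]) :
  cabs (\sum_(i <- r | P i) F i) <= \sum_(i <- r | P i) cabs (F i).
Proof.
elim/big_ind2 : _ => [|z x w y zx wy|//]; first by rewrite cabs0.
by rewrite (le_trans (cabsD _ _))// lerD.
Qed.

Lemma cabs_tri z w u : cabs (z - u) <= cabs (z - w) + cabs (w - u).
Proof. by rewrite (le_trans _ (cabsD _ _))// addrA subrK. Qed.

Lemma cabs_small z : (forall e, 0 < e -> cabs z <= e) -> z = 0.
Proof.
move=> h; apply/eqP; rewrite -cabs_eq0 eq_le cabs_ge0 andbT leNgt.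
by apply/negP => z0; have := h (cabs z / 2); lra.
Qed.

Lemma ltcR_cabs z x : (`|z| < x%:C) = (cabs z < x).
Proof. by rewrite cabsE ltcR. Qed.

End modulus.

Definition tends_to (R : numDomainType) (V : zmodType) (N : V -> R)
    (u : nat -> V) (l : V) :=
  forall e, 0 < e -> exists n, forall i, (n <= i)%N -> N (u i - l) <= e.

Definition cauchy_sequence (R : numDomainType) (V : zmodType) (N : V -> R)
    (u : nat -> V) :=
  forall e, 0 < e -> exists n, forall i j, (n <= i)%N -> (n <= j)%N ->
    N (u i - u j) <= e.

(** Common ground of the modulus and of the norm of a Banach algebra. The values
    are real so that estimates take place in an ordered field. *)
Record complete_norm (R : realType) (V : lmodType R[i]) (N : V -> R) : Prop := {
  cnD : forall x y, N (x + y) <= N x + N y;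
  cnZ : forall a x, N (a *: x) = cabs a * N x;
  cn0_eq0 : forall x, N x = 0 -> x = 0;
  cn_complete : forall u, cauchy_sequence N u -> exists l, tends_to N u l }.

Section complete_norm.
Variables (R : realType) (V : lmodType R[i]) (N : V -> R).
Hypothesis hN : complete_norm N.

Lemma cn0 : N 0 = 0.
Proof. by rewrite -(scale0r 0) (cnZ hN) cabs0 mul0r. Qed.

Lemma cnN x : N (- x) = N x.
Proof. by rewrite -scaleN1r (cnZ hN) cabsN cabs1 mul1r. Qed.

Lemma cn_ge0 x : 0 <= N x.
Proof. by have := cnD hN x (- x); rewrite subrr cn0 cnN; lra. Qed.

Lemma cnB x y : N (x - y) = N (y - x).
Proof. by rewrite -cnN opprB. Qed.

Lemma cn_tri x y z : N (x - z) <= N (x - y) + N (y - z).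
Proof. by rewrite (le_trans _ (cnD hN _ _))// addrA subrK. Qed.

Lemma cn_sum I (r : seq I) (P : pred I) (F : I -> V) :
  N (\sum_(i <- r | P i) F i) <= \sum_(i <- r | P i) N (F i).
Proof.
elim/big_ind2 : _ => [|z x w y zx wy|//]; first by rewrite cn0.
by rewrite (le_trans (cnD hN _ _))// lerD.
Qed.

Lemma cn_eq x y : (forall e, 0 < e -> N (x - y) <= e) -> x = y.
Proof.
move=> h; apply/eqP; rewrite -subr_eq0; apply/eqP/(cn0_eq0 hN)/eqP.
rewrite eq_le cn_ge0 andbT leNgt; apply/negP => p.
by have := h (N (x - y) / 2); lra.
Qed.

Lemma tends_to_unique u x y : tends_to N u x -> tends_to N u y -> x = y.
Proof.
move=> ux uy; apply: cn_eq => e e0.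
have [|n1 h1] := ux (e / 2); first by lra.
have [|n2 h2] := uy (e / 2); first by lra.
have {h1} := h1 _ (leq_maxl n1 n2); have {h2} := h2 _ (leq_maxr n1 n2).
by have := cn_tri x (u (maxn n1 n2)) y; rewrite (cnB x (u _)); lra.
Qed.

End complete_norm.

Lemma real_complete (R : realType) (u : nat -> R) :
  cauchy_sequence Num.norm u -> exists l, tends_to Num.norm u l.
Proof.
move=> cu.
have /cauchy_cvgP/cvg_ex[l ul] : cauchy (u @ \oo).
  apply: cauchy_exP => e e0; have [|n hn] := cu (e / 2); first by lra.
  exists (u n), n => // i /= ni; rewrite /ball /=.
  by have := hn n i (leqnn _) ni; lra.
exists l => e e0; move/cvgrPdist_le : ul => /(_ _ e0)[n _ hn].
by exists n => i ni; rewrite distrC; exact: hn.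
Qed.

Lemma cabs_complete (R : realType) : complete_norm (V := R[i]) (@cabs R).
Proof.
split; [exact: cabsD|exact: cabsM|by move=> x /eqP; rewrite cabs_eq0 => /eqP|].
move=> u cu.
have [|x ux] := @real_complete R (Re \o u).
  move=> e /cu[n hn]; exists n => i j ni nj; rewrite (le_trans _ (hn i j ni nj))//.
  by rewrite (le_trans _ (Re_le_cabs _))// -raddfB.
have [|y uy] := @real_complete R (Im \o u).
  move=> e /cu[n hn]; exists n => i j ni nj; rewrite (le_trans _ (hn i j ni nj))//.
  by rewrite (le_trans _ (Im_le_cabs _))// -raddfB.
exists (x +i* y) => e e0.
have [|n1 h1] := ux (e / 2); first by lra.
have [|n2 h2] := uy (e / 2); first by lra.
exists (maxn n1 n2) => i; rewrite geq_max => /andP[/h1 {}h1 /h2 {}h2].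
rewrite (le_trans (cabs_le _))// 2!raddfB /=.
by move: h1 h2 => /=; lra.
Qed.

(** * Compactness *)

Section compactness.
Variable R : realType.

(** Stated for a relation on pairs of points rather than for a covering: both
    uniform continuity and uniform differentiability are of this form. *)
Lemma lebesgue_number (T : pseudoMetricType R) (K : set T)
    (Q : T -> T -> Prop) : compact K ->
  (forall p, K p -> exists2 d : R, 0 < d &
     forall x y, ball p d x -> ball p d y -> Q x y) ->
  exists2 d : R, 0 < d & forall x y, K x -> ball x d y -> Q x y.
Proof.
move=> /compact_near_coveringP cK h.
have /(_ (fun d x => forall y, ball x d y -> Q x y)) := cK R (0^'+).
move=> [].
  move=> p Kp; have [d d0 hd] := h p Kp.
  near=> x e => /= y xy.
  have px : ball p (d / 2) x by near: x; apply: nbhsx_ballx; rewrite divr_gt0.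
  apply: hd; first by apply: le_ball px; lra.
  have -> : d = d / 2 + d / 2 by lra.
  apply: ball_triangle px _; apply: le_ball xy; near: e.
  by apply: nbhs_right_le; rewrite divr_gt0.
move=> e /= e0 he; exists (e / 2); first by rewrite divr_gt0.
move=> x y Kx; apply: he => //=; rewrite ?divr_gt0//.
by rewrite sub0r normrN gtr0_norm ?divr_gt0//; move: e0 => /=; lra.
Unshelve. all: by end_near. Qed.

Lemma compact_local_bound (T : pseudoMetricType R) (K : set T) (g : T -> R) :
  compact K ->
  (forall p, K p -> exists B d : R, 0 < d /\ forall x, ball p d x -> g x <= B) ->
  exists B, forall x, K x -> g x <= B.
Proof.
move=> /compact_near_coveringP cK h.
have /(_ (fun B x => g x <= B)) := cK R (pinfty_nbhs R).
move=> [].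
  move=> p Kp; have [B [d [d0 hd]]] := h p Kp.
  near=> x B' => /=; apply: (@le_trans _ _ B).
    by apply: hd; near: x; exact: nbhsx_ballx.
  by near: B'; apply: nbhs_pinfty_ge; exact: num_real.
move=> B [Br hB]; exists (B + 1) => x Kx; apply: hB => //; lra.
Unshelve. all: by end_near. Qed.

(** Intervals are handled by gluing: a property of subintervals that is
    inherited by unions of adjacent ones, and that holds near each point,
    holds globally. *)
Lemma cousin (a b : R) (P : R -> R -> Prop) : a <= b ->
  (forall x y z, a <= x -> x <= y -> y <= z -> z <= b ->
     P x y -> P y z -> P x z) ->
  (forall p, a <= p <= b -> exists2 d : R, 0 < d &
     forall x y, a <= x -> x <= p -> p <= y -> y <= b -> y - x < d -> P x y) ->
  P a b.
Proof.
move=> ab glue loc.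
pose S := [set x | a <= x <= b /\ P a x].
have Sa : S a.
  have [|d d0 hd] := loc a; first by rewrite lexx ab.
  by split; [rewrite lexx ab|apply: hd => //; rewrite subrr].
have ubS : ubound S b by move=> x [/andP[]].
have supS : has_sup S by split; [exists a|exists b].
pose s := sup S.
have as_ : a <= s by apply: sup_upper_bound.
have sb : s <= b by apply: sup_le_ub => //; exists a.
have [|d d0 hd] := loc s; first by rewrite as_ sb.
have d20 : 0 < d / 2 by rewrite divr_gt0.
have [x Sx sx] := sup_adherent d20 supS.
have xs : x <= s by apply: sup_upper_bound.
case: Sx => /andP[ax xb] Pax.
pose y := Num.min b (s + d / 4).
have sy : s <= y by rewrite le_min sb; lra.
have yb : y <= b by rewrite ge_min lexx.
have yd : y <= s + d / 4 by rewrite ge_min lexx orbT.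
have Pay : P a y.
  apply: (glue a x y) => //; first exact: (le_trans xs).
  by apply: hd => //; move: sx; rewrite -/s; lra.
have [by_|yb'] := eqVneq y b; first by rewrite -by_.
have : y <= s by apply: sup_upper_bound => //; split=> //; rewrite (le_trans as_).
rewrite /y; case: (leP b (s + d / 4)) => [h|h].
  by move: yb'; rewrite /y min_l ?eqxx.
lra.
Qed.

End compactness.

(** * Complex derivatives *)

Section derivatives.
Variable R : realType.
Implicit Types (f g : R[i] -> R[i]) (z w d : R[i]).

(** The complex derivative, in the form in which it is used below: first-order
    expansions with an explicit error. *)
Definition has_deriv f z d := forall e : R, 0 < e ->
  exists2 r : R, 0 < r & forall w, cabs (w - z) < r ->
    cabs (f w - f z - d * (w - z)) <= e * cabs (w - z).

Definition cont_at f z := forall e : R, 0 < e ->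
  exists2 r : R, 0 < r & forall w, cabs (w - z) < r -> cabs (f w - f z) <= e.

Lemma has_deriv_le f z d : has_deriv f z d ->
  exists2 r : R, 0 < r & forall w, cabs (w - z) < r ->
    cabs (f w - f z) <= (cabs d + 1) * cabs (w - z).
Proof.
move=> /(_ 1 ltr01)[r r0 hr]; exists r => // w /hr.
have := cabsD (f w - f z - d * (w - z)) (d * (w - z)).
by rewrite subrK cabsM; lra.
Qed.

Lemma has_deriv_cont f z d : has_deriv f z d -> cont_at f z.
Proof.
move=> /has_deriv_le[r r0 hr] e e0.
have d1 : 0 < cabs d + 1 by have := cabs_ge0 d; lra.
exists (Num.min r (e / (cabs d + 1))); first by rewrite lt_min r0 divr_gt0.
move=> w; rewrite lt_min => /andP[/hr hw]; rewrite ltr_pdivlMr// mulrC.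
by move: hw; lra.
Qed.

Lemma has_deriv_cst c z : has_deriv (fun=> c) z 0.
Proof.
move=> e e0; exists 1 => // w _.
by rewrite subrr mul0r subr0 cabs0 mulr_ge0 ?cabs_ge0// ltW.
Qed.

Lemma has_deriv_id z : has_deriv id z 1.
Proof.
move=> e e0; exists 1 => // w _.
by rewrite mul1r subrr cabs0 mulr_ge0 ?cabs_ge0// ltW.
Qed.

Lemma has_derivD f g z a b : has_deriv f z a -> has_deriv g z b ->
  has_deriv (fun w => f w + g w) z (a + b).
Proof.
move=> hf hg e e0; have e2 : 0 < e / 2 by rewrite divr_gt0.
have [r1 r10 h1] := hf _ e2; have [r2 r20 h2] := hg _ e2.
exists (Num.min r1 r2); first by rewrite lt_min r10 r20.
move=> w; rewrite lt_min => /andP[/h1 {}h1 /h2 {}h2].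
have -> : f w + g w - (f z + g z) - (a + b) * (w - z) =
  (f w - f z - a * (w - z)) + (g w - g z - b * (w - z)) by ring.
by rewrite (le_trans (cabsD _ _))//; lra.
Qed.

Lemma has_derivM f g z a b : has_deriv f z a -> has_deriv g z b ->
  has_deriv (fun w => f w * g w) z (a * g z + f z * b).
Proof.
move=> hf hg e e0.
set F := cabs (f z); set Gz := cabs (g z); set A := cabs a.
have F0 : 0 <= F by exact: cabs_ge0.
have G0 : 0 <= Gz by exact: cabs_ge0.
have A0 : 0 <= A by exact: cabs_ge0.
pose e1 := e / 3 / (Gz + 1); pose e2 := e / 3 / (F + 1).
pose e3 := e / 3 / (A + 1).
have [] : [/\ 0 < e1, 0 < e2 & 0 < e3].
  by split; rewrite /e1 /e2 /e3 !divr_gt0//; lra.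
move=> e10 e20 e30.
have [r1 r10 h1] := hf _ e10; have [r2 r20 h2] := hg _ e20.
have [r3 r30 h3] := has_deriv_le hf; have [r4 r40 h4] := has_deriv_cont hg e30.
exists (Num.min (Num.min r1 r2) (Num.min r3 r4)).
  by rewrite !lt_min r10 r20 r30 r40.
move=> w; rewrite !lt_min => /andP[/andP[/h1 {}h1 /h2 {}h2] /andP[/h3 {}h3 /h4 {}h4]].
have -> : f w * g w - f z * g z - (a * g z + f z * b) * (w - z) =
  (f w - f z - a * (w - z)) * g z + f z * (g w - g z - b * (w - z))
  + (f w - f z) * (g w - g z) by ring.
set D := cabs (w - z) in h1 h2 h3 *.
have D0 : 0 <= D by exact: cabs_ge0.
rewrite (le_trans (cabsD _ _))// -/D.
have H1 : cabs ((f w - f z - a * (w - z)) * g z) <= e / 3 * D.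
  rewrite cabsM -/Gz (@le_trans _ _ (e1 * D * (Gz + 1)))//.
    by apply: ler_pM => //; rewrite ?cabs_ge0// -/Gz; lra.
  by rewrite mulrAC /e1 divfK// gt_eqF//; lra.
have H2 : cabs (f z * (g w - g z - b * (w - z))) <= e / 3 * D.
  rewrite cabsM -/F (@le_trans _ _ ((F + 1) * (e2 * D)))//.
    by apply: ler_pM => //; rewrite ?cabs_ge0//; lra.
  by rewrite mulrA (mulrC (F + 1)) /e2 divfK// gt_eqF//; lra.
have H3 : cabs ((f w - f z) * (g w - g z)) <= e / 3 * D.
  rewrite cabsM (@le_trans _ _ ((A + 1) * D * e3))//.
    by apply: ler_pM => //; rewrite ?cabs_ge0.
  by rewrite mulrAC (mulrC (A + 1)) /e3 divfK// gt_eqF//; lra.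
have := cabsD ((f w - f z - a * (w - z)) * g z) (f z * (g w - g z - b * (w - z))).
by lra.
Qed.

Lemma has_derivZ f z a c : has_deriv f z a -> has_deriv (fun w => c * f w) z (c * a).
Proof.
move=> hf; have := has_derivM (has_deriv_cst c z) hf.
by rewrite mul0r add0r.
Qed.

Lemma has_derivN f z a : has_deriv f z a -> has_deriv (fun w => - f w) z (- a).
Proof.
move=> /(has_derivZ (-1)); rewrite mulN1r.
by under [X in has_deriv X]eq_fun do rewrite mulN1r.
Qed.

Lemma has_derivB f g z a b : has_deriv f z a -> has_deriv g z b ->
  has_deriv (fun w => f w - g w) z (a - b).
Proof. by move=> hf hg; apply: has_derivD hf (has_derivN hg). Qed.

Lemma has_deriv_local f g z d r : 0 < r ->
  (forall w, cabs (w - z) < r -> f w = g w) -> has_deriv f z d -> has_deriv g z d.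
Proof.
move=> r0 fg hf e /hf[r' r'0 h]; exists (Num.min r r'); rewrite ?lt_min ?r0//.
move=> w; rewrite lt_min => /andP[wr wr']; rewrite -!fg ?subrr ?cabs0//; exact: h.
Qed.

Lemma has_deriv_sum n (F : nat -> R[i] -> R[i]) z (d : nat -> R[i]) :
  (forall j, (j < n)%N -> has_deriv (F j) z (d j)) ->
  has_deriv (fun w => \sum_(0 <= j < n) F j w) z (\sum_(0 <= j < n) d j).
Proof.
elim: n => [|n ih] h.
  rewrite big_geq//; under [X in has_deriv X]eq_fun do rewrite big_geq//.
  exact: has_deriv_cst.
rewrite big_nat_recr//=.
under [X in has_deriv X]eq_fun do rewrite big_nat_recr//=.
by apply: has_derivD; [apply: ih => j /ltnW; exact: h|exact: h].
Qed.

Lemma has_deriv_affine f (p q : R[i]) z d : has_deriv f (p + q * z) d ->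
  has_deriv (fun w => f (p + q * w)) z (d * q).
Proof.
move=> hf e e0.
have q1 : 0 < cabs q + 1 by have := cabs_ge0 q; lra.
have [|r r0 h] := hf (e / (cabs q + 1)); first by rewrite divr_gt0.
exists (r / (cabs q + 1)); first by rewrite divr_gt0.
move=> w; rewrite ltr_pdivlMr// => wz.
have E : p + q * w - (p + q * z) = q * (w - z) by ring.
have := cabs_ge0 (w - z); set D := cabs (w - z) in wz * => D0.
have /h : cabs (p + q * w - (p + q * z)) < r by rewrite E cabsM -/D; lra.
rewrite E cabsM -/D mulrA => /le_trans; apply.
by rewrite [X in X <= _]mulrA ler_wpM2r// mulrAC ler_pdivrMr// ler_wpM2l ?(ltW e0)//; lra.
Qed.

Lemma has_deriv_unique f z a b : has_deriv f z a -> has_deriv f z b -> a = b.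
Proof.
move=> ha hb; apply/eqP; rewrite -subr_eq0; apply/eqP/cabs_small => e e0.
have [|r1 r10 h1] := ha (e / 2); first by rewrite divr_gt0.
have [|r2 r20 h2] := hb (e / 2); first by rewrite divr_gt0.
pose r := Num.min r1 r2 / 2.
have r0 : 0 < r by rewrite divr_gt0// lt_min r10.
have m0 : 0 < Num.min r1 r2 by rewrite lt_min r10.
have m1 : Num.min r1 r2 <= r1 by rewrite ge_min lexx.
have m2 : Num.min r1 r2 <= r2 by rewrite ge_min lexx orbT.
have rr1 : r < r1 by rewrite /r; lra.
have rr2 : r < r2 by rewrite /r; lra.
have E : z + r%:C - z = r%:C by ring.
have := h1 (z + r%:C); have := h2 (z + r%:C).
rewrite E cabs_real gtr0_norm// => /(_ rr2) {}h2 /(_ rr1) {}h1.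
have : cabs ((a - b) * r%:C) <= e * r.
  have -> : (a - b) * r%:C = (f (z + r%:C) - f z - b * r%:C) -
     (f (z + r%:C) - f z - a * r%:C) by ring.
  by rewrite (le_trans (cabsD _ _))// cabsN; lra.
by rewrite cabsM cabs_real gtr0_norm// ler_pM2r.
Qed.

Lemma has_deriv_inv (z : R[i]) : z != 0 -> has_deriv (fun w => w^-1) z (- z^-1 ^+ 2).
Proof.
move=> z0 e e0; have cz : 0 < cabs z by rewrite cabs_gt0.
have cz3 : 0 < cabs z ^+ 3 / 2 by rewrite divr_gt0// exprn_gt0.
exists (Num.min (cabs z / 2) (e * (cabs z ^+ 3 / 2))).
  by rewrite lt_min divr_gt0//= mulr_gt0.
move=> w; rewrite lt_min => /andP[w1 w2].
have cw : cabs z / 2 <= cabs w by have := cabs_dist z w; rewrite cabsB; lra.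
have w0 : w != 0 by rewrite -cabs_gt0; lra.
have -> : w^-1 - z^-1 - - z^-1 ^+ 2 * (w - z) = (w - z) * (w - z) / (w * z ^+ 2).
  by field; rewrite w0 z0.
rewrite !cabsM cabsV cabsM cabsX mulrAC ler_wpM2r ?cabs_ge0//.
have h : cabs z ^+ 3 / 2 <= cabs w * cabs z ^+ 2.
  by rewrite exprS mulrAC ler_wpM2r// exprn_ge0// cabs_ge0.
rewrite ler_pdivrMr; last by apply: lt_le_trans h.
apply: (le_trans (ltW w2)); rewrite ler_wpM2l//; exact: ltW.
Qed.

Lemma has_deriv_kernel (c a z : R[i]) : z != a ->
  has_deriv (fun w => c / (w - a)) z (- c / (z - a) ^+ 2).
Proof.
move=> za; have h : -a + 1 * z != 0 by rewrite mul1r addrC subr_eq0.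
have := has_derivZ c (has_deriv_affine (has_deriv_inv h)).
have -> : c * (- (- a + 1 * z)^-1 ^+ 2 * 1) = - c / (z - a) ^+ 2.
  by rewrite mul1r addrC mulr1 mulrN mulNr exprVn.
by under [X in has_deriv X]eq_fun do rewrite mul1r (addrC (- a)).
Qed.

(** [derive1] is the limit at 0 of difference quotients; multiplying them by the
    increment gives the expansion in [has_deriv], and conversely. *)
Lemma has_deriv_derive1 f z d : has_deriv f z d -> derive1 f z = d.
Proof.
move=> hf; apply/cvg_lim => //; apply/cvgrPdist_le => e e0.
have eE : e = (Re e)%:C by rewrite RRe_real// gtr0_real.
have e'0 : 0 < Re e by move: e0; rewrite {1}eE ltcR.
have [r r0 hr] := hf _ e'0.
apply/nbhs_normP; exists r%:C => /=; first by rewrite ltcR.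
move=> h /=; rewrite sub0r normrN ltcR_cabs => hlt h0.
have E : h + z - z = h by rewrite addrK.
have := hr (h + z); rewrite E => /(_ hlt) {}hr.
rewrite eE cabsE lecR.
have -> : d - h^-1 *: (f (h + z) - f z) = - (h^-1 * (f (h + z) - f z - d * h)).
  have -> : h^-1 *: (f (h + z) - f z) = h^-1 * (f (h + z) - f z) by [].
  by field.
rewrite cabsN cabsM cabsV mulrC ler_pdivrMr ?cabs_gt0//.
Qed.

Lemma derivable_has_deriv f z : derivable f z 1 -> has_deriv f z (derive1 f z).
Proof.
rewrite derive1E => /cvgP; rewrite /derive.
set q := fun h => _; move=> cq.
have {cq} : q @ 0^' --> lim (q @ 0^') by [].
set l := lim _; move=> /cvgrPdist_le ql e e0.
have e0' : (0 : R[i]) < e%:C by rewrite ltcR.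
have := ql _ e0'; move=> /nbhs_normP[r r0 hr].
have rE : r = (Re r)%:C by rewrite RRe_real// gtr0_real.
have r'0 : 0 < Re r by move: r0; rewrite {1}rE /= ltcR.
exists (Re r) => // w wz.
have [->|wz0] := eqVneq w z.
  by rewrite !subrr mulr0 subr0 cabs0 mulr0.
have := hr (w - z); rewrite /= sub0r normrN rE ltcR_cabs wz => /(_ isT).
rewrite subr_eq0 => /(_ wz0); rewrite /q /= cabsE lecR.
have -> : (w - z) *: (1 : R[i]) + z = w by rewrite [_ *: _]mulr1 subrK.
have wz1 : w - z != 0 by rewrite subr_eq0.
have -> : l - (w - z)^-1 *: (f w - f z) = - ((w - z)^-1 * (f w - f z - l * (w - z))).
  have -> : (w - z)^-1 *: (f w - f z) = (w - z)^-1 * (f w - f z) by [].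
  by field.
by rewrite cabsN cabsM cabsV mulrC ler_pdivrMr ?cabs_gt0.
Qed.

(** ** Mean value inequalities *)

(** The bound, with [C + e] for [C], is inherited by unions of adjacent
    intervals, and the derivative provides it near each point. *)
Lemma mean_value (F f : R[i] -> R[i]) (C : R) :
  (forall s : R, 0 <= s <= 1 -> has_deriv F s%:C (f s%:C) /\ cabs (f s%:C) <= C) ->
  cabs (F 1 - F 0) <= C.
Proof.
move=> h; apply/ler_addgt0Pr => e e0.
have : cabs (F (1 : R)%:C - F (0 : R)%:C) <= (C + e) * (1 - 0).
  apply: (@cousin R 0 1 (fun x y => cabs (F y%:C - F x%:C) <= (C + e) * (y - x))) => //.
    by move=> x y z _ _ _ _ xy yz; have := cabs_tri (F z%:C) (F y%:C) (F x%:C); lra.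
  move=> p p01; have [Fp fp] := h _ p01.
  have [r r0 hr] := Fp _ e0; exists r => // x y x0 xp py y1 yx.
  have {}hr (t : R) : x <= t -> t <= y ->
      cabs (F t%:C - F p%:C) <= (C + e) * `|t - p|.
    move=> xt ty; have tp : `|t - p| < r by rewrite ltr_norml; lra.
    have := hr t%:C; rewrite -rmorphB cabs_real => /(_ tp) {}hr.
    have := cabsD (F t%:C - F p%:C - f p%:C * (t - p)%:C) (f p%:C * (t - p)%:C).
    rewrite subrK cabsM cabs_real.
    have : cabs (f p%:C) * `|t - p| <= C * `|t - p| by rewrite ler_wpM2r.
    by lra.
  have h1 : cabs (F y%:C - F p%:C) <= (C + e) * (y - p).
    by rewrite -[y - p]ger0_norm ?hr//; lra.
  have h2 : cabs (F p%:C - F x%:C) <= (C + e) * (p - x).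
    by rewrite cabsB -[p - x]ger0_norm ?(distrC p) ?hr//; lra.
  have := cabs_tri (F y%:C) (F p%:C) (F x%:C); lra.
by rewrite subr0 mulr1.
Qed.

Lemma mean_value_segment (F f : R[i] -> R[i]) (a b : R[i]) (C : R) :
  (forall s : R, 0 <= s <= 1 -> has_deriv F (a + (b - a) * s%:C) (f s%:C) /\
     cabs (f s%:C) <= C) ->
  cabs (F b - F a) <= C * cabs (b - a).
Proof.
move=> h.
have := @mean_value (fun s => F (a + (b - a) * s)) (fun s => f s * (b - a))
  (C * cabs (b - a)).
rewrite mulr1 mulr0 addr0 (addrC a) subrK; apply=> s /h[h1 h2]; split.
  exact: has_deriv_affine.
by rewrite cabsM ler_wpM2r ?cabs_ge0.
Qed.

(** In the order of the complex numbers [0 <= z] implies that [z] is real, so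
    the imaginary part of the increment has to be controlled as well. *)
Lemma increasing_of_deriv (F f : R[i] -> R[i]) (a b : R) : a <= b ->
  (forall s : R, a <= s <= b -> has_deriv F s%:C (f s%:C) /\ 0 <= f s%:C) ->
  0 <= F b%:C - F a%:C.
Proof.
move=> ab h.
have key e : 0 < e -> - (e * (b - a)) <= Re (F b%:C - F a%:C) /\
    `|Im (F b%:C - F a%:C)| <= e * (b - a).
  move=> e0.
  apply: (@cousin R a b (fun x y => - (e * (y - x)) <= Re (F y%:C - F x%:C) /\
    `|Im (F y%:C - F x%:C)| <= e * (y - x))) => //.
    move=> x y z _ _ _ _; rewrite !raddfB /= => -[r1 i1] [r2 i2]; split; first by lra.
    have := ler_normD (Im (F z%:C) - Im (F y%:C)) (Im (F y%:C) - Im (F x%:C)).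
    by rewrite addrA subrK; lra.
  move=> p p01; have [Fp fp] := h _ p01.
  have [r r0 hr] := Fp _ e0; exists r => // x y x0 xp py y1 yx.
  have fpE : f p%:C = (Re (f p%:C))%:C by rewrite RRe_real// ger0_real.
  have {}fp : 0 <= Re (f p%:C) by move: fp; rewrite {1}fpE lecR.
  have {}hr (t : R) : x <= t -> t <= y ->
      cabs (F t%:C - F p%:C - (Re (f p%:C) * (t - p))%:C) <= e * `|t - p|.
    move=> xt ty; have tp : `|t - p| < r by rewrite ltr_norml; lra.
    have := hr t%:C; rewrite -rmorphB cabs_real => /(_ tp).
    by rewrite rmorphM /= -fpE.
  have Imh (t : R) : x <= t -> t <= y -> `|Im (F t%:C) - Im (F p%:C)| <= e * `|t - p|.
    move=> xt ty; have := le_trans (Im_le_cabs _) (hr t xt ty).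
    by rewrite !raddfB /= subr0.
  have Reh (t : R) : x <= t -> t <= y ->
      `|Re (F t%:C) - Re (F p%:C) - Re (f p%:C) * (t - p)| <= e * `|t - p|.
    move=> xt ty; have := le_trans (Re_le_cabs _) (hr t xt ty).
    by rewrite !raddfB.
  have xy : x <= y by lra.
  have /= := Imh _ (lexx x) xy; have /= := Imh _ xy (lexx y).
  have /= := Reh _ (lexx x) xy; have /= := Reh _ xy (lexx y).
  rewrite (ger0_norm (_ : 0 <= y - p)) ?subr_ge0// (ler0_norm (_ : x - p <= 0)) ?subr_le0//.
  rewrite !ler_norml !raddfB /=.
  have m1 : 0 <= Re (f p%:C) * (y - p) by rewrite mulr_ge0// subr_ge0.
  have m2 : 0 <= Re (f p%:C) * (p - x) by rewrite mulr_ge0// subr_ge0.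
  by move=> ? ? ? ?; split; lra.
have ba : 0 < b - a + 1 by lra.
have E (e : R) : 0 < e -> e / (b - a + 1) * (b - a) <= e.
  move=> e0; rewrite mulrAC ler_pdivrMr// ler_wpM2l//; [exact: ltW|lra].
rewrite lecE; apply/andP; split.
  rewrite -normr_eq0 eq_le normr_ge0 andbT; apply/ler_addgt0Pr => e e0.
  have [|_] := key (e / (b - a + 1)); first by rewrite divr_gt0.
  by rewrite add0r => /le_trans; apply; exact: E.
apply/ler_addgt0Pr => e e0.
have [|+ _] := key (e / (b - a + 1)); first by rewrite divr_gt0.
by have := E _ e0; rewrite /=; lra.
Qed.

End derivatives.

(** * Roots of unity *)

Section limits.
Variable R : realType.

Lemma expr_small (x e : R) : 0 <= x < 1 -> 0 < e ->
  exists n, forall i, (n <= i)%N -> x ^+ i <= e.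
Proof.
move=> /andP[x0 x1] e0.
have /cvgrPdist_le/(_ _ e0)[n _ h] : x ^+ n @[n --> \oo] --> (0 : R).
  by apply: cvg_expr; rewrite ger0_norm.
exists n => i /h; rewrite sub0r normrN ger0_norm// exprn_ge0//.
Qed.

Lemma ratio_small (C e : R) : 0 < e ->
  exists n, forall i, (n <= i)%N -> (0 < i)%N -> C / i%:R <= e.
Proof.
move=> e0; exists (Num.bound `|C / e|) => i ni i0.
have i0' : (0 : R) < i%:R by rewrite ltr0n.
rewrite ler_pdivrMr// mulrC -ler_pdivrMr// (le_trans (ler_norm _))//.
by rewrite (le_trans (ltW (archi_boundP (normr_ge0 _))))// ler_nat.
Qed.

End limits.

Section roots_of_unity.
Variable R : realType.
Implicit Types (x y : R) (n k : nat).

Definition cis x : R[i] := cos x +i* sin x.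

Lemma cisD x y : cis (x + y) = cis x * cis y.
Proof. by rewrite /cis cosD sinD; apply/eqP; rewrite eq_complex /= eqxx addrC eqxx. Qed.

Lemma cis0 : cis 0 = 1.
Proof. by rewrite /cis cos0 sin0. Qed.

Lemma cisX x n : cis x ^+ n = cis (x * n%:R).
Proof.
elim: n => [|n ih]; first by rewrite mulr0 cis0.
by rewrite exprS ih -cisD; congr cis; rewrite -[n.+1]add1n natrD mulrDr mulr1.
Qed.

Lemma cabs_cis x : cabs (cis x) = 1.
Proof. by rewrite cabs_sqrt /= cos2Dsin2 sqrtr1. Qed.

Lemma cis2pi : cis (2 * pi) = 1.
Proof. by rewrite mulr_natl /cis cos2pi sin2pi. Qed.

Lemma cis_neq1 x : 0 < x < 2 * pi -> cis x != 1.
Proof.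
move=> /andP[x0 x1]; apply/eqP => -[+ _].
have -> : x = (x / 2) *+ 2 by lra.
rewrite cos_mulr2n; have := cos2Dsin2 (x / 2).
have : 0 < sin (x / 2) by apply: sin_gt0_pi; lra.
by move=> /(exprn_gt0 2); lra.
Qed.

Lemma sin_le x : 0 <= x -> `|sin x| <= x.
Proof.
move=> x0; have [|c cx] := @MVT_segment R sin cos 0 x x0.
  by apply: continuous_subspaceT => ?; exact: continuous_sin.
rewrite sin0 !subr0 => ->; rewrite normrM (ger0_norm x0) ler_piMl//.
exact: cos_max.
Qed.

Lemma cos_ge x : 0 <= x -> 1 - x ^+ 2 / 2 <= cos x.
Proof.
move=> x0; have -> : x = (x / 2) *+ 2 by lra.
rewrite cos_mulr2n; have := cos2Dsin2 (x / 2).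
have /sin_le h : 0 <= x / 2 by rewrite divr_ge0.
have : `|sin (x / 2)| ^+ 2 <= (x / 2) ^+ 2 by rewrite lerXn2r// nnegrE divr_ge0.
rewrite real_normK ?num_real//.
have -> : x / 2 *+ 2 = x by lra.
nra.
Qed.

Lemma sin_near x : 0 <= x <= 1 -> `|sin x - x| <= x ^+ 2.
Proof.
move=> /andP[x0 x1]; have [|c cx] := @MVT_segment R sin cos 0 x x0.
  by apply: continuous_subspaceT => ?; exact: continuous_sin.
rewrite sin0 !subr0 => ->; move: cx; rewrite in_itv /= => /andP[c0 cx].
have := cos_ge c0; have := cos_le1 c.
have : c ^+ 2 <= x ^+ 2 by rewrite lerXn2r// nnegrE.
move=> h1 h2 h3; rewrite ler_norml.
have h4 : x ^+ 2 <= x by rewrite expr2 ler_piMr.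
by apply/andP; split; nra.
Qed.

Lemma cis_near x : 0 <= x <= 1 -> cabs (cis x - 1 - 'i%C * x%:C) <= 2 * x ^+ 2.
Proof.
move=> x01; have -> : cis x - 1 - 'i%C * x%:C = (cos x - 1) +i* (sin x - x).
  by rewrite /cis; simpc.
rewrite (le_trans (cabs_le _))//=.
have := sin_near x01; case/andP: x01 => x0 x1.
have := cos_ge x0; have := cos_le1 x => h1 h2 h3.
have -> : `|cos x - 1| = 1 - cos x by rewrite distrC ger0_norm// subr_ge0.
nra.
Qed.

Lemma cis_lip x y : cabs (cis x - cis y) <= 2 * `|x - y|.
Proof.
wlog xy : x y / y <= x.
  move=> h; have [/h//|/ltW/h] := leP y x.
  by rewrite cabsB distrC.
have d0 : 0 <= x - y by rewrite subr_ge0.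
have -> : cis x = cis y * cis (x - y) by rewrite -cisD addrCA subrr addr0.
rewrite -[X in cabs (_ - X)]mulr1 -mulrBr cabsM cabs_cis mul1r (ger0_norm d0).
set t := x - y in d0 *.
rewrite (le_trans (cabs_le _))// !raddfB /= subr0.
have := sin_le d0; have := cos_ge d0; have := cos_le1 t => h1 h2 h3.
have -> : `|cos t - 1| = 1 - cos t by rewrite distrC ger0_norm// subr_ge0.
have := cos_geN1 t => h4.
have [t1|t1] := leP t 2; nra.
Qed.

(** The primitive root exp (2 pi i / n). *)
Definition rou n : R[i] := cis (2 * pi / n%:R).

Lemma cabs_rou n : cabs (rou n) = 1.
Proof. exact: cabs_cis. Qed.

Lemma rou_neq0 n : rou n != 0.
Proof. by rewrite -cabs_gt0 cabs_rou. Qed.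

Lemma rouX n : (0 < n)%N -> rou n ^+ n = 1.
Proof.
move=> n0; rewrite cisX divfK ?cis2pi//.
by rewrite pnatr_eq0 -lt0n.
Qed.

Lemma rou_prim n k : (0 < k < n)%N -> rou n ^+ k != 1.
Proof.
move=> /andP[k0 kn]; rewrite cisX; apply: cis_neq1.
have n0 : (0 : R) < n%:R by rewrite ltr0n (ltn_trans k0).
have k0' : (0 : R) < k%:R by rewrite ltr0n.
have kn' : k%:R < n%:R :> R by rewrite ltr_nat.
have p0 := @pi_gt0 R; rewrite mulrAC.
apply/andP; split; first by rewrite !mulr_gt0// invr_gt0.
rewrite ltr_pdivrMr// ltr_pM2l//; lra.
Qed.

Lemma sum_root n (w : R[i]) k : w ^+ n = 1 -> w ^+ k != 1 ->
  \sum_(j < n) (w ^+ j) ^+ k = 0.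
Proof.
move=> wn; rewrite -subr_eq0 => h; apply: (mulfI h).
under eq_bigr do rewrite -exprM mulnC exprM.
by rewrite -subrX1 -exprM mulnC exprM wn expr1n subrr mulr0.
Qed.

Lemma rou_lim e : 0 < e -> exists n0, forall n, (n0 <= n)%N -> (0 < n)%N ->
  cabs (rou n - 1) <= e.
Proof.
move=> e0; have [n0 h] := ratio_small (2 * (2 * pi)) e0.
exists n0 => n /h + n0'; move=> /(_ n0').
rewrite -cis0 => h'; apply: le_trans (cis_lip _ _) _; rewrite subr0.
have p0 : 0 <= 2 * pi / n%:R :> R by rewrite divr_ge0 ?mulr_ge0 ?pi_ge0.
by rewrite ger0_norm// mulrA.
Qed.

(** The derivative of [cis] at 0: this is where the factor 2 pi i of all contour
    integrals comes from. *)
Lemma rou_lim_deriv e : 0 < e -> exists n0, forall n, (n0 <= n)%N -> (0 < n)%N ->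
  cabs (n%:R * (rou n - 1) - two_pi_i R) <= e.
Proof.
move=> e0; have p0 := @pi_gt0 R.
have [n0 h0] := @ratio_small R (2 * pi) 1 ltr01.
have [n1 h1] := ratio_small (2 * (2 * pi) ^+ 2) e0.
exists (maxn n0 n1) => n; rewrite geq_max => /andP[/h0 {}h0 /h1 {}h1] n0'.
have n0'' : (0 : R) < n%:R by rewrite ltr0n.
have := @cis_near (2 * pi / n%:R); rewrite h0// andbT divr_ge0 ?mulr_ge0 ?pi_ge0//.
move=> /(_ isT) h.
have -> : n%:R * (rou n - 1) - two_pi_i R =
    n%:R * (cis (2 * pi / n%:R) - 1 - 'i%C * (2 * pi / n%:R)%:C).
  rewrite /two_pi_i /rou [RHS]mulrBr; congr (_ - _).
  rewrite mulrCA mulrC -(rmorph_nat (real_complex R) n) -rmorphM /=; congr (_ * _%:C).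
  by field; rewrite gt_eqF.
rewrite cabsM cabs_nat (le_trans _ (h1 n0'))//.
rewrite (le_trans (ler_wpM2l (ltW n0'') h))//.
have -> : n%:R * (2 * (2 * pi / n%:R) ^+ 2) = 2 * (2 * pi) ^+ 2 / n%:R :> R.
  by field; rewrite gt_eqF.
by [].
Qed.

(** The averaging identity over the roots of unity. It is used for complex
    numbers, where it computes winding numbers and Cauchy integrals of
    constants, and in Banach algebras, where it replaces the complex analysis
    in the spectral radius formula. *)
Lemma mean_root (A : unitAlgType R[i]) n (w : R[i]) (y : A) : (0 < n)%N ->
  w ^+ n = 1 -> (forall k, (0 < k < n)%N -> w ^+ k != 1) ->
  (forall j, (j < n)%N -> 1 - w ^+ j *: y \is a GRing.unit) ->
  1 - y ^+ n \is a GRing.unit /\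
  (n%:R : R[i])^-1 *: \sum_(j < n) (1 - w ^+ j *: y)^-1 = (1 - y ^+ n)^-1.
Proof.
move=> n0 wn hw hu; set Z := \sum_(j < n) _.
have geo j : (1 - w ^+ j *: y) * (\sum_(k < n) (w ^+ j *: y) ^+ k) = 1 - y ^+ n.
  have := subrX1 (w ^+ j *: y) n.
  rewrite exprZn -exprM mulnC exprM wn expr1n scale1r => /(congr1 -%R).
  by rewrite -mulNr !opprB.
have E1 j : (j < n)%N -> (1 - w ^+ j *: y)^-1 * (1 - y ^+ n) =
    \sum_(k < n) (w ^+ j *: y) ^+ k.
  by move=> jn; rewrite -(geo j) mulKr// hu.
have E2 : Z * (1 - y ^+ n) = n%:R.
  rewrite mulr_suml (eq_bigr (fun j : 'I_n => \sum_(k < n) (w ^+ j *: y) ^+ k)).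
    rewrite exchange_big /=; case: n n0 wn hw {hu Z geo E1} => // n _ wn hw.
    rewrite big_ord_recl [X in _ + X]big1 ?addr0.
      under eq_bigr do rewrite expr0.
      by rewrite sumr_const card_ord.
    move=> k _; under eq_bigr do rewrite exprZn.
    rewrite -scaler_suml sum_root ?scale0r//.
    by apply: hw; rewrite lift0 /= ltnS ltn_ord.
  by move=> j _; rewrite E1.
have c j : GRing.comm (1 - y ^+ n) (1 - w ^+ j *: y)^-1.
  have cy : GRing.comm (1 - y ^+ n) y.
    by apply/commr_sym/commrB; [exact: commr1|exact: commrX].
  apply/commrV/commrB; first exact: commr1.
  by rewrite /GRing.comm -scalerAr -scalerAl cy.
have cZ : GRing.comm (1 - y ^+ n) Z by apply: commr_sum => j _; exact: c.
have n0' : (n%:R : R[i]) \is a GRing.unit by rewrite unitfE pnatr_eq0 -lt0n.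
have E3 : ((n%:R : R[i])^-1 *: Z) * (1 - y ^+ n) = 1.
  by rewrite -scalerAl E2 -(scaler_nat n (1 : A)) scalerA mulVr// scale1r.
have E4 : (1 - y ^+ n) * ((n%:R : R[i])^-1 *: Z) = 1.
  by rewrite -scalerAr cZ E2 -(scaler_nat n (1 : A)) scalerA mulVr// scale1r.
have U : 1 - y ^+ n \is a GRing.unit by apply/unitrP; exists ((n%:R : R[i])^-1 *: Z).
split=> //; apply: (mulIr U); by rewrite E3 mulVr.
Qed.

(** The discrete counterpart of the integral of 1 / (z - u) over the unit
    circle: the right-hand side tends to 1 if [u] is inside of the circle, and
    to 0 if it is outside. *)
Lemma mean_kernel n (u : R[i]) : (0 < n)%N -> cabs u != 1 ->
  n%:R^-1 * \sum_(j < n) (rou n ^+ j / (rou n ^+ j - u)) = (1 - u ^+ n)^-1.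
Proof.
move=> n0 u1.
have hz j : rou n ^+ j - u != 0.
  rewrite subr_eq0; apply: contra u1 => /eqP <-.
  by rewrite cabsX cabs_rou expr1n.
have zj j : rou n ^+ j != 0 by rewrite expf_neq0// rou_neq0.
have E j : rou n ^+ j - u = rou n ^+ j * (1 - (rou n)^-1 ^+ j *: (u : R[i])).
  by rewrite [_ *: _]/(_ * _) mulrBr mulr1 exprVn mulrA divff ?mul1r.
have [|||_ <-] := @mean_root R[i] n (rou n)^-1 u n0.
- by rewrite exprVn rouX// invr1.
- by move=> k kn; rewrite exprVn invr_eq1 rou_prim.
- by move=> j jn; rewrite unitfE; have := hz j; rewrite E mulf_eq0 negb_or => /andP[].
congr (_ * _); apply: eq_bigr => j _; rewrite E invfM mulrA divff ?mul1r//.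
Qed.

End roots_of_unity.

Section inverse_power_limits.
Variable R : realType.
Implicit Types u : R[i].

Lemma inv_power_lim_in u : cabs u < 1 ->
  tends_to (@cabs R) (fun n => (1 - u ^+ n)^-1) 1.
Proof.
move=> u1 e e0.
have [||n0 hn0] := @expr_small R (cabs u) (Num.min (e / 2) (1 / 2)).
- by rewrite cabs_ge0.
- by rewrite lt_min; apply/andP; split; lra.
exists n0 => n /hn0; rewrite -cabsX le_min => /andP[h1 h2].
have h3 : 1 / 2 <= cabs (1 - u ^+ n).
  by have := cabs_dist 1 (u ^+ n); rewrite cabs1; lra.
have h4 : 1 - u ^+ n != 0 by rewrite -cabs_gt0; lra.
have -> : (1 - u ^+ n)^-1 - 1 = u ^+ n / (1 - u ^+ n) by field.
rewrite cabsM cabsV ler_pdivrMr ?cabs_gt0//.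
have : e * (1 / 2) <= e * cabs (1 - u ^+ n) by rewrite ler_wpM2l// ltW.
lra.
Qed.

(** Since [1 / (1 - x) = 1 - 1 / (1 - 1 / x)]. *)
Lemma inv_power_lim_out u : 1 < cabs u ->
  tends_to (@cabs R) (fun n => (1 - u ^+ n)^-1) 0.
Proof.
move=> u1 e e0.
have u0 : u != 0 by rewrite -cabs_gt0; lra.
have ui : cabs u^-1 < 1 by rewrite cabsV invf_lt1//; lra.
have [n0 hn0] := inv_power_lim_in ui e0.
exists (maxn n0 1) => n; rewrite geq_max => /andP[/hn0 + n1]; case: n n1 => // n _ h.
rewrite subr0.
have un : u ^+ n.+1 != 0 by rewrite expf_neq0.
have un1 : u ^+ n.+1 - 1 != 0.
  rewrite subr_eq0; apply/eqP => /(congr1 (@cabs R)); rewrite cabsX cabs1.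
  by apply/eqP; rewrite gt_eqF// exprn_egt1.
have un2 : 1 - u ^+ n.+1 != 0 by rewrite -opprB oppr_eq0.
have E : (1 - u^-1 ^+ n.+1)^-1 - 1 = - (1 - u ^+ n.+1)^-1.
  rewrite exprVn; have -> : 1 - (u ^+ n.+1)^-1 = (u ^+ n.+1 - 1) / u ^+ n.+1 by field.
  by field; rewrite ?un ?un1 ?un2.
by move: h; rewrite E cabsN.
Qed.

End inverse_power_limits.

(** * Goursat's theorem and primitives *)

Lemma two_neq0 (R : realType) : (2 : R[i]) != 0.
Proof. by rewrite pnatr_eq0. Qed.

Section segment_integral.
Variable R : realType.
Implicit Types (f : R[i] -> R[i]) (a b c z w p : R[i]) (D : R[i] -> Prop).

(** Dyadic trapezoid sums. They are additive at the midpoint, odd under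
    reversal, and exact on affine functions at every level, which is all that
    Goursat's argument requires of the integral. *)
Fixpoint trapezoid f n a b : R[i] :=
  if n is n'.+1 then
    trapezoid f n' a ((a + b) / 2) + trapezoid f n' ((a + b) / 2) b
  else (b - a) * ((f a + f b) / 2).

Lemma trapezoid_rev f n a b : trapezoid f n b a = - trapezoid f n a b.
Proof.
elim: n a b => [|n ih] a b /=; first by ring.
by rewrite (addrC b a) (ih ((a + b) / 2) b) (ih a); ring.
Qed.

Definition midconvex D := forall a b, D a -> D b -> D ((a + b) / 2).

Lemma cabs_half z : cabs (z / 2) = cabs z / 2.
Proof. by rewrite cabsM cabsV cabs_nat. Qed.

Lemma trapezoid_est f n a b D (al be : R[i]) (e : R) : midconvex D ->
  D a -> D b -> (forall z, D z -> cabs (f z - (al + be * z)) <= e) ->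
  cabs (trapezoid f n a b - (al + be * ((a + b) / 2)) * (b - a)) <= e * cabs (b - a).
Proof.
move=> cD + + h; have h2 := @two_neq0 R.
elim: n a b => [|n ih] a b Da Db /=.
  have -> : (b - a) * ((f a + f b) / 2) - (al + be * ((a + b) / 2)) * (b - a) =
     ((f a - (al + be * a)) + (f b - (al + be * b))) / 2 * (b - a) by field.
  rewrite cabsM ler_wpM2r ?cabs_ge0// cabs_half.
  have := cabsD (f a - (al + be * a)) (f b - (al + be * b)).
  by have := h _ Da; have := h _ Db; lra.
have Dm : D ((a + b) / 2) by exact: cD.
have := ih _ _ Da Dm; have := ih _ _ Dm Db.
set m := (a + b) / 2; have -> : b - m = (b - a) / 2 by rewrite /m; field.
have -> : m - a = (b - a) / 2 by rewrite /m; field.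
rewrite cabs_half => h3 h4.
have -> : trapezoid f n a m + trapezoid f n m b - (al + be * m) * (b - a) =
  (trapezoid f n a m - (al + be * ((a + m) / 2)) * ((b - a) / 2)) +
  (trapezoid f n m b - (al + be * ((m + b) / 2)) * ((b - a) / 2)).
  by rewrite /m; field.
by apply: (le_trans (cabsD _ _)); lra.
Qed.

Lemma midconvex_ball p (r : R) : midconvex (fun z => cabs (z - p) <= r).
Proof.
move=> a b ha hb; have -> : (a + b) / 2 - p = (a - p) / 2 + (b - p) / 2.
  by have := @two_neq0 R => ?; field.
by rewrite (le_trans (cabsD _ _))// !cabs_half; lra.
Qed.

Lemma pow2_large (x : R) : exists n, x <= 2 ^+ n.
Proof.
exists (Num.bound `|x|); rewrite (le_trans (ler_norm _))//.
rewrite (le_trans (ltW (archi_boundP (normr_ge0 _))))//.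
by rewrite -natrX ler_nat ltnW// ltn_expl.
Qed.

Definition segment_pt a b (s : R) := a + s%:C * (b - a).

(** On a piece so short that [f] varies by at most [e1], a dyadic sum of any level
    differs from a value of [f] times the increment by at most [e1] times the
    length. These errors add up to a multiple of the length of the segment. *)
Lemma trapezoid_cauchy f a b :
  (forall s, 0 <= s <= 1 -> cont_at f (segment_pt a b s)) ->
  cauchy_sequence (@cabs R) (fun n => trapezoid f n a b).
Proof.
move=> cf e e0.
have ab0 := cabs_ge0 (b - a).
have K1 : 0 < 4 * (cabs (b - a) + 1) by lra.
pose e1 := e / (4 * (cabs (b - a) + 1)).
have e10 : 0 < e1 by rewrite divr_gt0.
pose pt := segment_pt a b.
have [d d0 hd] : exists2 d : R, 0 < d & forall s t, 0 <= s <= 1 -> 0 <= t <= 1 ->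
    `|s - t| < d -> cabs (f (pt s) - f (pt t)) <= e1.
  have [|d d0 hd] := @lebesgue_number R R `[0, 1] (fun s t => 0 <= s <= 1 ->
      0 <= t <= 1 -> cabs (f (pt s) - f (pt t)) <= e1) (@segment_compact _ _ _).
    move=> s; rewrite /= in_itv /= => s01.
    have [|r r0 hr] := cf s s01 (e1 / 2); first by rewrite divr_gt0.
    exists (r / (cabs (b - a) + 1)); first by rewrite divr_gt0//; lra.
    have near u : ball s (r / (cabs (b - a) + 1)) u ->
        cabs (f (pt u) - f (pt s)) <= e1 / 2.
      rewrite /ball /= ltr_pdivlMr; last by lra.
      move=> su; apply: hr; rewrite /segment_pt.
      have -> : a + u%:C * (b - a) - (a + s%:C * (b - a)) = (u - s)%:C * (b - a) by ring.
      by rewrite cabsM cabs_real distrC; have := normr_ge0 (s - u); lra.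
    move=> x y /near hx /near hy _ _.
    by have := cabs_tri (f (pt x)) (f (pt s)) (f (pt y)); rewrite (cabsB (f (pt s))); lra.
  exists d => // s t s01 t01 st; apply: hd => //; by rewrite /= in_itv.
have loc n s t : 0 <= s -> s <= t -> t <= 1 -> t - s < d ->
    cabs (trapezoid f n (pt s) (pt t) - f (pt s) * (pt t - pt s)) <=
    e1 * ((t - s) * cabs (b - a)).
  move=> s0 st t1 tsd.
  have := @trapezoid_est f n (pt s) (pt t) (fun z => exists2 u, s <= u <= t & z = pt u)
     (f (pt s)) 0 e1.
  rewrite mul0r addr0; have -> : pt t - pt s = (t - s)%:C * (b - a).
    by rewrite /pt /segment_pt; ring.
  rewrite [cabs (_%:C * _)]cabsM cabs_real (ger0_norm (_ : 0 <= t - s)) ?subr_ge0//.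
  apply.
  - move=> _ _ [u us ->] [v vs ->]; exists ((u + v) / 2); first by lra.
    rewrite /pt /segment_pt fmorph_div/= rmorphD /= rmorph_nat.
    by have := @two_neq0 R => ?; field.
  - by exists s => //; rewrite lexx.
  - by exists t => //; rewrite lexx andbT.
  - by move=> z [u us ->]; rewrite mul0r addr0; apply: hd; rewrite ?ger0_norm; lra.
have key N : forall s t k, 0 <= s -> s <= t -> t <= 1 -> t - s < 2 ^+ N * d ->
    cabs (trapezoid f (N + k) (pt s) (pt t) - trapezoid f N (pt s) (pt t)) <=
    2 * (e1 * ((t - s) * cabs (b - a))).
  elim: N => [|N ih] s t k s0 st t1 tsd.
    rewrite expr0 mul1r in tsd; rewrite add0n.
    have := loc k _ _ s0 st t1 tsd; have := loc 0%N _ _ s0 st t1 tsd.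
    set X := f _ * _; have := cabs_tri (trapezoid f k (pt s) (pt t)) X (trapezoid f 0 (pt s) (pt t)).
    by rewrite (cabsB X); lra.
  rewrite exprS in tsd; rewrite addSn /=.
  have -> : (pt s + pt t) / 2 = pt ((s + t) / 2).
    rewrite /pt /segment_pt fmorph_div/= rmorphD /= rmorph_nat.
    by have := @two_neq0 R => ?; field.
  have [A1 A2 A3 A4] : [/\ s <= (s + t) / 2, (s + t) / 2 <= t, (s + t) / 2 <= 1
    & 0 <= (s + t) / 2] by split; lra.
  have A5 : (s + t) / 2 - s < 2 ^+ N * d by lra.
  have A6 : t - (s + t) / 2 < 2 ^+ N * d by lra.
  have h1 := ih _ _ k s0 A1 A3 A5.
  have h2 := ih _ _ k A4 A2 t1 A6.
  rewrite opprD addrACA; apply: (le_trans (cabsD _ _)).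
  apply: (le_trans (lerD h1 h2)).
  by rewrite le_eqVlt; apply/orP; left; apply/eqP; field.
have [N hN] := pow2_large (2 / d).
have {}hN : 1 < 2 ^+ N * d by move: hN; rewrite ler_pdivrMr//; lra.
have ptE : pt 0 = a /\ pt 1 = b by rewrite /pt /segment_pt; split; ring.
have {}key k : cabs (trapezoid f (N + k) a b - trapezoid f N a b) <= e / 2.
  have := @key N 0 1 k; rewrite ptE.1 ptE.2 !subr0 mul1r => /(_ _ _ _ _)/le_trans; apply=> //.
  have : e1 * (cabs (b - a) + 1) = e / 4.
    by rewrite /e1; field; rewrite gt_eqF//; lra.
  by lra.
exists N => i j /subnKC <- /subnKC <-.
have := key (i - N)%N; have := key (j - N)%N.
have := cabs_tri (trapezoid f (N + (i - N)) a b) (trapezoid f N a b) (trapezoid f (N + (j - N)) a b).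
by rewrite (cabsB (trapezoid f N a b)); lra.
Qed.

Definition segment_int f a b : R[i] :=
  xget 0 [set l | tends_to (@cabs R) (fun n => trapezoid f n a b) l].

Lemma tends_toD (u v : nat -> R[i]) x y : tends_to (@cabs R) u x ->
  tends_to (@cabs R) v y -> tends_to (@cabs R) (fun n => u n + v n) (x + y).
Proof.
move=> ux vy e e0; have [|n1 h1] := ux (e / 2); first by lra.
have [|n2 h2] := vy (e / 2); first by lra.
exists (maxn n1 n2) => i; rewrite geq_max => /andP[/h1 {}h1 /h2 {}h2].
have -> : u i + v i - (x + y) = (u i - x) + (v i - y) by ring.
by apply: (le_trans (cabsD _ _)); lra.
Qed.

Lemma tends_toN (u : nat -> R[i]) x : tends_to (@cabs R) u x ->
  tends_to (@cabs R) (fun n => - u n) (- x).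
Proof. by move=> ux e /ux[n h]; exists n => i /h; rewrite -opprD cabsN. Qed.

Lemma tends_to_le (u : nat -> R[i]) x y (B : R) : tends_to (@cabs R) u x ->
  (forall n, cabs (u n - y) <= B) -> cabs (x - y) <= B.
Proof.
move=> ux h; apply/ler_addgt0Pr => e /ux[n /(_ _ (leqnn _))].
by have := h n; have := cabs_tri x (u n) y; rewrite (cabsB x (u n)); lra.
Qed.

End segment_integral.

Section goursat.
Variables (R : realType) (f f' : R[i] -> R[i]) (p0 : R[i]) (r : R).
Let U z := cabs (z - p0) <= r.
Hypothesis df : forall z, U z -> has_deriv f z (f' z).
Let I := segment_int f.
Local Notation mid a b := ((a + b) / 2).
Implicit Types a b c : R[i].

Let U_segment a b (s : R) : U a -> U b -> 0 <= s <= 1 -> U (segment_pt a b s).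
Proof.
rewrite /U => Ua Ub s01.
have -> : segment_pt a b s - p0 = (1 - s)%:C * (a - p0) + s%:C * (b - p0).
  by rewrite /segment_pt; ring.
apply: (le_trans (cabsD _ _)); rewrite !cabsM !cabs_real !ger0_norm; [|lra|lra].
have : (1 - s) * cabs (a - p0) <= (1 - s) * r by rewrite ler_wpM2l//; lra.
have : s * cabs (b - p0) <= s * r by rewrite ler_wpM2l//; lra.
lra.
Qed.

Let U_mid a b : U a -> U b -> U (mid a b).
Proof. exact: midconvex_ball. Qed.

Let I_lim a b : U a -> U b -> tends_to (@cabs R) (fun n => trapezoid f n a b) (I a b).
Proof.
move=> Ua Ub; rewrite /I /segment_int; case: xgetP => // abs.
have [|l hl] := cn_complete (cabs_complete R) (@trapezoid_cauchy R f a b _).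
  by move=> s s01; apply: has_deriv_cont (df _); exact: U_segment.
by case: (abs l).
Qed.

Let uniq_lim := tends_to_unique (cabs_complete R).

Let I_rev a b : U a -> U b -> I b a = - I a b.
Proof.
move=> Ua Ub; apply: uniq_lim (I_lim Ub Ua) _.
have := tends_toN (I_lim Ua Ub).
by under [X in tends_to _ X]eq_fun do rewrite -trapezoid_rev.
Qed.

Let I_mid a b : U a -> U b -> I a b = I a (mid a b) + I (mid a b) b.
Proof.
move=> Ua Ub; have Um := U_mid Ua Ub.
apply: uniq_lim (tends_toD (I_lim Ua Um) (I_lim Um Ub)) => e.
by move=> /(I_lim Ua Ub)[n h]; exists n => i ni; rewrite -/(trapezoid f i.+1 a b) h// leqW.
Qed.

Let I_est a b D (al be : R[i]) (e : R) : U a -> U b -> midconvex D ->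
  D a -> D b -> (forall z, D z -> cabs (f z - (al + be * z)) <= e) ->
  cabs (I a b - (al + be * (mid a b)) * (b - a)) <= e * cabs (b - a).
Proof.
move=> Ua Ub cD Da Db h; apply: tends_to_le (I_lim Ua Ub) _ => n.
exact: trapezoid_est cD Da Db h.
Qed.

Let T (t : R[i] * R[i] * R[i]) := let: (a, b, c) := t in I a b + I b c + I c a.

Let good (e : R) (td : (R[i] * R[i] * R[i]) * R) := let: ((a, b, c), d) := td in
  [/\ U a, U b & U c] /\
  [/\ cabs (b - a) <= d, cabs (c - b) <= d, cabs (a - c) <= d & e * d ^+ 2 < cabs (T (a, b, c))].

(** The four triangles cut off by the midpoints of the sides are half as large,
    and their integrals add up to the integral over the given one. *)
Let refine e td : good e td -> exists td' : (R[i] * R[i] * R[i]) * R,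
  [/\ good e td', td'.2 = td.2 / 2 & cabs (td'.1.1.1 - td.1.1.1) <= td.2 / 2].
Proof.
case: td => -[[a b] c] d [[Ua Ub Uc] [ab bc ca big]] /=.
have Uab := U_mid Ua Ub; have Ubc := U_mid Ub Uc; have Uca := U_mid Uc Ua.
have d0 : 0 <= d by apply: le_trans ab; exact: cabs_ge0.
have ac : cabs (c - a) <= d by rewrite cabsB.
have ba : cabs (a - b) <= d by rewrite cabsB.
have cb : cabs (b - c) <= d by rewrite cabsB.
have E : T (a, b, c) = T (a, mid a b, mid c a) + T (mid a b, b, mid b c)
   + T (mid c a, mid b c, c) + T (mid a b, mid b c, mid c a).
  rewrite /T (I_mid Ua Ub) (I_mid Ub Uc) (I_mid Uc Ua).
  rewrite (I_rev Uca Uab) (I_rev Uab Ubc) (I_rev Ubc Uca).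
  ring.
have h2 := @two_neq0 R.
have H z : cabs z <= d -> cabs (z / 2) <= d / 2 by rewrite cabs_half; lra.
have S1 : mid a b - a = (b - a) / 2 by field.
have S2 : mid c a - mid a b = (c - b) / 2 by field.
have S3 : a - mid c a = (a - c) / 2 by field.
have S4 : b - mid a b = (b - a) / 2 by field.
have S5 : mid b c - b = (c - b) / 2 by field.
have S6 : mid a b - mid b c = (a - c) / 2 by field.
have S7 : mid b c - mid c a = (b - a) / 2 by field.
have S8 : c - mid b c = (c - b) / 2 by field.
have S9 : mid c a - c = (a - c) / 2 by field.
have S10 : mid b c - mid a b = (c - a) / 2 by field.
have S11 : mid c a - mid b c = (a - b) / 2 by field.
have S12 : mid a b - mid c a = (b - c) / 2 by field.
have S13 : mid c a - a = (c - a) / 2 by field.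
have [h1|h1] := ltP (e * (d / 2) ^+ 2) (cabs (T (a, mid a b, mid c a))).
  exists ((a, mid a b, mid c a), d / 2); split=> //=.
    by split=> //; split; rewrite ?S1 ?S2 ?S3 ?H.
  by rewrite subrr cabs0; lra.
have [h3|h3] := ltP (e * (d / 2) ^+ 2) (cabs (T (mid a b, b, mid b c))).
  exists ((mid a b, b, mid b c), d / 2); split=> //=.
    by split=> //; split; rewrite ?S4 ?S5 ?S6 ?H.
  by rewrite S1 H.
have [h4|h4] := ltP (e * (d / 2) ^+ 2) (cabs (T (mid c a, mid b c, c))).
  exists ((mid c a, mid b c, c), d / 2); split=> //=.
    by split=> //; split; rewrite ?S7 ?S8 ?S9 ?H.
  by rewrite S13 H.
have [h5|h5] := ltP (e * (d / 2) ^+ 2) (cabs (T (mid a b, mid b c, mid c a))).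
  exists ((mid a b, mid b c, mid c a), d / 2); split=> //=.
    by split=> //; split; rewrite ?S10 ?S11 ?S12 ?H.
  by rewrite S1 H.
exfalso; move: big; rewrite E => big.
have := cabsD (T (a, mid a b, mid c a)) (T (mid a b, b, mid b c)).
have := cabsD (T (a, mid a b, mid c a) + T (mid a b, b, mid b c)) (T (mid c a, mid b c, c)).
have := cabsD (T (a, mid a b, mid c a) + T (mid a b, b, mid b c) + T (mid c a, mid b c, c))
   (T (mid a b, mid b c, mid c a)).
have : e * (d / 2) ^+ 2 = e * d ^+ 2 / 4 by field.
lra.
Qed.

(** Bisection. Triangles with an integral larger than [e * d ^+ 2], for [d] a
    bound on the sides, shrink to a point. The expansion of [f] at this point
    contradicts the lower bound, since the sums are exact on affine
    functions. *)
Lemma goursat a b c : U a -> U b -> U c -> I a b + I b c + I c a = 0.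
Proof.
move=> Ua Ub Uc.
pose d := cabs (b - a) + cabs (c - b) + cabs (a - c).
have d0 : 0 <= d by rewrite !addr_ge0 ?cabs_ge0.
apply: cabs_small => e0 e00.
pose e := e0 / (d ^+ 2 + 1).
have d21 : 0 < d ^+ 2 + 1 by have := sqr_ge0 d; lra.
have e_gt0 : 0 < e by rewrite divr_gt0.
apply: (@le_trans _ _ (e * d ^+ 2)); last first.
  by rewrite /e mulrAC ler_pdivrMr// ler_wpM2l ?(ltW e00)//; lra.
rewrite leNgt; apply/negP => big.
have g0 : good e ((a, b, c), d).
  split=> //; have := cabs_ge0 (b - a); have := cabs_ge0 (c - b); have := cabs_ge0 (a - c).
  by move=> ? ? ?; rewrite /d; split=> //; lra.
have [st hst] : exists st : (R[i] * R[i] * R[i]) * R -> (R[i] * R[i] * R[i]) * R,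
    forall td, good e td -> [/\ good e (st td), (st td).2 = td.2 / 2 &
      cabs ((st td).1.1.1 - td.1.1.1) <= td.2 / 2].
  have h td : exists td', good e td -> [/\ good e td', td'.2 = td.2 / 2 &
      cabs (td'.1.1.1 - td.1.1.1) <= td.2 / 2].
    have [/refine[td' h]|ng] := pselect (good e td); first by exists td'.
    by exists td.
  by have [st hst] := choice h; exists st.
pose s n := iter n st ((a, b, c), d).
have gs n : good e (s n) by elim: n => [//|n ih]; case: (hst _ ih).
have ds n : (s n).2 = d / 2 ^+ n.
  elim: n => [|n ih]; first by rewrite expr0 divr1.
  case: (hst _ (gs n)) => _ -> _; rewrite ih exprS invfM; ring.
pose v n := (s n).1.1.1.
have dv n k : cabs (v (n + k)%N - v n) <= d / 2 ^+ n - d / 2 ^+ (n + k).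
  elim: k => [|k ih]; first by rewrite addn0 !subrr cabs0.
  case: (hst _ (gs (n + k)%N)) => _ _; rewrite -/(s (n + k).+1) -!/(v _) ds addnS => h.
  have := cabs_tri (v (n + k).+1) (v (n + k)%N) (v n).
  have -> : d / 2 ^+ (n + k).+1 = d / 2 ^+ (n + k) / 2 by rewrite exprS invfM; ring.
  lra.
have p2 n : 0 < 2 ^+ n :> R by rewrite exprn_gt0.
have dpos n : 0 <= d / 2 ^+ n by rewrite divr_ge0// ltW.
have dv' n k : cabs (v (n + k)%N - v n) <= d / 2 ^+ n.
  by have := dv n k; have := dpos (n + k)%N; lra.
have dsmall x : 0 < x -> exists n, d / 2 ^+ n <= x.
  move=> x0; have [n hn] := pow2_large (d / x); exists n.
  by move: hn; rewrite !ler_pdivrMr// mulrC.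
have [p vp] : exists p, tends_to (@cabs R) v p.
  apply: (cn_complete (cabs_complete R)) => x x0.
  have [|n hn] := dsmall (x / 2); first by lra.
  exists n => i j /subnKC <- /subnKC <-.
  have := dv' n (i - n)%N; have := dv' n (j - n)%N.
  by have := cabs_tri (v (n + (i - n))%N) (v n) (v (n + (j - n))%N); rewrite (cabsB (v n)); lra.
have vp' n : cabs (v n - p) <= d / 2 ^+ n.
  rewrite cabsB; apply: (tends_to_le (u := fun k => v (n + k)%N)) => [x /vp[m h]|k].
    by exists m => i mi; rewrite h// (leq_trans mi)// leq_addl.
  exact: dv'.
have Uv n : U (v n) by have := gs n; rewrite /v; case: (s n) => -[[? ?] ?] ? [[]].
have Up : U p by apply: tends_to_le vp _.
have e9 : 0 < e / 9 by rewrite divr_gt0.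
have [x x0 hx] := df Up e9.
have [|n hn] := dsmall (x / 3); first by rewrite divr_gt0.
have := gs n; have := vp' n; have := ds n; rewrite /v.
case: (s n) hn => -[[a1 b1] c1] dn /= + -> ap => hn.
set dn' := d / 2 ^+ n in hn ap *.
case=> -[Ua1 Ub1 Uc1] [ab bc ca].
have [dn0|dn0] := eqVneq dn' 0.
  move: ab bc ca; rewrite dn0.
  have z0 z : cabs z <= 0 -> z = 0.
    by move=> h; apply/eqP; rewrite -cabs_eq0 eq_le h cabs_ge0.
  move=> /z0/eqP; rewrite subr_eq0 => /eqP ->.
  move=> /z0/eqP; rewrite subr_eq0 => /eqP -> _.
  have Iaa : I a1 a1 = 0.
    have := I_mid Ua1 Ua1; have -> : mid a1 a1 = a1 by have := @two_neq0 R => ?; field.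
    by move/eqP; rewrite -subr_eq0 opprD addrA subrr sub0r oppr_eq0 => /eqP.
  by rewrite Iaa !addr0 cabs0 expr0n mulr0 ltxx.
have dn_gt0 : 0 < dn' by rewrite lt_neqAle eq_sym dn0 dpos.
pose D z := cabs (z - p) <= 2 * dn'.
have cD : midconvex D by exact: midconvex_ball.
have Da : D a1 by rewrite /D; lra.
have Db : D b1 by rewrite /D; have := cabs_tri b1 a1 p; lra.
have Dc : D c1 by rewrite /D; have := cabs_tri c1 a1 p; rewrite (cabsB c1 a1); lra.
have hD z : D z -> cabs (f z - ((f p - f' p * p) + f' p * z)) <= e / 9 * (2 * dn').
  move=> Dz; have := hx z; have -> : f z - f p - f' p * (z - p) =
    f z - ((f p - f' p * p) + f' p * z) by ring.
  move=> /(_ _)/le_trans; apply; first by move: Dz; rewrite /D; lra.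
  by rewrite ler_wpM2l// ltW.
have E1 := I_est Ua1 Ub1 cD Da Db hD; have E2 := I_est Ub1 Uc1 cD Db Dc hD.
have E3 := I_est Uc1 Ua1 cD Dc Da hD.
apply/negP; rewrite -leNgt.
set al := f p - f' p * p in E1 E2 E3; set be := f' p in E1 E2 E3.
have -> : I a1 b1 + I b1 c1 + I c1 a1 =
  (I a1 b1 - (al + be * mid a1 b1) * (b1 - a1)) +
  (I b1 c1 - (al + be * mid b1 c1) * (c1 - b1)) +
  (I c1 a1 - (al + be * mid c1 a1) * (a1 - c1)).
  by have := @two_neq0 R => ?; field.
have K0 : 0 <= e / 9 * (2 * dn') by rewrite mulr_ge0 ?(ltW e9) ?mulr_ge0 ?(ltW dn_gt0).
have F1 := le_trans E1 (ler_wpM2l K0 ab).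
have F2 := le_trans E2 (ler_wpM2l K0 bc).
have F3 := le_trans E3 (ler_wpM2l K0 ca).
apply: (le_trans (cabsD _ _)).
apply: (le_trans (lerD (cabsD _ _) (lexx _))).
have := sqr_ge0 dn'.
have : e / 9 * (2 * dn') * dn' = 2 / 9 * (e * dn' ^+ 2) by field.
have : 0 <= e * dn' ^+ 2 by rewrite mulr_ge0 ?sqr_ge0// ltW.
lra.
Qed.

Lemma primitive_exists : exists F, forall z, cabs (z - p0) < r -> has_deriv F z (f z).
Proof.
have [r0|r0] := ltP 0 r; last first.
  by exists f => z zp; have := cabs_ge0 (z - p0); lra.
have Up0 : U p0 by rewrite /U subrr cabs0 ltW.
exists (I p0) => z zr e e0.
have Uz : U z by exact: ltW.
have [x x0 hx] := has_deriv_cont (df Uz) e0.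
exists (Num.min x (r - cabs (z - p0))); first by rewrite lt_min x0 subr_gt0.
move=> w; rewrite lt_min => /andP[wx wr].
have Uw : U w by rewrite /U; have := cabs_tri w z p0; lra.
have -> : I p0 w - I p0 z = I z w.
  have := goursat Up0 Uz Uw; rewrite (I_rev Up0 Uw) => /eqP.
  by rewrite subr_eq0 => /eqP <-; ring.
have := @I_est z w (fun v => cabs (v - z) <= cabs (w - z)) (f z) 0 e Uz Uw.
rewrite mul0r addr0; apply.
- exact: midconvex_ball.
- by rewrite subrr cabs0 cabs_ge0.
- by [].
- by move=> v vz; rewrite mul0r addr0; apply: hx; exact: le_lt_trans wx.
Qed.

End goursat.

(** * Cauchy's formula as a limit of averages *)

Section compact_square.
Variable R : realType.
Implicit Types (p z w : R[i]).

Let pt p (x : R * R) : R[i] := p + (x.1 +i* x.2).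

Let square (r : R) : set (R * R) := `[- r, r] `*` `[- r, r].

Let square_compact r : compact (square r).
Proof. by apply: compact_setX; exact: segment_compact. Qed.

Let cabs_pt p x : cabs (pt p x - p) <= `|x.1| + `|x.2|.
Proof. by rewrite /pt addrAC subrr add0r (le_trans (cabs_le _)). Qed.

Let cabs_ptB p x y : cabs (pt p x - pt p y) <= `|x.1 - y.1| + `|x.2 - y.2|.
Proof.
have -> : pt p x - pt p y = (x.1 - y.1) +i* (x.2 - y.2).
  by rewrite /pt opprD addrACA subrr add0r.
exact: cabs_le.
Qed.

Let ptP p z : exists2 x, pt p x = z & forall r, cabs (z - p) <= r -> square r x.
Proof.
exists (Re (z - p), Im (z - p)).
  rewrite /pt /=; case: (z - p) (subrK p z) => a b /= <-; exact: addrC.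
move=> r zr; rewrite /square /=; split; rewrite /= in_itv /= -ler_norml.
  exact: le_trans (Re_le_cabs _) zr.
exact: le_trans (Im_le_cabs _) zr.
Qed.

Let square_near p r x : square r x -> cabs (pt p x - p) <= 2 * r.
Proof.
rewrite /square /= => -[]; rewrite /= !in_itv /= -!ler_norml => h1 h2.
by apply: le_trans (cabs_pt p x) _; lra.
Qed.

Let ball_near p (d : R) x y : ball x (d / 2) y -> cabs (pt p y - pt p x) < d.
Proof.
move=> [/= h1 h2]; apply: le_lt_trans (cabs_ptB _ _ _) _.
move: h1 h2; rewrite /ball /= !(distrC (x.1)) !(distrC x.2).
by lra.
Qed.

(** A disc is covered by a square, which is compact as a product of intervals and
    contained in the disc of twice the radius. *)
Lemma lebesgue_number_disc p (r : R) (Q : R[i] -> R[i] -> Prop) :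
  (forall z, cabs (z - p) <= 2 * r -> exists2 d : R, 0 < d &
     forall x y, cabs (x - z) < d -> cabs (y - z) < d -> Q x y) ->
  exists2 d : R, 0 < d &
     forall x y, cabs (x - p) <= r -> cabs (y - x) < d -> Q x y.
Proof.
move=> h.
have [|d d0 hd] := @lebesgue_number R _ (square r) (fun x y => Q (pt p x) (pt p y))
  (@square_compact r).
  move=> x /(square_near p)/h[d d0 hd]; exists (d / 2); first by rewrite divr_gt0.
  by move=> y z hy hz; apply: hd; exact: ball_near.
exists d => // x y; have [x' <- hx'] := ptP p x => /hx' {}hx'.
have [y' <- _] := ptP p y => yx; apply: hd => //.
have E : pt p y' - pt p x' = (y'.1 - x'.1) +i* (y'.2 - x'.2).
  by rewrite /pt opprD addrACA subrr add0r.
split; rewrite /ball /= distrC; apply: le_lt_trans yx; rewrite E.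
  exact: (Re_le_cabs (_ +i* _)).
exact: (Im_le_cabs (_ +i* _)).
Qed.

Lemma bounded_disc p (r : R) (g : R[i] -> R) :
  (forall z, cabs (z - p) <= 2 * r -> exists B d : R, 0 < d /\
     forall x, cabs (x - z) < d -> g x <= B) ->
  exists B, forall x, cabs (x - p) <= r -> g x <= B.
Proof.
move=> h.
have [|B hB] := @compact_local_bound R _ (square r) (g \o pt p) (@square_compact r).
  move=> x /(square_near p)/h[B [d [d0 hd]]]; exists B, (d / 2); split; first by rewrite divr_gt0.
  by move=> y hy; apply: hd; exact: ball_near.
exists B => x; have [x' <- hx'] := ptP p x => /hx' {}hx'.
exact: hB.
Qed.

Lemma cont_bounded_disc p (r : R) (f : R[i] -> R[i]) :
  (forall z, cabs (z - p) <= 2 * r -> cont_at f z) ->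
  exists B, forall x, cabs (x - p) <= r -> cabs (f x) <= B.
Proof.
move=> h; apply: bounded_disc => z /h/(_ 1 ltr01)[d d0 hd].
exists (cabs (f z) + 1), d; split=> // x /hd.
by have := cabs_dist (f x) (f z); lra.
Qed.

End compact_square.

Section cauchy_formula.
Variables (R : realType) (F f : R[i] -> R[i]) (p0 : R[i]) (r rho : R).
Hypotheses (r0 : 0 < r) (r_rho : 2 * r < rho).
Hypothesis dF : forall z, cabs (z - p0) < rho -> has_deriv F z (f z).
Hypothesis cf : forall z, cabs (z - p0) < rho -> cont_at f z.

Let zeta n j : R[i] := p0 + r%:C * rou R n ^+ j.

Let zeta_sub n j : zeta n j - p0 = r%:C * rou R n ^+ j.
Proof. by rewrite /zeta addrAC subrr add0r. Qed.

Let cabs_zeta n j : cabs (zeta n j - p0) = r.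
Proof. by rewrite zeta_sub cabsM cabsX cabs_rou expr1n mulr1 cabs_real gtr0_norm. Qed.

(** Continuity of the derivative makes the first-order expansion uniform. *)
Let uniform_expansion e : 0 < e -> exists2 d : R, 0 < d & forall z w,
  cabs (z - p0) <= r -> cabs (w - z) < d ->
  cabs (F w - F z - f z * (w - z)) <= e * cabs (w - z).
Proof.
move=> e0; apply: (@lebesgue_number_disc R p0 r) => p pr.
have pr' : cabs (p - p0) < rho by have := r_rho; lra.
have e2 : 0 < e / 2 by rewrite divr_gt0.
have [d d0 hd] := cf pr' e2.
exists (Num.min d (rho - cabs (p - p0))); first by rewrite lt_min d0 subr_gt0.
move=> x y; rewrite !lt_min => /andP[xd xr] /andP[yd yr].
have near w : cabs (w - p) < Num.min d (rho - cabs (p - p0)) ->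
    cabs (w - p) < d /\ cabs (w - p0) < rho.
  rewrite lt_min => /andP[h1 h2]; split=> //.
  by have := cabs_tri w p p0; lra.
have [D1 x1] : cabs (x - p) < d /\ cabs (x - p0) < rho by apply: near; rewrite lt_min xd.
have seg s : 0 <= s <= 1 -> cabs (x + (y - x) * s%:C - p) < Num.min d (rho - cabs (p - p0)).
  move=> s01; have -> : x + (y - x) * s%:C - p = (1 - s)%:C * (x - p) + s%:C * (y - p) by ring.
  apply: le_lt_trans (cabsD _ _) _; rewrite !cabsM !cabs_real !ger0_norm; [|lra|lra].
  set m := Num.min _ _ in near *.
  have xm : cabs (x - p) < m by rewrite lt_min xd.
  have ym : cabs (y - p) < m by rewrite lt_min yd.
  have [->|s0] := eqVneq s 0; first by rewrite subr0 mul1r mul0r addr0.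
  have : (1 - s) * cabs (x - p) <= (1 - s) * m by rewrite ler_wpM2l ?(ltW xm)//; lra.
  have : s * cabs (y - p) < s * m by rewrite ltr_pM2l// lt_neqAle eq_sym s0; lra.
  lra.
have := @mean_value_segment R (fun w => F w - f p * w)
  (fun s => f (x + (y - x) * s) - f p * 1) x y (e / 2).
have -> : F y - f p * y - (F x - f p * x) = F y - F x - f p * (y - x) by ring.
move=> hmv; have {hmv} h : cabs (F y - F x - f p * (y - x)) <= e / 2 * cabs (y - x).
  apply: hmv => s s01.
  have [h1 h2] := near _ (seg s s01); split; last first.
    by rewrite mulr1; exact: hd.
  apply: has_derivB; first exact: dF.
  by apply: has_derivZ; exact: has_deriv_id.
have -> : F y - F x - f x * (y - x) =
  (F y - F x - f p * (y - x)) - (f x - f p) * (y - x) by ring.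
apply: le_trans (cabsD _ _) _; rewrite cabsN cabsM.
have : cabs (f x - f p) * cabs (y - x) <= e / 2 * cabs (y - x).
  by rewrite ler_wpM2r ?cabs_ge0// hd.
lra.
Qed.

(** Riemann sums of the integral of [f] over the circle of centre
    [(1 - s) * w + s * p0] and radius [s * r]. They are
    small because the increments of the primitive [F] cancel around the circle.
    The factor [s] is divided out, which leaves the case [s = 0], where the sum
    of the roots of unity vanishes. *)
Let sum_zeta_small e : 0 < e -> exists n0, forall n, (n0 <= n)%N -> (0 < n)%N ->
  forall w s, cabs (w - p0) < r -> 0 <= s <= 1 ->
  cabs (n%:R^-1 * \sum_(0 <= j < n) f (w + s%:C * (zeta n j - w)) * (zeta n j - p0)) <= e.
Proof.
move=> e0; have e1 : 0 < e / r by rewrite divr_gt0.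
have [d d0 hd] := uniform_expansion e1.
have [|n0 hn0] := @rou_lim R (d / (2 * r)); first by rewrite divr_gt0// mulr_gt0.
exists (maxn n0 2) => n; rewrite geq_max => /andP[/hn0 {}hn0 n2] n1 w s wr s01.
have {}hn0 := hn0 n1; set om := rou R n in hn0.
have om1 : om - 1 != 0 by rewrite subr_eq0 -(expr1 om) rou_prim.
have n0' : (0 : R) < n%:R by rewrite ltr0n.
case/andP: (s01) => s0 s1.
have [->|s_neq0] := eqVneq s 0.
  rewrite (eq_bigr (fun j => f w * r%:C * (om ^+ j) ^+ 1)).
    rewrite -mulr_sumr big_mkord sum_root ?rouX// ?mulr0 ?cabs0 ?(ltW e0)//.
    by rewrite rou_prim.
  by move=> j _; rewrite mul0r addr0 zeta_sub expr1 mulrA.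
have s_gt0 : 0 < s by rewrite lt_neqAle eq_sym s_neq0.
pose z j := w + s%:C * (zeta n j - w).
have zr j : cabs (z j - p0) <= r.
  have -> : z j - p0 = (1 - s)%:C * (w - p0) + s%:C * (zeta n j - p0) by rewrite /z; ring.
  apply: (le_trans (cabsD _ _)); rewrite !cabsM !cabs_real cabs_zeta !ger0_norm//; last by lra.
  have : (1 - s) * cabs (w - p0) <= (1 - s) * r by rewrite ler_wpM2l ?(ltW wr)//; lra.
  lra.
have zS j : z j.+1 - z j = s%:C * (zeta n j - p0) * (om - 1).
  by rewrite zeta_sub /z /zeta -/om exprS; ring.
have zS' j : cabs (z j.+1 - z j) = s * r * cabs (om - 1).
  by rewrite zS !cabsM cabs_zeta cabs_real ger0_norm.
have close j : cabs (z j.+1 - z j) < d.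
  rewrite zS'; have : s * r * cabs (om - 1) <= r * cabs (om - 1).
    by rewrite ler_wpM2r ?cabs_ge0// ler_piMl// ltW.
  have : r * cabs (om - 1) <= r * (d / (2 * r)) by rewrite ler_wpM2l ?(ltW r0).
  have -> : r * (d / (2 * r)) = d / 2 by field; rewrite gt_eqF.
  lra.
set S := \sum_(0 <= j < n) _.
have tele : \sum_(0 <= j < n) (F (z j.+1) - F (z j)) = 0.
  by rewrite telescope_sumr// /z /zeta rouX// expr0 subrr.
have E : s%:C * (om - 1) * S =
    - \sum_(0 <= j < n) (F (z j.+1) - F (z j) - f (z j) * (z j.+1 - z j)).
  rewrite sumrB tele sub0r opprK mulr_sumr; apply: eq_bigr => j _.
  by rewrite zS /z; ring.
have : cabs (s%:C * (om - 1) * S) <= \sum_(0 <= j < n) e / r * (s * r * cabs (om - 1)).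
  rewrite E cabsN; apply: le_trans (cabs_sum _ _ _) _; apply: ler_sum => j _.
  by rewrite -(zS' j) hd.
rewrite sumr_const_nat subn0 -[X in _ <= X -> _]mulr_natl 2!cabsM cabs_real (gtr0_norm s_gt0).
set rhs := (X in _ <= X -> _).
have -> : rhs = s * cabs (om - 1) * (n%:R * e) by rewrite /rhs; field; rewrite gt_eqF.
rewrite ler_pM2l ?mulr_gt0 ?cabs_gt0// => h.
by rewrite cabsM cabsV cabs_nat ler_pdivrMl.
Qed.

Definition cauchy_average n w : R[i] :=
  n%:R^-1 * \sum_(0 <= j < n) (F (zeta n j) * (zeta n j - p0) / (zeta n j - w)).

Let zeta_neq n j w : cabs (w - p0) < r -> zeta n j - w != 0.
Proof.
move=> wr; rewrite -cabs_gt0; have := cabs_tri (zeta n j) w p0.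
by rewrite cabs_zeta; lra.
Qed.

Let mean_kernel_disc w : cabs (w - p0) < r -> tends_to (@cabs R)
  (fun n => n%:R^-1 * \sum_(0 <= j < n) ((zeta n j - p0) / (zeta n j - w))) 1.
Proof.
move=> wr e e0.
pose u := (w - p0) / r%:C.
have rC : r%:C != 0 by rewrite -cabs_gt0 cabs_real gtr0_norm.
have u1 : cabs u < 1.
  by rewrite cabsM cabsV cabs_real gtr0_norm// ltr_pdivrMr// mul1r.
have [n0 hn0] := inv_power_lim_in u1 e0.
exists n0.+1 => n n1; have n_gt0 : (0 < n)%N by apply: leq_ltn_trans n1.
have -> : n%:R^-1 * \sum_(0 <= j < n) ((zeta n j - p0) / (zeta n j - w)) = (1 - u ^+ n)^-1.
  rewrite -(mean_kernel n_gt0 (negbT (lt_eqF u1))) big_mkord; congr (_ * _).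
  apply: eq_bigr => j _; rewrite zeta_sub.
  have -> : zeta n j - w = r%:C * (rou R n ^+ j - u) by rewrite /zeta /u; field.
  have h : rou R n ^+ j - u != 0.
    rewrite -cabs_gt0; have := cabs_dist (rou R n ^+ j) u.
    by rewrite cabsX cabs_rou expr1n; lra.
  by field; rewrite h rC.
exact: hn0 (ltnW n1).
Qed.

(** Cauchy's formula for functions of class C^1: moving the circle
    continuously to the point [w] changes the average by less and less, since
    its derivative is a Riemann sum of [f dz] around a closed curve. *)
Theorem cauchy_formula w : cabs (w - p0) < r ->
  tends_to (@cabs R) (cauchy_average ^~ w) (F w).
Proof.
move=> wr e e0; have e2 : 0 < e / 2 by rewrite divr_gt0.
have [n1 h1] := sum_zeta_small e2.
have [|n2 h2] := mean_kernel_disc wr (e := e / 2 / (cabs (F w) + 1)).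
  by rewrite divr_gt0//; have := cabs_ge0 (F w); lra.
exists (maxn (maxn n1 n2) 1) => n; rewrite !geq_max => /andP[/andP[/h1 {}h1 /h2 {}h2] n0].
have {}h1 := h1 n0 w _ wr.
pose Gn s := n%:R^-1 * \sum_(0 <= j < n) (F (w + (zeta n j - w) * s) * ((zeta n j - p0) / (zeta n j - w))).
have G1 : Gn 1 = cauchy_average n w.
  rewrite /Gn /cauchy_average; congr (_ * _); apply: eq_bigr => j _.
  by rewrite mulr1 (addrC w) subrK mulrA.
have G0 : Gn 0 = F w * (n%:R^-1 * \sum_(0 <= j < n) ((zeta n j - p0) / (zeta n j - w))).
  rewrite /Gn mulrCA; congr (_ * _); rewrite mulr_sumr; apply: eq_bigr => j _.
  by rewrite mulr0 addr0.
have step : cabs (Gn 1 - Gn 0) <= e / 2.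
  apply: (@mean_value R Gn (fun s => n%:R^-1 * \sum_(0 <= j < n)
     f (w + s * (zeta n j - w)) * (zeta n j - p0))) => s s01; split; last exact: h1.
  apply: has_derivZ; apply: has_deriv_sum => j jn.
  have hz := zeta_neq n j wr.
  have -> : f (w + s%:C * (zeta n j - w)) * (zeta n j - p0) =
    (f (w + (zeta n j - w) * s%:C) * (zeta n j - w)) * ((zeta n j - p0) / (zeta n j - w)) +
    F (w + (zeta n j - w) * s%:C) * 0.
    by rewrite (mulrC s%:C); field.
  apply: (@has_derivM R (fun s => F (w + (zeta n j - w) * s)) (fun=> _)); last exact: has_deriv_cst.
  apply: has_deriv_affine; apply: dF.
  have -> : w + (zeta n j - w) * s%:C - p0 = (1 - s)%:C * (w - p0) + s%:C * (zeta n j - p0) by ring.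
  apply: le_lt_trans (cabsD _ _) _; rewrite !cabsM !cabs_real cabs_zeta !ger0_norm; [|lra|lra].
  have : (1 - s) * cabs (w - p0) <= (1 - s) * r by rewrite ler_wpM2l ?(ltW wr)//; lra.
  have := r0; have := r_rho; lra.
rewrite -G1; have := cabs_tri (Gn 1) (Gn 0) (F w).
have : cabs (Gn 0 - F w) <= e / 2.
  rewrite G0 -{2}[F w]mulr1 -mulrBr cabsM.
  have A : 0 < cabs (F w) + 1 by have := cabs_ge0 (F w); lra.
  have : cabs (F w) * cabs (n%:R^-1 * \sum_(0 <= j < n) ((zeta n j - p0) / (zeta n j - w)) - 1)
     <= cabs (F w) * (e / 2 / (cabs (F w) + 1)) by rewrite ler_wpM2l ?cabs_ge0.
  move/le_trans; apply; rewrite mulrA ler_pdivrMr// mulrC ler_wpM2l ?(ltW e2)//; lra.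
lra.
Qed.

End cauchy_formula.

(** * Smoothness of holomorphic functions *)

Section quadratic_expansions.
Variable R : realType.
Implicit Types (S : R[i] -> Prop) (p w z : R[i]) (F : R[i] -> R[i]).

Definition open_pred S := forall p, S p ->
  exists2 d : R, 0 < d & forall w, cabs (w - p) < d -> S w.

Definition expands_on S (C : R) F F1 := forall p w, S p -> S w ->
  cabs (F w - F p - F1 p * (w - p)) <= C * cabs (w - p) ^+ 2.

Lemma expands_has_deriv S C F F1 p : open_pred S -> expands_on S C F F1 -> S p ->
  has_deriv F p (F1 p).
Proof.
move=> oS h Sp e e0; have [d d0 hd] := oS p Sp.
have C0 : 0 < `|C| + 1 by have := normr_ge0 C; lra.
exists (Num.min d (e / (`|C| + 1))); first by rewrite lt_min d0 divr_gt0.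
move=> w; rewrite lt_min => /andP[/hd Sw]; rewrite ltr_pdivlMr// => wp.
apply: (le_trans (h _ _ Sp Sw)); rewrite expr2 mulrA ler_wpM2r ?cabs_ge0//.
have := ler_norm C; have := cabs_ge0 (w - p).
set x := cabs _ in wp * => x0 h1.
have : C * x <= `|C| * x by rewrite ler_wpM2r.
lra.
Qed.

(** The second-order control, uniform in [n], turns the convergence of [Fn] at
    two close points into the Cauchy property of [F1n] at one of them. *)
Lemma limit_expands S C F (Fn F1n : nat -> R[i] -> R[i]) : open_pred S -> 0 <= C ->
  (forall w, S w -> tends_to (@cabs R) (Fn ^~ w) (F w)) ->
  (forall n, expands_on S C (Fn n) (F1n n)) ->
  exists F1, (forall p, S p -> tends_to (@cabs R) (F1n ^~ p) (F1 p)) /\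
    expands_on S C F F1.
Proof.
move=> oS C0 cv ex.
have lim p : S p -> exists l, tends_to (@cabs R) (F1n ^~ p) l.
  move=> Sp; apply: (cn_complete (cabs_complete R)) => e e0.
  have [d d0 hd] := oS p Sp.
  have C1 : 0 < 4 * (C + 1) by lra.
  pose h := Num.min (d / 2) (e / (4 * (C + 1))).
  have h0 : 0 < h by rewrite lt_min !divr_gt0.
  have hd2 : h <= d / 2 by rewrite ge_min lexx.
  have he : h <= e / (4 * (C + 1)) by rewrite ge_min lexx orbT.
  have Ch : C * h <= e / 4.
    move: he; rewrite ler_pdivlMr//; have : 0 <= h by exact: ltW.
    by lra.
  pose w := p + h%:C; have wp : w - p = h%:C by rewrite /w addrAC subrr add0r.
  have cwp : cabs (w - p) = h by rewrite wp cabs_real gtr0_norm.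
  have Sw : S w by apply: hd; rewrite cwp; lra.
  have e8 : 0 < e * h / 8 by rewrite !mulr_gt0// invr_gt0.
  have [n1 h1] := cv _ Sw _ e8; have [n2 h2] := cv _ Sp _ e8.
  exists (maxn n1 n2) => i j; rewrite !geq_max => /andP[i1 i2] /andP[j1 j2].
  have := ex i p w Sp Sw; have := ex j p w Sp Sw; rewrite cwp wp => exj exi.
  have := h1 _ i1; have := h1 _ j1; have := h2 _ i2; have := h2 _ j2.
  move=> a1 a2 a3 a4.
  rewrite -(ler_pM2r h0) -[X in _ * X <= _](gtr0_norm h0) -cabs_real -cabsM.
  have -> : (F1n i p - F1n j p) * h%:C =
    (Fn j w - Fn j p - F1n j p * h%:C) - (Fn i w - Fn i p - F1n i p * h%:C) +
    ((Fn i w - F w) - (Fn j w - F w)) - ((Fn i p - F p) - (Fn j p - F p)) by ring.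
  apply: (le_trans (cabsD _ _)).
  apply: (le_trans (lerD (cabsD _ _) (lexx _))).
  apply: (le_trans (lerD (lerD (cabsD _ _) (cabsD _ _)) (lexx _))).
  rewrite !cabsN.
  have := cabsD (Fn i p - F p) (- (Fn j p - F p)); rewrite cabsN.
  have : C * h ^+ 2 <= e / 4 * h by rewrite expr2 mulrA ler_wpM2r// ltW.
  lra.
have [F1 hF1] : exists F1, forall p, S p -> tends_to (@cabs R) (F1n ^~ p) (F1 p).
  have h p : exists l, S p -> tends_to (@cabs R) (F1n ^~ p) l.
    by have [/lim[l hl]|ns] := pselect (S p); [exists l|exists 0].
  by have [F1 hF1] := choice h; exists F1.
exists F1; split=> // p w Sp Sw; apply/ler_addgt0Pr => e e0.
have D0 : 0 < 3 * (cabs (w - p) + 1) by have := cabs_ge0 (w - p); lra.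
have [n1 h1] := cv _ Sw (e / 3) ltac:(lra).
have [n2 h2] := cv _ Sp (e / 3) ltac:(lra).
have [n3 h3] := hF1 _ Sp (e / (3 * (cabs (w - p) + 1))) ltac:(by rewrite divr_gt0).
pose n := maxn (maxn n1 n2) n3.
have {}h1 : cabs (Fn n w - F w) <= e / 3.
  by apply: h1; rewrite !leq_max leqnn.
have {}h2 : cabs (Fn n p - F p) <= e / 3.
  by apply: h2; rewrite !leq_max leqnn orbT.
have {}h3 : cabs (F1n n p - F1 p) * cabs (w - p) <= e / 3.
  have := h3 n; rewrite leq_maxr ler_pdivlMr// => /(_ isT).
  by have := cabs_ge0 (F1n n p - F1 p); lra.
have := ex n p w Sp Sw => h4.
have -> : F w - F p - F1 p * (w - p) = (Fn n w - Fn n p - F1n n p * (w - p)) -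
  (Fn n w - F w) + (Fn n p - F p) + (F1n n p - F1 p) * (w - p) by ring.
apply: (le_trans (cabsD _ _)); rewrite [cabs (_ * _)]cabsM.
have := cabsD ((Fn n w - Fn n p - F1n n p * (w - p)) - (Fn n w - F w)) (Fn n p - F p).
have := cabsD (Fn n w - Fn n p - F1n n p * (w - p)) (- (Fn n w - F w)).
rewrite cabsN; lra.
Qed.

Lemma average_bound n (x : nat -> R[i]) (M : R) : 0 <= M -> (forall j, cabs (x j) <= M) ->
  cabs (n%:R^-1 * \sum_(0 <= j < n) x j) <= M.
Proof.
move=> M0 h; case: n => [|n]; first by rewrite big_geq// mulr0 cabs0.
rewrite cabsM cabsV cabs_nat ler_pdivrMl ?ltr0n//.
apply: le_trans (cabs_sum _ _ _) _; apply: (@le_trans _ _ (\sum_(0 <= j < n.+1) M)).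
  by apply: ler_sum => j _.
by rewrite sumr_const_nat subn0 mulr_natl.
Qed.

End quadratic_expansions.

Section kernel_expansions.
Variable R : realType.
Implicit Types c x y h : R[i].

(** Second-order remainders of the Cauchy kernel and of its first two
    derivatives. *)
Lemma kernel1 c (ze w p : R[i]) : ze - w != 0 -> ze - p != 0 ->
  c / (ze - w) - c / (ze - p) - c / (ze - p) ^+ 2 * (w - p) =
  c * (w - p) ^+ 2 * (ze - w)^-1 * (ze - p)^-1 ^+ 2.
Proof. by move=> h1 h2; field; rewrite ?h1 ?h2. Qed.

Lemma kernel2 c (ze w p : R[i]) : ze - w != 0 -> ze - p != 0 ->
  c / (ze - w) ^+ 2 - c / (ze - p) ^+ 2 - 2 * c / (ze - p) ^+ 3 * (w - p) =
  c * (w - p) ^+ 2 * (ze - w)^-1 * (ze - p)^-1 ^+ 2 * ((ze - w)^-1 + 2 * (ze - p)^-1).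
Proof. by move=> h1 h2; field; rewrite ?h1 ?h2. Qed.

Lemma kernel3 c (ze w p : R[i]) : ze - w != 0 -> ze - p != 0 ->
  2 * c / (ze - w) ^+ 3 - 2 * c / (ze - p) ^+ 3 - 6 * c / (ze - p) ^+ 4 * (w - p) =
  2 * (c * (w - p) ^+ 2 * (ze - w)^-1 * (ze - p)^-1 ^+ 2 *
   ((ze - w)^-1 ^+ 2 + 2 * (ze - w)^-1 * (ze - p)^-1 + 3 * (ze - p)^-1 ^+ 2)).
Proof. by move=> h1 h2; field; rewrite ?h1 ?h2. Qed.

End kernel_expansions.

Section C1_smooth.
Variables (R : realType) (F f : R[i] -> R[i]) (p0 : R[i]) (r rho B : R).
Hypotheses (r0 : 0 < r) (r_rho : 2 * r < rho).
Hypothesis dF : forall z, cabs (z - p0) < rho -> has_deriv F z (f z).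
Hypothesis cf : forall z, cabs (z - p0) < rho -> cont_at f z.
Hypothesis FB : forall z, cabs (z - p0) = r -> cabs (F z) <= B.

Let S (w : R[i]) := cabs (w - p0) < r / 2.

Let oS : open_pred S.
Proof.
move=> p Sp; exists (r / 2 - cabs (p - p0)); first by rewrite subr_gt0.
by move=> w; have := cabs_tri w p p0; rewrite /S; lra.
Qed.

Let zeta n j : R[i] := p0 + r%:C * rou R n ^+ j.

Let zeta_sub n j : zeta n j - p0 = r%:C * rou R n ^+ j.
Proof. by rewrite /zeta addrAC subrr add0r. Qed.

Let cabs_zeta n j : cabs (zeta n j - p0) = r.
Proof. by rewrite zeta_sub cabsM cabsX cabs_rou expr1n mulr1 cabs_real gtr0_norm. Qed.

Let zetaS n j w : S w -> r / 2 <= cabs (zeta n j - w).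
Proof.
by rewrite /S => Sw; have := cabs_tri (zeta n j) w p0; rewrite cabs_zeta; lra.
Qed.

Let zeta_neq n j w : S w -> zeta n j - w != 0.
Proof. by move=> /(zetaS n j); rewrite -cabs_gt0; have := r0; lra. Qed.

Let ka := 2 / r.

Let ka0 : 0 < ka. Proof. by rewrite divr_gt0. Qed.

Let zetaV n j w : S w -> cabs (zeta n j - w)^-1 <= ka.
Proof.
move=> Sw; rewrite cabsV -[ka]invrK lef_pV2 ?posrE ?invr_gt0 ?cabs_gt0 ?zeta_neq//.
by rewrite /ka invf_div; exact: zetaS.
Qed.

Let c n j := F (zeta n j) * (zeta n j - p0).

Let cB n j : cabs (c n j) <= B * r.
Proof. by rewrite cabsM cabs_zeta ler_wpM2r ?FB// ltW. Qed.

Let B0 : 0 <= B.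
Proof. by apply: le_trans (FB (cabs_zeta 0 0)); exact: cabs_ge0. Qed.

Let Br0 : 0 <= B * r.
Proof. by rewrite mulr_ge0// ltW. Qed.

Let base n j p w : S p -> S w ->
  cabs (c n j * (w - p) ^+ 2 * (zeta n j - w)^-1 * (zeta n j - p)^-1 ^+ 2) <=
  B * r * ka ^+ 3 * cabs (w - p) ^+ 2.
Proof.
move=> Sp Sw; rewrite 3!cabsM 2!cabsX.
have -> : B * r * ka ^+ 3 * cabs (w - p) ^+ 2 = B * r * cabs (w - p) ^+ 2 * ka * ka ^+ 2 by ring.
have h0 z : 0 <= cabs z by exact: cabs_ge0.
apply: ler_pM; rewrite ?mulr_ge0 ?exprn_ge0 ?h0//; last first.
  by rewrite lerXn2r ?nnegrE ?(ltW ka0) ?h0//; exact: zetaV.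
apply: ler_pM; rewrite ?mulr_ge0 ?exprn_ge0 ?h0//; last exact: zetaV.
by rewrite ler_wpM2r ?exprn_ge0 ?h0//; exact: cB.
Qed.

Let avg (x : nat -> nat -> R[i]) n := n%:R^-1 * \sum_(0 <= j < n) x n j.

Let avg_expands C (K K1 : nat -> nat -> R[i] -> R[i]) : 0 <= C ->
  (forall n j, expands_on S C (K n j) (K1 n j)) ->
  forall n, expands_on S C (fun w => avg (fun n j => K n j w) n)
                           (fun w => avg (fun n j => K1 n j w) n).
Proof.
move=> C0 h n p w Sp Sw; rewrite /avg.
have -> : n%:R^-1 * \sum_(0 <= j < n) K n j w - n%:R^-1 * \sum_(0 <= j < n) K n j p -
   n%:R^-1 * (\sum_(0 <= j < n) K1 n j p) * (w - p) =
   n%:R^-1 * \sum_(0 <= j < n) (K n j w - K n j p - K1 n j p * (w - p)).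
  by rewrite -mulrBr -mulrA -mulrBr mulr_suml -!sumrB.
apply: average_bound => [|j]; last exact: h.
by rewrite mulr_ge0// exprn_ge0// cabs_ge0.
Qed.

(** Cauchy's formula exhibits [F] as a limit of averages of Cauchy kernels, whose
    derivatives of all orders are controlled on the smaller disc. *)
Theorem C1_smooth : exists F1 F2 F3,
  [/\ expands_on S (8 * B / r ^+ 2) F F1,
      forall p, S p -> has_deriv F p (F1 p),
      forall p, S p -> has_deriv F1 p (F2 p) &
      forall p, S p -> has_deriv F2 p (F3 p)].
Proof.
have h0 z : 0 <= cabs z by exact: cabs_ge0.
have k0 := ltW ka0.
pose C1 := B * r * ka ^+ 3; pose C2 := C1 * (3 * ka); pose C3 := C1 * (12 * ka ^+ 2).
have C10 : 0 <= C1 by rewrite mulr_ge0// exprn_ge0.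
have C20 : 0 <= C2 by rewrite mulr_ge0// mulr_ge0.
have C30 : 0 <= C3 by rewrite mulr_ge0// mulr_ge0 ?exprn_ge0.
have E1 n j : expands_on S C1 (fun w => c n j / (zeta n j - w))
    (fun w => c n j / (zeta n j - w) ^+ 2).
  move=> p w Sp Sw; rewrite kernel1; [exact: base|exact: zeta_neq|exact: zeta_neq].
have E2 n j : expands_on S C2 (fun w => c n j / (zeta n j - w) ^+ 2)
    (fun w => 2 * c n j / (zeta n j - w) ^+ 3).
  move=> p w Sp Sw; rewrite kernel2; [|exact: zeta_neq|exact: zeta_neq].
  rewrite cabsM /C2 [leRHS]mulrAC ler_pM ?h0//; first exact: base.
  apply: (le_trans (cabsD _ _)); rewrite [cabs (_ * _)]cabsM cabs_nat.
  by have := zetaV n j Sp; have := zetaV n j Sw; lra.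
have E3 n j : expands_on S C3 (fun w => 2 * c n j / (zeta n j - w) ^+ 3)
    (fun w => 6 * c n j / (zeta n j - w) ^+ 4).
  move=> p w Sp Sw; rewrite kernel3; [|exact: zeta_neq|exact: zeta_neq].
  rewrite 2!cabsM cabs_nat /C3 [leRHS]mulrAC.
  have -> : C1 * cabs (w - p) ^+ 2 * (12 * ka ^+ 2) = 2 * (C1 * cabs (w - p) ^+ 2 * (6 * ka ^+ 2)) by ring.
  rewrite ler_wpM2l// ler_pM ?h0//; first exact: base.
  set x := (zeta n j - w)^-1; set y := (zeta n j - p)^-1.
  have hx : cabs x <= ka by exact: zetaV.
  have hy : cabs y <= ka by exact: zetaV.
  apply: (le_trans (cabsD _ _)); apply: (le_trans (lerD (cabsD _ _) (lexx _))).
  rewrite !cabsM !cabs_nat.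
  have : cabs x * cabs x <= ka ^+ 2 by rewrite expr2 ler_pM ?h0.
  have : cabs y * cabs y <= ka ^+ 2 by rewrite expr2 ler_pM ?h0.
  have : cabs x * cabs y <= ka ^+ 2 by rewrite expr2 ler_pM ?h0.
  lra.
have cv0 w : S w -> tends_to (@cabs R) (fun n => avg (fun n j => c n j / (zeta n j - w)) n) (F w).
  move=> Sw; apply: (cauchy_formula r0 r_rho dF cf).
  by move: Sw; rewrite /S; have := r0; lra.
have [F1 [cv1 ex1]] := limit_expands oS C10 cv0 (avg_expands C10 E1).
have [F2 [cv2 ex2]] := limit_expands oS C20 cv1 (avg_expands C20 E2).
have [F3 [cv3 ex3]] := limit_expands oS C30 cv2 (avg_expands C30 E3).
exists F1, F2, F3; split.
- move=> p w Sp Sw; have -> : 8 * B / r ^+ 2 = C1; last exact: ex1.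
  by rewrite /C1 /ka; field; rewrite gt_eqF.
- by move=> p; exact: expands_has_deriv ex1.
- by move=> p; exact: expands_has_deriv ex2.
- by move=> p; exact: expands_has_deriv ex3.
Qed.

End C1_smooth.

Section holomorphic.
Variable R : realType.
Implicit Types (f : R[i] -> R[i]) (p z w : R[i]).

Definition holomorphic (G : R[i] -> Prop) f f' :=
  forall z, G z -> has_deriv f z (f' z).

Lemma open_ball p (r : R) : open_pred (fun z => cabs (z - p) < r).
Proof.
move=> z zr; exists (r - cabs (z - p)); first by rewrite subr_gt0.
by move=> w; have := cabs_tri w z p; lra.
Qed.

(** A holomorphic function is locally the derivative of a function of class
    C^1, hence as smooth as the latter. *)
Theorem holomorphic_deriv G f f' : open_pred G -> holomorphic G f f' ->
  exists f'', holomorphic G f' f''.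
Proof.
move=> oG hf.
suff h z : exists d, G z -> has_deriv f' z d.
  by have [f'' hf''] := choice h; exists f''.
have [Gz|] := pselect (G z); last by exists 0.
have [d d0 hd] := oG z Gz.
have [|F hF] := @primitive_exists R f f' z (d / 2).
  by move=> w wz; apply: hf; apply: hd; lra.
have rho0 : 0 < d / 2 by lra.
have r0 : 0 < d / 8 by lra.
have r_rho : 2 * (d / 8) < d / 2 by lra.
have cf w : cabs (w - z) < d / 2 -> cont_at f w.
  by move=> wz; apply: has_deriv_cont (hf _ _); apply: hd; lra.
have [|B hB] := @cont_bounded_disc R z (d / 8) F.
  by move=> w wz; apply: has_deriv_cont (hF _ _); lra.
have [|F1 [F2 [F3 [_ h1 h2 h3]]]] := @C1_smooth R F f z (d / 8) (d / 2) B r0 r_rho hF cf.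
  by move=> w wz; apply: hB; rewrite wz.
exists (F3 z) => _.
have near w : cabs (w - z) < d / 8 / 2 -> F2 w = f' w.
  move=> wz; apply: has_deriv_unique (h2 _ wz) _.
  have [x x0 hx] := open_ball wz.
  apply: (has_deriv_local x0 (f := f)) => [v vw|]; last by apply: hf; apply: hd; lra.
  by apply: has_deriv_unique (hF _ _) (h1 _ (hx _ vw)); have := hx _ vw; lra.
apply: (has_deriv_local (r := d / 8 / 2) (f := F2)) => [|//|]; first by lra.
by apply: h3; rewrite subrr cabs0; lra.
Qed.

(** Cauchy's estimate for the second derivative, in integrated form. *)
Theorem cauchy_estimate f f' p (r rho B : R) : 0 < r -> 2 * r < rho ->
  holomorphic (fun z => cabs (z - p) < rho) f f' ->
  (forall z, cabs (z - p) = r -> cabs (f z) <= B) ->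
  forall w, cabs (w - p) < r / 2 ->
  cabs (f w - f p - f' p * (w - p)) <= 8 * B / r ^+ 2 * cabs (w - p) ^+ 2.
Proof.
move=> r0 r_rho hf fB w wp.
have [f'' hf''] := holomorphic_deriv (@open_ball p rho) hf.
have [|F1 [_ [_ [ex h1 _ _]]]] := C1_smooth r0 r_rho hf _ fB.
  by move=> z zr; apply: has_deriv_cont (hf'' _ zr).
have pp : cabs (p - p) < r / 2 by rewrite subrr cabs0; lra.
rewrite (has_deriv_unique (hf p _) (h1 _ pp)); last by lra.
exact: ex.
Qed.

(** The value at a point is a limit of averages over any circle around it, in
    particular over arbitrarily large ones. *)
Theorem liouville f f' : holomorphic (fun=> True) f f' ->
  (forall e : R, 0 < e -> exists r : R, forall z, r <= cabs z -> cabs (f z) <= e) ->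
  forall z, f z = 0.
Proof.
move=> hf fB p; apply: cabs_small => e e0.
have [r hr] := fB _ e0.
pose t := `|r| + cabs p + 1.
have t0 : 0 < t by rewrite /t; have := normr_ge0 r; have := cabs_ge0 p; lra.
have [f'' hf''] := holomorphic_deriv (fun p _ => ex_intro2 _ _ 1 ltr01 (fun _ _ => I)) hf.
have := @cauchy_formula R f f' p t (2 * t + 1) t0 ltac:(lra) (fun z _ => hf z I)
  (fun z _ => has_deriv_cont (hf'' z I)) p.
rewrite subrr cabs0 => /(_ t0) cv.
rewrite -[f p]subr0; apply: tends_to_le cv _ => n.
rewrite subr0; apply: average_bound => [|j]; first exact: ltW.
have E : cabs (p + t%:C * rou R n ^+ j - p) = t.
  by rewrite addrAC subrr add0r cabsM cabsX cabs_rou expr1n mulr1 cabs_real gtr0_norm.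
rewrite -mulrA divff ?mulr1; last by rewrite -cabs_gt0 E.
apply: hr; have := cabs_dist (p + t%:C * rou R n ^+ j - p) (- p).
rewrite E opprK subrK cabsN; have := ler_norm r; rewrite /t; lra.
Qed.

End holomorphic.

(** * Integration along rectifiable curves *)

Section control.
Variable R : realType.
Implicit Types (gamma : R -> R[i]) (v : R -> R).

(** The variation of a rectifiable curve on initial subintervals; all
    estimates of integrals go through increments of such a function. *)
Definition controls v gamma := forall x y : R, 0 <= x -> x <= y -> y <= 1 ->
  cabs (gamma y - gamma x) <= v y - v x.

Lemma bounded_variation_control (f : R -> R) : bounded_variation 0 1 f ->
  exists v, forall x y : R, 0 <= x -> x <= y -> y <= 1 -> `|f y - f x| <= v y - v x.
Proof.
move=> bv; exists (fun x => fine (total_variation 0 x f)) => x y x0 xy y1.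
have y0 : 0 <= y := le_trans x0 xy.
have bvy : bounded_variation 0 y f by apply: bounded_variationl bv.
have bvx : bounded_variation 0 x f by apply: (bounded_variationl _ xy).
have bxy : bounded_variation x y f by apply: (bounded_variationr x0).
have fx : total_variation 0 x f \is a fin_num by apply/bounded_variationP.
have fxy : total_variation x y f \is a fin_num by apply/bounded_variationP.
rewrite (total_variationD f x0 xy) fineD//.
rewrite [X in _ <= X - _]addrC addrK -lee_fin fineK//.
exact: total_variation_ge.
Qed.

(** The real and imaginary parts have bounded variation; their variation functions
    are additive over adjacent intervals. *)
Lemma rectifiable_control gamma : rectifiable gamma -> exists v, controls v gamma.
Proof.
move=> [L hL].
have H (p : R[i] -> R) (pB : forall z w, p (z - w) = p z - p w)
    (ple : forall z, `|p z| <= cabs z) : bounded_variation 0 1 (p \o gamma).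
  exists L => _ [s ps <-]; have := hL s ps; rewrite /curve_variation.
  rewrite -lecR; apply: le_trans; rewrite /variation rmorph_sum /=.
  by apply: ler_sum => i _; rewrite -pB cabsE lecR.
have [v1 h1] := bounded_variation_control (H Re ltac:(by move=> ? ?; rewrite raddfB) (@Re_le_cabs R)).
have [v2 h2] := bounded_variation_control (H Im ltac:(by move=> ? ?; rewrite raddfB) (@Im_le_cabs R)).
exists (fun x => v1 x + v2 x) => x y x0 xy y1.
apply: (le_trans (cabs_le _)); have := h1 _ _ x0 xy y1; have := h2 _ _ x0 xy y1.
rewrite /= !raddfB /=; lra.
Qed.

Lemma within_continuous_dist gamma : {within `[0, 1], continuous gamma} ->
  forall s, 0 <= s <= 1 -> forall e : R, 0 < e -> exists2 d : R, 0 < d &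
    forall u, 0 <= u <= 1 -> `|u - s| < d -> cabs (gamma u - gamma s) <= e.
Proof.
move=> /subspace_continuousP h s s01 e e0.
have /h/cvgrPdist_le/(_ e%:C) : `[0, 1]%classic s by rewrite /= in_itv.
rewrite ltcR => /(_ e0) /nbhs_normP[d d0 hd]; exists d => // u u01 us.
have := hd u; rewrite /= distrC in_itv => /(_ us u01).
by rewrite cabsE lecR cabsB.
Qed.

End control.

Section partition_comparison.
Variables (R : realType) (V : lmodType R[i]) (N : V -> R).
Hypothesis hN : complete_norm N.

(** The refinement of two partitions is replaced by the double family of
    increments of [g] over the intersections of their intervals. *)
Variables (x y : nat -> R) (n m : nat).
Hypotheses (x0 : x 0%N = 0) (xn : x n = 1) (y0 : y 0%N = 0) (ym : y m = 1).
Hypothesis xS : forall i, (i < n)%N -> x i <= x i.+1.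
Hypothesis yS : forall j, (j < m)%N -> y j <= y j.+1.

Let clip i z := Num.max (x i) (Num.min z (x i.+1)).

Let x_mono i j : (i <= j)%N -> (j <= n)%N -> x i <= x j.
Proof.
move=> /subnKC <-; elim: (j - i)%N => [|k ih]; first by rewrite addn0.
by rewrite addnS => h; apply: le_trans (xS h); rewrite ih// ltnW.
Qed.

Let y_mono i j : (i <= j)%N -> (j <= m)%N -> y i <= y j.
Proof.
move=> /subnKC <-; elim: (j - i)%N => [|k ih]; first by rewrite addn0.
by rewrite addnS => h; apply: le_trans (yS h); rewrite ih// ltnW.
Qed.

Let x01 i : (i <= n)%N -> 0 <= x i <= 1.
Proof. by move=> h; rewrite -x0 -xn !x_mono. Qed.

Let y01 i : (i <= m)%N -> 0 <= y i <= 1.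
Proof. by move=> h; rewrite -y0 -ym !y_mono. Qed.

Let clip_sumj (W : zmodType) (g : R -> W) i : (i < n)%N ->
  \sum_(0 <= j < m) (g (clip i (y j.+1)) - g (clip i (y j))) = g (x i.+1) - g (x i).
Proof.
move=> hi; rewrite (telescope_sumr (fun j => g (clip i (y j))))//.
have /andP[a1 a2] := x01 (ltnW hi); have /andP[b1 b2] := x01 hi; have := xS hi => h.
congr (g _ - g _); rewrite /clip.
  by rewrite ym min_r// max_r.
by rewrite y0 min_l// max_l.
Qed.

Let clip_sum_prefix (W : zmodType) (g : R -> W) z k : 0 <= z -> (k <= n)%N ->
  \sum_(0 <= i < k) (g (clip i z) - g (x i)) = g (Num.min z (x k)) - g 0.
Proof.
move=> z0; elim: k => [|k ih] hk; first by rewrite big_geq// x0 min_r// subrr.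
rewrite big_nat_recr//= ih ?(ltnW hk)//; have h := xS hk; rewrite /clip.
have [zx|xz] := leP z (x k).
  rewrite (min_l (le_trans zx h)) max_l// subrr addr0.
  by [].
rewrite max_r; first by rewrite addrC addrA subrK.
by rewrite le_min (ltW xz).
Qed.

Let clip_sumi (W : zmodType) (g : R -> W) j : (j < m)%N ->
  \sum_(0 <= i < n) (g (clip i (y j.+1)) - g (clip i (y j))) = g (y j.+1) - g (y j).
Proof.
move=> hj; have /andP[a1 a2] := y01 (ltnW hj); have /andP[b1 b2] := y01 hj.
transitivity (\sum_(0 <= i < n) (g (clip i (y j.+1)) - g (x i)) -
              \sum_(0 <= i < n) (g (clip i (y j)) - g (x i))).
  by rewrite -sumrB; apply: eq_bigr => i _; rewrite opprB addrA subrK.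
by rewrite !clip_sum_prefix// xn !min_l// opprB addrA subrK.
Qed.

Variables (gamma : R -> R[i]) (v : R -> R) (F : R -> V).
Hypothesis hv : controls v gamma.
Variables (t u : nat -> R) (d e : R).
Hypothesis xd : forall i, (i < n)%N -> x i.+1 - x i < d /\ x i <= t i <= x i.+1.
Hypothesis yd : forall j, (j < m)%N -> y j.+1 - y j < d /\ y j <= u j <= y j.+1.
Hypothesis osc : forall s w, 0 <= s <= 1 -> 0 <= w <= 1 -> `|s - w| < 2 * d ->
  N (F s - F w) <= e.

Lemma compare_sums :
  N (\sum_(0 <= i < n) (gamma (x i.+1) - gamma (x i)) *: F (t i) -
     \sum_(0 <= j < m) (gamma (y j.+1) - gamma (y j)) *: F (u j)) <= e * (v 1 - v 0).
Proof.
pose D (W : zmodType) (g : R -> W) i j := g (clip i (y j.+1)) - g (clip i (y j)).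
have -> : \sum_(0 <= i < n) (gamma (x i.+1) - gamma (x i)) *: F (t i) =
    \sum_(0 <= i < n) \sum_(0 <= j < m) D _ gamma i j *: F (t i).
  rewrite big_nat_cond [RHS]big_nat_cond; apply: eq_bigr => i /andP[/andP[_ hi] _].
  by rewrite -scaler_suml clip_sumj.
have -> : \sum_(0 <= j < m) (gamma (y j.+1) - gamma (y j)) *: F (u j) =
    \sum_(0 <= i < n) \sum_(0 <= j < m) D _ gamma i j *: F (u j).
  rewrite exchange_big /=.
  rewrite big_nat_cond [RHS]big_nat_cond; apply: eq_bigr => j /andP[/andP[_ hj] _].
  by rewrite -scaler_suml clip_sumi.
have vE : v 1 - v 0 = \sum_(0 <= i < n) \sum_(0 <= j < m) D _ v i j.
  transitivity (\sum_(0 <= i < n) (v (x i.+1) - v (x i))).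
    by rewrite (telescope_sumr (fun i => v (x i)))// xn x0.
  by apply: eq_big_nat => i /andP[_ hi]; rewrite clip_sumj.
rewrite vE mulr_sumr -sumrB.
apply: (le_trans (cn_sum hN _ _ _)).
rewrite big_nat_cond [leRHS]big_nat_cond; apply: ler_sum => i /andP[/andP[_ hi] _].
rewrite mulr_sumr -sumrB.
apply: (le_trans (cn_sum hN _ _ _)).
rewrite big_nat_cond [leRHS]big_nat_cond; apply: ler_sum => j /andP[/andP[_ hj] _].
rewrite -scalerBr (cnZ hN).
have [xd1 /andP[t1 t2]] := xd hi; have [yd1 /andP[u1 u2]] := yd hj.
have /andP[a1 a2] := x01 (ltnW hi); have /andP[b1 b2] := x01 hi.
have /andP[a3 a4] := y01 (ltnW hj); have /andP[b3 b4] := y01 hj.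
have hx := xS hi; have hy := yS hj.
have [E|NE] := pselect (clip i (y j.+1) = clip i (y j)).
  by rewrite /D E !subrr cabs0 mul0r mulr0.
have yx : y j < x i.+1.
  rewrite ltNge; apply/negP => h; apply: NE; rewrite /clip !min_r//.
  exact: le_trans hy.
have xy : x i < y j.+1.
  rewrite ltNge; apply/negP => h; apply: NE; rewrite /clip !max_l// ge_min ?h//.
  by rewrite (le_trans hy).
have cle : clip i (y j) <= clip i (y j.+1).
  rewrite /clip ge_max le_max lexx /= le_max; apply/orP; right.
  by rewrite le_min ge_min hy /= ge_min lexx orbT.
have c0 : 0 <= clip i (y j) by rewrite /clip le_max a1.
have c1 : clip i (y j.+1) <= 1 by rewrite /clip ge_max a2 ge_min b2 orbT.
rewrite mulrC ler_pM ?cabs_ge0 ?(cn_ge0 hN)//; last exact: hv.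
by apply: osc; [lra|lra|rewrite ltr_norml; lra].
Qed.

End partition_comparison.

Section uniform_partition.
Variable R : realType.

Definition uniform_part n : seq R := mkseq (fun i => i.+1%:R / n%:R) n.

Lemma nth_uniform_part n i : (0 < n)%N -> (i <= n)%N ->
  nth 1 (0 :: uniform_part n) i = i%:R / n%:R :> R.
Proof.
move=> n0; case: i => [|i] h /=; first by rewrite mul0r.
by rewrite nth_mkseq.
Qed.

Lemma uniform_partP n : (0 < n)%N -> itv_partition 0 1 (uniform_part n).
Proof.
move=> n0; have n0' : (0 : R) < n%:R by rewrite ltr0n.
split.
  apply/(pathP 1) => i; rewrite size_mkseq => hi.
  rewrite nth_uniform_part ?(ltnW hi)// nth_mkseq//.
  by rewrite ltr_pM2r ?invr_gt0// ltr_nat.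
rewrite (last_nth 1) size_mkseq nth_uniform_part// divff// gt_eqF//.
Qed.

End uniform_partition.

Section riemann_stieltjes.
Variables (R : realType) (V : lmodType R[i]) (N : V -> R).
Hypothesis hN : complete_norm N.
Variables (gamma : R -> R[i]) (v : R -> R).
Hypothesis hv : controls v gamma.

Definition uniform_sum (F : R[i] -> V) n : V := \sum_(0 <= j < n)
  (gamma (j.+1%:R / n%:R) - gamma (j%:R / n%:R)) *: F (gamma (j%:R / n%:R)).

Definition oscillation_le (F : R[i] -> V) (d e : R) := forall s w,
  0 <= s <= 1 -> 0 <= w <= 1 -> `|s - w| < d -> N (F (gamma s) - F (gamma w)) <= e.

Definition uniformly_continuous_along (F : R[i] -> V) := forall e : R, 0 < e ->
  exists2 d : R, 0 < d & oscillation_le F d e.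

Lemma control_ge0 : 0 <= v 1 - v 0.
Proof. by have := hv (lexx 0) ler01 (lexx 1); apply: le_trans; exact: cabs_ge0. Qed.

Lemma compare_uniform F (d e : R) s t n : oscillation_le F (2 * d) e ->
  tagged_partition d s t -> (0 < n)%N -> n%:R^-1 < d ->
  N (riemann_stieltjes_sum gamma F s t - uniform_sum F n) <= e * (v 1 - v 0).
Proof.
move=> osc [[ps /eqP ls] ts] n0 nd.
have n0' : (0 : R) < n%:R by rewrite ltr0n.
apply: (@compare_sums R V N hN (nth 1 (0 :: s)) (fun j => j%:R / n%:R) (size s) n
  _ _ _ _ _ _ gamma v (F \o gamma) hv t (fun j => j%:R / n%:R) d e _ _ osc) => //.
- by rewrite -(last_nth 1).
- by rewrite mul0r.
- by rewrite divff// gt_eqF.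
- move=> i hi; have [_ /andP[h1 h2]] := ts _ hi; exact: le_trans h2.
- by move=> j _; rewrite ler_pM2r ?invr_gt0// ler_nat.
- move=> j _; rewrite lexx ler_pM2r ?invr_gt0// ler_nat leqnSn; split=> //.
  by rewrite -mulrBl -natrB// subSnn mul1r.
Qed.

Lemma uniform_tagged n (d : R) : (0 < n)%N -> n%:R^-1 < d ->
  tagged_partition d (uniform_part R n) (fun j => j%:R / n%:R).
Proof.
move=> n0 nd; split; first exact: uniform_partP.
have n0' : (0 : R) < n%:R by rewrite ltr0n.
move=> i; rewrite size_mkseq => hi.
rewrite !nth_uniform_part ?(ltnW hi)//.
rewrite lexx ler_pM2r ?invr_gt0// ler_nat leqnSn; split=> //.
by rewrite -mulrBl -natrB// subSnn mul1r.
Qed.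

Lemma uniform_sumE F n : (0 < n)%N ->
  riemann_stieltjes_sum gamma F (uniform_part R n) (fun j => j%:R / n%:R) = uniform_sum F n.
Proof.
move=> n0; rewrite /riemann_stieltjes_sum /uniform_sum size_mkseq.
rewrite big_nat_cond [RHS]big_nat_cond; apply: eq_bigr => i /andP[/andP[_ hi] _].
by rewrite !nth_uniform_part ?(ltnW hi).
Qed.

Lemma inv_small (d : R) : 0 < d -> exists n0, forall n, (n0 <= n)%N -> (0 < n)%N ->
  n%:R^-1 < d.
Proof.
move=> d0; have [|n0 h] := @ratio_small R 1 (d / 2); first by rewrite divr_gt0.
by exists n0 => n /h /[apply]; rewrite mul1r; lra.
Qed.

Lemma uniform_sum_cv F : uniformly_continuous_along F ->
  exists l, tends_to N (uniform_sum F) l.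
Proof.
move=> uF; apply: (cn_complete hN) => e e0.
have V1 : 0 < v 1 - v 0 + 1 by have := control_ge0; lra.
have [|d d0 hd] := uF (e / (v 1 - v 0 + 1)); first by rewrite divr_gt0.
have [|n0 hn0] := @inv_small (d / 2); first by rewrite divr_gt0.
exists (maxn n0 1) => i j; rewrite !geq_max => /andP[i1 i2] /andP[j1 j2].
rewrite -(uniform_sumE F i2).
apply: (@le_trans _ _ (e / (v 1 - v 0 + 1) * (v 1 - v 0))).
  apply: (@compare_uniform F (d / 2)) => //.
  - by have -> : 2 * (d / 2) = d by lra.
  - by apply: uniform_tagged => //; exact: hn0.
  - exact: hn0.
by rewrite mulrAC ler_pdivrMr// ler_wpM2l ?(ltW e0)//; lra.
Qed.

Lemma limit_estimate F l (d e : R) s t : 0 < d -> tends_to N (uniform_sum F) l ->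
  oscillation_le F (2 * d) e -> tagged_partition d s t ->
  N (l - riemann_stieltjes_sum gamma F s t) <= e * (v 1 - v 0).
Proof.
move=> d0 cl osc ts; apply/ler_addgt0Pr => e1 e10.
have [n1 h1] := cl _ e10; have [n2 h2] := inv_small d0.
pose n := maxn (maxn n1 n2) 1.
have n1n : (n1 <= n)%N by rewrite !leq_max leqnn.
have n2n : (n2 <= n)%N by rewrite !leq_max leqnn orbT.
have n0 : (0 < n)%N by rewrite leq_max orbT.
have := compare_uniform osc ts n0 (h2 _ n2n n0); have := h1 _ n1n.
have := cn_tri hN l (uniform_sum F n) (riemann_stieltjes_sum gamma F s t).
rewrite (cnB hN l (uniform_sum F n)).
by rewrite (cnB hN (uniform_sum F n) (riemann_stieltjes_sum _ _ _ _)); lra.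
Qed.

Variable nrm : V -> R[i].
Hypothesis nrmE : forall x, nrm x = (N x)%:C.

Lemma limit_is_curve_integral F l : uniformly_continuous_along F ->
  tends_to N (uniform_sum F) l -> is_curve_integral nrm gamma F l.
Proof.
move=> uF cl e e0.
have V1 : 0 < v 1 - v 0 + 1 by have := control_ge0; lra.
have [|d d0 hd] := uF (e / (v 1 - v 0 + 1)); first by rewrite divr_gt0.
exists (d / 2); first by rewrite divr_gt0.
move=> s t ts; rewrite nrmE ltcR.
apply: (@le_lt_trans _ _ (e / (v 1 - v 0 + 1) * (v 1 - v 0))).
  apply: limit_estimate ts => //; first by rewrite divr_gt0.
  by have -> : 2 * (d / 2) = d by lra.
by rewrite mulrAC ltr_pdivrMr// ltr_pM2l//; lra.
Qed.

Lemma is_curve_integral_limit F l : is_curve_integral nrm gamma F l ->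
  tends_to N (uniform_sum F) l.
Proof.
move=> hl e e0; have [d d0 hd] := hl e e0.
have [n0 h0] := inv_small d0.
exists (maxn n0 1) => n; rewrite geq_max => /andP[h1 h2].
have := hd _ _ (uniform_tagged h2 (h0 _ h1 h2)).
by rewrite nrmE ltcR uniform_sumE// cnB// => /ltW.
Qed.

(** The integral is defined by a choice among the limits of tagged sums; the
    limit of the uniform sums shows that the choice is made in a nonempty
    set. *)
Theorem curve_integral_limit F : uniformly_continuous_along F ->
  tends_to N (uniform_sum F) (curve_integral nrm gamma F).
Proof.
move=> uF; have [l hl] := uniform_sum_cv uF.
rewrite /curve_integral; case: xgetP => [x _ /is_curve_integral_limit//|abs].
by have := abs l; have := limit_is_curve_integral uF hl.
Qed.

Lemma curve_integral_eq F l : uniformly_continuous_along F ->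
  tends_to N (uniform_sum F) l -> curve_integral nrm gamma F = l.
Proof.
by move=> uF; exact: (tends_to_unique hN (curve_integral_limit uF)).
Qed.

Theorem curve_integral_estimate F (d e : R) n : uniformly_continuous_along F ->
  0 < d -> oscillation_le F (2 * d) e -> (0 < n)%N -> n%:R^-1 < d ->
  N (curve_integral nrm gamma F - uniform_sum F n) <= e * (v 1 - v 0).
Proof.
move=> uF d0 osc n0 nd; rewrite -uniform_sumE//.
apply: limit_estimate (curve_integral_limit uF) osc _ => //.
exact: uniform_tagged.
Qed.

Lemma pointwise_uniformly_continuous F :
  (forall s, 0 <= s <= 1 -> forall e : R, 0 < e -> exists2 d : R, 0 < d &
    forall u, 0 <= u <= 1 -> `|u - s| < d -> N (F (gamma u) - F (gamma s)) <= e) ->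
  uniformly_continuous_along F.
Proof.
move=> h e e0.
have [|d d0 hd] := @lebesgue_number R R `[0, 1] (fun s t => 0 <= s <= 1 ->
    0 <= t <= 1 -> N (F (gamma s) - F (gamma t)) <= e) (@segment_compact _ _ _).
  move=> s; rewrite /= in_itv /= => s01.
  have [|r r0 hr] := h s s01 (e / 2); first by rewrite divr_gt0.
  exists r => // x y; rewrite /ball /= => xs ys x01 y01.
  have := hr x x01; rewrite distrC xs => /(_ isT).
  have := hr y y01; rewrite distrC ys => /(_ isT).
  have := cn_tri hN (F (gamma x)) (F (gamma s)) (F (gamma y)).
  by rewrite (cnB hN (F (gamma s))); lra.
exists d => // s w s01 w01 sw; apply: hd => //; by rewrite /= in_itv.
Qed.

Lemma weighted_sum_bound (x : nat -> V) (B : R) n : 0 <= B ->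
  (forall j, (j < n)%N -> N (x j) <= B) ->
  N (\sum_(0 <= j < n) (gamma (j.+1%:R / n%:R) - gamma (j%:R / n%:R)) *: x j) <=
  B * (v 1 - v 0).
Proof.
move=> B0 hB; case: n hB => [|n] hB.
  by rewrite big_geq// (cn0 hN) mulr_ge0// control_ge0.
have n0 : (0 : R) < n.+1%:R by rewrite ltr0n.
have -> : v 1 - v 0 = \sum_(0 <= j < n.+1) (v (j.+1%:R / n.+1%:R) - v (j%:R / n.+1%:R)).
  by rewrite (telescope_sumr (fun j => v (j%:R / n.+1%:R)))// divff ?mul0r// gt_eqF.
rewrite mulr_sumr; apply: (le_trans (cn_sum hN _ _ _)).
rewrite big_nat_cond [leRHS]big_nat_cond; apply: ler_sum => j /andP[/andP[_ hj] _].
have j0 : 0 <= j%:R / n.+1%:R :> R by rewrite divr_ge0.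
have j1 : j.+1%:R / n.+1%:R <= 1 :> R by rewrite ler_pdivrMr// mul1r ler_nat.
have jj : j%:R / n.+1%:R <= j.+1%:R / n.+1%:R :> R by rewrite ler_pM2r ?invr_gt0// ler_nat.
rewrite (cnZ hN) mulrC ler_pM ?cabs_ge0 ?(cn_ge0 hN)//; first exact: hB.
exact: hv.
Qed.

Lemma part_01 n j : (j <= n)%N -> 0 <= (j%:R / n%:R : R) <= 1.
Proof.
case: n => [|n] h; first by rewrite invr0 mulr0 lexx ler01.
by rewrite divr_ge0//= ler_pdivrMr ?ltr0n// mul1r ler_nat.
Qed.

Lemma uniform_sum_bound F (B : R) n : 0 <= B ->
  (forall s, 0 <= s <= 1 -> N (F (gamma s)) <= B) ->
  N (uniform_sum F n) <= B * (v 1 - v 0).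
Proof.
by move=> B0 hB; apply: weighted_sum_bound => // j jn; apply/hB/part_01/ltnW.
Qed.

Lemma uniformly_continuous_bounded F : uniformly_continuous_along F ->
  exists2 B, 0 <= B & forall s, 0 <= s <= 1 -> N (F (gamma s)) <= B.
Proof.
move=> /(_ 1 ltr01)[d d0 hd].
have [|B hB] := @compact_local_bound R R `[0, 1]
    (fun s => if 0 <= s <= 1 then N (F (gamma s)) else 0) (@segment_compact _ _ _).
  move=> s; rewrite /= in_itv /= => s01.
  exists (N (F (gamma s)) + 1), d; split=> // x; rewrite /ball /= => xs.
  have Ns := cn_ge0 hN (F (gamma s)).
  case: ifP => [x01|_]; last by lra.
  have := hd _ _ s01 x01 xs; rewrite (cnB hN).
  by have := cn_tri hN (F (gamma x)) (F (gamma s)) 0; rewrite !subr0; lra.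
have h s : 0 <= s <= 1 -> N (F (gamma s)) <= B.
  by move=> s01; have := hB s; rewrite /= in_itv /= s01; apply.
exists B => //; have := h 0; rewrite lexx ler01 => /(_ isT); apply: le_trans.
exact: cn_ge0.
Qed.

Lemma curve_integral_bound F (B : R) : uniformly_continuous_along F -> 0 <= B ->
  (forall s, 0 <= s <= 1 -> N (F (gamma s)) <= B) ->
  N (curve_integral nrm gamma F) <= B * (v 1 - v 0).
Proof.
move=> uF B0 hB; apply/ler_addgt0Pr => e e0.
have [n hn] := curve_integral_limit uF e0.
have := hn n (leqnn _); have := uniform_sum_bound n B0 hB.
have := cn_tri hN (curve_integral nrm gamma F) (uniform_sum F n) 0.
by rewrite !subr0 (cnB hN (curve_integral _ _ _)); lra.
Qed.

End riemann_stieltjes.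

(** * The homology form of Cauchy's formula *)

Lemma cabs1_le1 (R : realType) : cabs (1 : R[i]) <= 1.
Proof. by rewrite cabs1. Qed.

Lemma cscaleE (R : realType) (a b : R[i]) : a *: b = a * b.
Proof. by []. Qed.

Section curve.
Variables (R : realType) (gamma : R -> R[i]) (v : R -> R).
Hypothesis hv : controls v gamma.
Hypothesis gamma01 : gamma 0 = gamma 1.
Hypothesis gamma_cont : forall s, 0 <= s <= 1 -> forall e : R, 0 < e ->
  exists2 d : R, 0 < d &
    forall u, 0 <= u <= 1 -> `|u - s| < d -> cabs (gamma u - gamma s) <= e.

Implicit Types (F : R[i] -> R[i]) (z w p : R[i]).

Let hN := cabs_complete R.
Let VV := v 1 - v 0.
Let V0 : 0 <= VV := control_ge0 hv.
Local Notation us := (uniform_sum (V := R[i]) gamma).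
Local Notation along := (uniformly_continuous_along (V := R[i]) (@cabs R) gamma).
Local Notation J := (curve_integral (V := R[i]) Num.norm gamma).

Definition off_curve w := forall s, 0 <= s <= 1 -> gamma s != w.

Lemma cont_along F : (forall s, 0 <= s <= 1 -> cont_at F (gamma s)) -> along F.
Proof.
move=> cF; apply: pointwise_uniformly_continuous => // s s01 e e0.
have [r r0 hr] := cF s s01 e e0.
have [|d d0 hd] := gamma_cont s01 (e := r / 2); first by rewrite divr_gt0.
by exists d => // u u01 us; apply: hr; have := hd u u01 us; lra.
Qed.

Lemma J_lim F : along F -> tends_to (@cabs R) (us F) (J F).
Proof. by move=> aF; apply: (curve_integral_limit hN hv (@cabsE R) aF). Qed.

Lemma kernel_along c w : off_curve w -> along (fun z => c / (z - w)).
Proof.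
by move=> ow; apply: cont_along => s s01; apply: has_deriv_cont (has_deriv_kernel c (ow s s01)).
Qed.

Lemma off_curve_bound w : off_curve w -> exists2 B : R, 0 < B &
  forall s, 0 <= s <= 1 -> B <= cabs (gamma s - w).
Proof.
move=> ow; have [B B0 hB] := uniformly_continuous_bounded hN (kernel_along 1 ow).
exists (B + 1)^-1; first by rewrite invr_gt0; lra.
move=> s s01; have gw : 0 < cabs (gamma s - w) by rewrite cabs_gt0 subr_eq0 ow.
have := hB s s01; rewrite cabsM cabs1 mul1r cabsV => h.
by rewrite -[leRHS]invrK lef_pV2 ?posrE ?invr_gt0//; lra.
Qed.

Lemma off_curve_open w : off_curve w -> exists2 d : R, 0 < d &
  forall p, cabs (p - w) < d -> forall s, 0 <= s <= 1 -> d <= cabs (gamma s - p).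
Proof.
move=> /off_curve_bound[B B0 hB]; exists (B / 2); first by rewrite divr_gt0.
move=> p pw s s01; have := hB s s01; have := cabs_tri (gamma s) p w; lra.
Qed.

Lemma far_off p (d : R) : 0 < d -> (forall s, 0 <= s <= 1 -> d <= cabs (gamma s - p)) ->
  off_curve p.
Proof.
move=> d0 h s s01; rewrite -subr_eq0 -cabs_gt0; apply: lt_le_trans (h s s01); exact: d0.
Qed.

(** The remainder in [kernel1] is bounded along the curve as long as the
    parameter stays at distance [d] from it. *)
Lemma kernel_sum_expands (c : R[i] -> R[i]) (Bc d : R) p0 : 0 <= Bc -> 0 < d ->
  (forall s, 0 <= s <= 1 -> cabs (c (gamma s)) <= Bc) ->
  (forall p, cabs (p - p0) < d -> forall s, 0 <= s <= 1 -> d <= cabs (gamma s - p)) ->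
  forall n, expands_on (fun w => cabs (w - p0) < d) (Bc * d^-1 ^+ 3 * VV)
    (fun w => us (fun z => c z / (z - w)) n) (fun w => us (fun z => c z / (z - w) ^+ 2) n).
Proof.
move=> Bc0 d0 hc hd n p w pd wd.
rewrite /uniform_sum -sumrB mulr_suml -sumrB.
under eq_bigr do rewrite -scalerBr -scalerAl -scalerBr.
have -> : Bc * d^-1 ^+ 3 * VV * cabs (w - p) ^+ 2 = Bc * d^-1 ^+ 3 * cabs (w - p) ^+ 2 * VV by ring.
apply: (weighted_sum_bound hN hv) => [|j jn].
  by rewrite !mulr_ge0 ?exprn_ge0 ?invr_ge0 ?cabs_ge0 ?(ltW d0).
have j01 := @part_01 R n j (ltnW jn).
have dw := hd _ wd _ j01; have dp := hd _ pd _ j01.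
have nw : gamma (j%:R / n%:R) - w != 0 by rewrite -cabs_gt0; lra.
have np : gamma (j%:R / n%:R) - p != 0 by rewrite -cabs_gt0; lra.
rewrite kernel1// 3!cabsM 2!cabsX !cabsV.
have iw : (cabs (gamma (j%:R / n%:R) - w))^-1 <= d^-1 by rewrite lef_pV2 ?posrE ?cabs_gt0.
have ip : (cabs (gamma (j%:R / n%:R) - p))^-1 <= d^-1 by rewrite lef_pV2 ?posrE ?cabs_gt0.
have i0 : 0 <= d^-1 by rewrite invr_ge0 ltW.
have -> : Bc * d^-1 ^+ 3 * cabs (w - p) ^+ 2 = Bc * cabs (w - p) ^+ 2 * d^-1 * d^-1 ^+ 2 by ring.
have h0 (z : R[i]) : 0 <= cabs z by exact: cabs_ge0.
apply: ler_pM; rewrite ?mulr_ge0 ?exprn_ge0 ?invr_ge0 ?h0//; last first.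
  by rewrite lerXn2r ?nnegrE ?invr_ge0 ?h0// ltW.
apply: ler_pM; rewrite ?mulr_ge0 ?exprn_ge0 ?invr_ge0 ?h0//.
by rewrite ler_wpM2r ?exprn_ge0 ?h0//; exact: hc.
Qed.

(** The kernel [1 / (z - w) ^ 2] has the primitive [- 1 / (z - w)], and the
    curve is closed. *)
Lemma square_kernel_sum w : off_curve w ->
  tends_to (@cabs R) (us (fun z => 1 / (z - w) ^+ 2)) 0.
Proof.
move=> ow e e0.
have [B B0 hB] := off_curve_bound ow.
have Bi : 0 < B^-1 by rewrite invr_gt0.
pose e1 := e / (B^-1 * (VV + 1)).
have V1 : 0 < VV + 1 by have := V0; lra.
have e10 : 0 < e1 by rewrite divr_gt0// mulr_gt0.
have [d d0 hd] := kernel_along 1 ow e10.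
have [n0 h0] := inv_small d0.
exists (maxn n0 1) => n; rewrite geq_max => /andP[/h0 + n1]; move=> /(_ n1) nd.
rewrite subr0; set g := fun j : nat => gamma (j%:R / n%:R).
have n0' : (0 : R) < n%:R by rewrite ltr0n.
have gw j : (j <= n)%N -> g j - w != 0 by move=> jn; rewrite subr_eq0 ow// part_01.
have tele : \sum_(0 <= j < n) ((g j.+1 - w)^-1 - (g j - w)^-1) = 0.
  rewrite (telescope_sumr (fun j => (g j - w)^-1))// /g mul0r divff ?gt_eqF//.
  by rewrite gamma01 subrr.
have -> : us (fun z => 1 / (z - w) ^+ 2) n = - \sum_(0 <= j < n)
    (gamma (j.+1%:R / n%:R) - gamma (j%:R / n%:R)) *:
    (((g j.+1 - w)^-1 - (g j - w)^-1) * (g j - w)^-1 : R[i]).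
  apply/eqP; rewrite -subr_eq0 opprK -big_split /=; apply/eqP.
  transitivity (- \sum_(0 <= j < n) ((g j.+1 - w)^-1 - (g j - w)^-1)); last by rewrite tele oppr0.
  rewrite -sumrN; apply: eq_big_nat => j /andP[_ jn].
  have h1 := gw _ (ltnW jn); have h2 := gw _ jn.
  rewrite !cscaleE -!/(g _).
  by field; rewrite h1 h2.
rewrite cabsN; apply: (@le_trans _ _ (e1 * B^-1 * VV)).
  apply: (weighted_sum_bound hN hv) => [|j jn].
    by rewrite mulr_ge0// ltW.
  rewrite cabsM ler_pM ?cabs_ge0//.
    have := hd (j.+1%:R / n%:R) (j%:R / n%:R) (part_01 _ jn) (part_01 _ (ltnW jn)).
    rewrite -mulrBl -natrB// subSnn (mul1r n%:R^-1) ger0_norm ?invr_ge0 ?(ltW n0')// => /(_ nd).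
    by rewrite !mul1r.
  rewrite cabsV lef_pV2 ?posrE ?cabs_gt0 ?gw ?(ltW jn)//; last exact: ltnW.
  exact/hB/part_01/ltnW.
have -> : e1 * B^-1 * VV = e * VV / (VV + 1) by rewrite /e1; field; rewrite !gt_eqF.
rewrite ler_pdivrMr// ler_wpM2l ?(ltW e0)//; lra.
Qed.

(** The winding number, up to the factor 2 pi i. *)
Definition curve_index w := J (fun z => (z - w)^-1).

Lemma curve_index_lim w : off_curve w -> tends_to (@cabs R) (us (fun z => 1 / (z - w))) (curve_index w).
Proof.
move=> ow; have := J_lim (kernel_along 1 ow); rewrite /curve_index.
by under [X in J X]eq_fun do rewrite mul1r.
Qed.

(** Differentiation under the integral sign: the derivative is the limit of the
    sums in [square_kernel_sum]. *)
Lemma curve_index_deriv w : off_curve w -> has_deriv curve_index w 0.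
Proof.
move=> ow; have [d d0 hd] := off_curve_open ow.
have off p : cabs (p - w) < d -> off_curve p by move=> /hd; exact: far_off.
have ex := @kernel_sum_expands (fun=> 1) 1 d w ler01 d0
  (fun s _ => @cabs1_le1 R) hd.
have C0 : 0 <= 1 * d^-1 ^+ 3 * VV.
  by rewrite mul1r mulr_ge0// exprn_ge0// invr_ge0 ltW.
have [F1 [cv1 ex1]] := limit_expands (@open_ball R w d) C0
  (fun p pw => curve_index_lim (off p pw)) ex.
have ww : cabs (w - w) < d by rewrite subrr cabs0.
have <- : F1 w = 0 := tends_to_unique hN (cv1 w ww) (square_kernel_sum ow).
exact: expands_has_deriv (@open_ball R w d) ex1 ww.
Qed.

Lemma curve_index_segment a b :
  (forall s : R, 0 <= s <= 1 -> off_curve (a + (b - a) * s%:C)) -> curve_index b = curve_index a.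
Proof.
move=> h; apply/eqP; rewrite -subr_eq0 -cabs_eq0 eq_le cabs_ge0 andbT.
rewrite -(mul0r (cabs (b - a))).
apply: (@mean_value_segment R curve_index (fun=> 0)) => s s01; split.
  by apply: curve_index_deriv; exact: h.
by rewrite cabs0.
Qed.

Lemma curve_index_ball w : off_curve w -> exists2 d : R, 0 < d &
  forall p, cabs (p - w) < d -> off_curve p /\ curve_index p = curve_index w.
Proof.
move=> ow; have [d d0 hd] := off_curve_open ow; exists d => // p pw.
have off q : cabs (q - w) < d -> off_curve q by move=> /hd; exact: far_off.
split; first exact: off.
apply: curve_index_segment => s /andP[s0 s1]; apply: off.
rewrite addrAC subrr add0r cabsM cabs_real (ger0_norm s0).
by apply: le_lt_trans pw; rewrite ler_piMr// cabs_ge0.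
Qed.

Lemma curve_bounded : exists2 M : R, 0 <= M & forall s, 0 <= s <= 1 -> cabs (gamma s) <= M.
Proof.
have aid : along id by apply: cont_along => s _; exact: has_deriv_cont (has_deriv_id _).
by have [M M0 hM] := uniformly_continuous_bounded hN aid; exists M.
Qed.

Lemma J_bound F (B : R) : along F -> 0 <= B ->
  (forall s, 0 <= s <= 1 -> cabs (F (gamma s)) <= B) -> cabs (J F) <= B * VV.
Proof. by move=> aF; apply: (curve_integral_bound hN hv (@cabsE R) aF). Qed.

Lemma kernel_bound c M w (D : R) : 0 < D -> 0 <= M ->
  (forall s, 0 <= s <= 1 -> D <= cabs (gamma s - w)) ->
  along (fun z => c z / (z - w)) ->
  (forall s, 0 <= s <= 1 -> cabs (c (gamma s)) <= M) ->
  cabs (J (fun z => c z / (z - w))) <= M / D * VV.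
Proof.
move=> D0 M0 far al hM; apply: J_bound => //; first by rewrite divr_ge0// ltW.
move=> s s01; rewrite cabsM cabsV ler_pM ?cabs_ge0 ?invr_ge0 ?cabs_ge0//; first exact: hM.
have h := far s s01; have p : 0 < cabs (gamma s - w) by apply: lt_le_trans h.
by rewrite lef_pV2 ?posrE.
Qed.

(** The index is constant along the ray from [w] away from the origin, and tends
    to 0 on it because the kernel does. *)
Lemma curve_index_far : exists M0 : R, forall w, M0 <= cabs w -> off_curve w /\ curve_index w = 0.
Proof.
have [M M0 hM] := curve_bounded; exists (M + 1) => w wM.
have far p (D : R) : M + D <= cabs p -> forall s, 0 <= s <= 1 -> D <= cabs (gamma s - p).
  move=> pM s /hM h; have := cabs_dist p (gamma s); rewrite cabsB; lra.
have off p : M + 1 <= cabs p -> off_curve p.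
  by move=> h; apply: (far_off (d := 1)) => //; exact: far.
split; first exact: off.
apply: cabs_small => e e0.
have V1 : 0 <= VV / e by rewrite divr_ge0// ltW.
pose T := M + 1 + VV / e.
have T1 : 1 <= T by rewrite /T; lra.
have cw : 1 <= cabs w by lra.
have wT : M + (1 + VV / e) <= cabs (T%:C * w).
  rewrite cabsM cabs_real ger0_norm; last by lra.
  have : T * 1 <= T * cabs w by rewrite ler_wpM2l//; lra.
  by rewrite /T; lra.
have oT : off_curve (T%:C * w) by apply: off; lra.
have -> : curve_index w = curve_index (T%:C * w).
  apply/esym/curve_index_segment => s /andP[s0 s1]; apply: off.
  have -> : w + (T%:C * w - w) * s%:C = (1 + (T - 1) * s)%:C * w by ring.
  rewrite cabsM cabs_real.
  have h : 0 <= (T - 1) * s by rewrite mulr_ge0//; lra.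
  rewrite ger0_norm; last by lra.
  have : 1 * cabs w <= (1 + (T - 1) * s) * cabs w by rewrite ler_wpM2r//; lra.
  lra.
have := @kernel_bound (fun=> 1) 1 (T%:C * w) (1 + VV / e) ltac:(lra) ler01 (far _ _ wT)
  (kernel_along 1 oT) (fun s _ => @cabs1_le1 R).
rewrite /curve_index; under [X in J X]eq_fun do rewrite mul1r.
move/le_trans; apply; rewrite mul1r mulrC ler_pdivrMr; last by lra.
have -> : e * (1 + VV / e) = e + VV by field; rewrite gt_eqF.
lra.
Qed.

End curve.

Section difference_quotient.
Variables (R : realType) (G : R[i] -> Prop) (f f' f'' : R[i] -> R[i]).
Hypothesis oG : open_pred G.
Hypothesis hf : holomorphic G f f'.
Hypothesis hf' : holomorphic G f' f''.
Implicit Types z w : R[i].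

Definition dquot z w := if z == w then f' z else (f z - f w) / (z - w).

Lemma dquot_sym z w : dquot z w = dquot w z.
Proof.
rewrite /dquot eq_sym; case: eqVneq => [->//|wz].
by rewrite -mulrNN -invrN !opprB.
Qed.

Lemma dquotE z w : w != z -> dquot z w = (f w - f z) * (1 / (w - z)).
Proof.
by move=> wz; rewrite dquot_sym /dquot (negbTE wz) mul1r.
Qed.

(** On the diagonal, the expansion of the quotient follows from the mean value
    inequality for [f] minus its second-order Taylor polynomial. *)
Lemma dquot_deriv z w : G z -> G w -> exists d, has_deriv (dquot z) w d.
Proof.
move=> Gz Gw; have [<-|zw] := eqVneq z w; last first.
  have wz : w != z by rewrite eq_sym.
  exists ((f' w - 0) * (1 / (w - z)) + (f w - f z) * (- 1 / (w - z) ^+ 2)).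
  apply: (@has_deriv_local R (fun u => (f u - f z) * (1 / (u - z))) _ w _ (cabs (w - z))).
  - by rewrite cabs_gt0 subr_eq0.
  - move=> u uw; rewrite dquotE//; apply: contraTneq uw => ->.
    by rewrite cabsB ltxx.
  apply: has_derivM; last exact: has_deriv_kernel.
  by apply: has_derivB; [exact: hf|exact: has_deriv_cst].
exists (f'' z / 2) => e e0; clear w Gw.
have [d d0 hd] := oG Gz.
have [r r0 hr] := hf' Gz e0.
exists (Num.min d r); first by rewrite lt_min d0.
move=> w; rewrite lt_min => /andP[wd wr].
have [->|wz] := eqVneq w z.
  by rewrite !subrr mulr0 subr0 cabs0 mulr0.
have wz' : w - z != 0 by rewrite subr_eq0.
have h2 := @two_neq0 R.
rewrite dquotE// /dquot eqxx.
have -> : (f w - f z) * (1 / (w - z)) - f' z - f'' z / 2 * (w - z) =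
  ((f w - f' z * w - f'' z / 2 * ((w - z) * (w - z))) -
   (f z - f' z * z - f'' z / 2 * ((z - z) * (z - z)))) / (w - z).
  by field; rewrite wz'.
rewrite cabsM cabsV ler_pdivrMr ?cabs_gt0//.
apply: (@mean_value_segment R
  (fun u => f u - f' z * u - f'' z / 2 * ((u - z) * (u - z)))
  (fun s => f' (z + (w - z) * s) - f' z * 1 -
     f'' z / 2 * ((1 - 0) * (z + (w - z) * s - z) + (z + (w - z) * s - z) * (1 - 0)))).
move=> s /andP[s0 s1]; set u := z + (w - z) * s%:C.
have uz : cabs (u - z) <= cabs (w - z).
  rewrite /u addrAC subrr add0r cabsM cabs_real (ger0_norm s0) ler_piMr// cabs_ge0//.
split.
  apply: has_derivB.
    apply: has_derivB; last by apply: has_derivZ; exact: has_deriv_id.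
    by apply/hf/hd; exact: le_lt_trans wd.
  apply: has_derivZ; apply: (@has_derivM R (fun u => u - z) (fun u => u - z)).
    by apply: has_derivB; [exact: has_deriv_id|exact: has_deriv_cst].
  by apply: has_derivB; [exact: has_deriv_id|exact: has_deriv_cst].
have -> : f' u - f' z * 1 - f'' z / 2 * ((1 - 0) * (u - z) + (u - z) * (1 - 0)) =
  f' u - f' z - f'' z * (u - z) by field.
apply: (le_trans (hr _ (le_lt_trans uz wr))).
by rewrite ler_wpM2l// ltW.
Qed.

Lemma dquot_deriv_fun : exists dq, forall z w, G z -> G w -> has_deriv (dquot z) w (dq z w).
Proof.
have h zw : exists d, G zw.1 -> G zw.2 -> has_deriv (dquot zw.1) zw.2 d.
  have [Gz|nz] := pselect (G zw.1); last by exists 0.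
  have [Gw|nw] := pselect (G zw.2); last by exists 0.
  by have [d hd] := dquot_deriv Gz Gw; exists d.
by have [dq hdq] := choice h; exists (fun z w => dq (z, w)) => z w; exact: (hdq (z, w)).
Qed.

(** Two regimes: close points, where the mean value inequality applies, and
    distant ones, where the denominator is bounded below. *)
Lemma dquot_bound (K : R[i] -> Prop) (M : R) w0 (rho : R) :
  0 < rho -> (forall w, cabs (w - w0) < 4 * rho -> G w) ->
  (forall z, K z -> G z) -> (forall z, K z -> cabs (f z) <= M) ->
  exists2 B, 0 <= B & forall z w, K z -> cabs (w - w0) <= rho -> cabs (dquot z w) <= B.
Proof.
move=> rho0 hG KG KM.
have [B1 h1] := @cont_bounded_disc R w0 rho f ltac:(move=> z zr; apply: has_deriv_cont (hf (hG _ _)); lra).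
have [B2 h2] := @cont_bounded_disc R w0 (3 / 2 * rho) f'
  ltac:(move=> z zr; apply: has_deriv_cont (hf' (hG _ _)); lra).
have B20 : 0 <= B2.
  by apply: le_trans (h2 w0 _); rewrite ?cabs_ge0// subrr cabs0; lra.
have B10 : 0 <= B1.
  by apply: le_trans (h1 w0 _); rewrite ?cabs_ge0// subrr cabs0; lra.
have q0 : 0 < rho / 2 by rewrite divr_gt0.
pose B := B2 + `|M + B1| / (rho / 2).
have t0 : 0 <= `|M + B1| / (rho / 2) by rewrite divr_ge0// ltW.
exists B; first by rewrite /B; lra.
move=> z w Kz wr.
have [zr|zr] := leP (cabs (z - w0)) (3 / 2 * rho).
  apply: (@le_trans _ _ B2); last by rewrite /B; lra.
  have [->|wz] := eqVneq w z; first by rewrite /dquot eqxx h2.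
  rewrite dquotE// mul1r cabsM cabsV ler_pdivrMr ?cabs_gt0 ?subr_eq0//.
  apply: (@mean_value_segment R f (fun s => f' (z + (w - z) * s))) => s s01.
  have E : cabs (z + (w - z) * s%:C - w0) <= 3 / 2 * rho.
    have -> : z + (w - z) * s%:C - w0 = (1 - s)%:C * (z - w0) + s%:C * (w - w0) by ring.
    apply: (le_trans (cabsD _ _)); rewrite !cabsM !cabs_real !ger0_norm; [|lra|lra].
    have : (1 - s) * cabs (z - w0) <= (1 - s) * (3 / 2 * rho) by rewrite ler_wpM2l//; lra.
    have : s * cabs (w - w0) <= s * (3 / 2 * rho) by rewrite ler_wpM2l//; lra.
    lra.
  by split; [apply/hf/hG; lra|exact: h2].
apply: (@le_trans _ _ (`|M + B1| / (rho / 2))); last by rewrite /B; lra.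
have zw : rho / 2 <= cabs (w - z).
  by have := cabs_tri z w w0; rewrite (cabsB z w); lra.
have zw0 : 0 < cabs (w - z) by lra.
rewrite dquotE; last by rewrite -subr_eq0 -cabs_gt0.
rewrite mul1r cabsM cabsV ler_pM ?cabs_ge0 ?invr_ge0 ?cabs_ge0//.
  apply: (le_trans (cabsD _ _)); rewrite cabsN; apply: le_trans (ler_norm _).
  by have := KM z Kz; have := h1 w wr; lra.
by rewrite lef_pV2 ?posrE.
Qed.

End difference_quotient.

(** Dixon's proof: the integrals of the difference quotients of [f], and off
    [G] those of the Cauchy kernel, form an entire function that vanishes at
    infinity. *)
Section dixon.
Variables (R : realType) (gamma : R -> R[i]) (v : R -> R).
Hypothesis hv : controls v gamma.
Hypothesis gamma01 : gamma 0 = gamma 1.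
Hypothesis gamma_cont : forall s, 0 <= s <= 1 -> forall e : R, 0 < e ->
  exists2 d : R, 0 < d &
    forall u, 0 <= u <= 1 -> `|u - s| < d -> cabs (gamma u - gamma s) <= e.
Variables (G : R[i] -> Prop) (f f' : R[i] -> R[i]).
Hypothesis oG : open_pred G.
Hypothesis hf : holomorphic G f f'.
Hypothesis gammaG : forall s, 0 <= s <= 1 -> G (gamma s).
Hypothesis curve_index_out : forall w, ~ G w -> curve_index gamma w = 0.

Implicit Types (z w p : R[i]).

Let hN := cabs_complete R.
Let VV := v 1 - v 0.
Let V0 : 0 <= VV := control_ge0 hv.
Local Notation us := (uniform_sum (V := R[i]) gamma).
Local Notation along := (uniformly_continuous_along (V := R[i]) (@cabs R) gamma).
Local Notation J := (curve_integral (V := R[i]) Num.norm gamma).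

Let ballG w0 : G w0 -> exists2 rho : R, 0 < rho & forall w, cabs (w - w0) < 4 * rho -> G w.
Proof.
by move=> /oG[d d0 hd]; exists (d / 4); [rewrite divr_gt0|move=> w wd; apply: hd; lra].
Qed.

Let f_along : along f.
Proof. by apply: (cont_along gamma_cont) => s /gammaG/hf/has_deriv_cont. Qed.

Let M_exists : exists2 M : R, 0 <= M & forall s, 0 <= s <= 1 -> cabs (f (gamma s)) <= M.
Proof. by have [M M0 hM] := uniformly_continuous_bounded hN f_along; exists M. Qed.

Let fkernel_along w : off_curve gamma w -> along (fun z => f z / (z - w)).
Proof.
move=> ow; apply: (cont_along gamma_cont) => s s01.
have := has_derivM (hf (gammaG s01)) (has_deriv_kernel 1 (ow s s01)).
under [X in has_deriv X]eq_fun do rewrite mul1r.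
exact: has_deriv_cont.
Qed.

Let out_off w : ~ G w -> off_curve gamma w.
Proof. by move=> Gw s /gammaG Gs; apply/eqP => gw; apply: Gw; rewrite -gw. Qed.

Theorem cauchy_homology w : G w -> off_curve gamma w ->
  J (fun z => f z / (z - w)) = f w * curve_index gamma w.
Proof.
have [f'' hf'] := holomorphic_deriv oG hf.
have [dq hdq] := dquot_deriv_fun oG hf hf'.
pose q := dquot f f'.
have q_along p : G p -> along (fun z => q z p).
  move=> Gp; apply: (cont_along gamma_cont) => s /gammaG Gs.
  have := has_deriv_cont (hdq _ _ Gp Gs).
  by rewrite /cont_at => h e /h[r r0 hr]; exists r => // u /hr; rewrite -!/(q _ _) ![q p _]dquot_sym.
pose H p := if pselect (G p) then J (fun z => q z p) else J (fun z => f z / (z - p)).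
have J_along F : along F -> tends_to (@cabs R) (us F) (J F) by move=> /(J_lim hv).
have q_split p : G p -> off_curve gamma p ->
    J (fun z => q z p) = J (fun z => f z / (z - p)) - f p * curve_index gamma p.
  move=> Gp op; apply: (curve_integral_eq hN hv (@cabsE R) (q_along p Gp)).
  have t1 := J_along _ (fkernel_along op).
  have t2 := curve_index_lim hv gamma_cont op.
  have : tends_to (@cabs R) (fun n => us (fun z => f z / (z - p)) n +
     - f p * us (fun z => 1 / (z - p)) n) (J (fun z => f z / (z - p)) + - f p * curve_index gamma p).
    apply: tends_toD t1 _ => e e0.
    have a1 : 0 < cabs (f p) + 1 by have := cabs_ge0 (f p); lra.
    have [|n hn] := t2 (e / (cabs (f p) + 1)); first by rewrite divr_gt0.
    exists n => i /hn; rewrite -mulrBr cabsM cabsN ler_pdivlMr// => h.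
    have := cabs_ge0 (us (fun z => 1 / (z - p)) i - curve_index gamma p); lra.
  rewrite mulNr => h e /h[n hn]; exists n => i /hn.
  congr (cabs (_ - _) <= _); rewrite /uniform_sum mulr_sumr -big_split /=.
  apply: eq_big_nat => j /andP[_ ji].
  have gp := op _ (@part_01 R _ _ (ltnW ji)).
  rewrite !cscaleE /q /dquot (negbTE gp).
  have gp' : gamma (j%:R / i%:R) - p != 0 by rewrite subr_eq0.
  by field.
have H_off p : off_curve gamma p -> curve_index gamma p = 0 -> H p = J (fun z => f z / (z - p)).
  move=> op ip; rewrite /H; case: pselect => // Gp.
  by rewrite q_split// ip mulr0 subr0.
have [M M0 hM] := M_exists.
(* On [G], Cauchy's estimate provides expansions of the difference quotients
   that are uniform along the curve. Off [G], the index vanishes in a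
   neighbourhood, where [H] is therefore an integral of the Cauchy kernel. *)
have H_deriv p : exists d, has_deriv H p d.
  have [Gp|nGp] := pselect (G p).
    have [rho rho0 hrho] := ballG Gp.
    have [B B0 hB] := dquot_bound hf hf' (K := fun z => exists2 s, 0 <= s <= 1 & z = gamma s)
       rho0 hrho ltac:(move=> _ [s s01 ->]; exact: gammaG) ltac:(move=> _ [s s01 ->]; exact: hM).
    pose S w := cabs (w - p) < rho / 8.
    have SG w' : S w' -> G w' by move=> Sw; apply: hrho; move: Sw; rewrite /S; lra.
    have ex n : expands_on S (8 * B / (rho / 2) ^+ 2 * VV)
        (fun w => us (fun z => q z w) n) (fun w => us (fun z => dq z w) n).
      move=> a b Sa Sb.
      rewrite /uniform_sum -sumrB mulr_suml -sumrB.
      under eq_bigr do rewrite -scalerBr -scalerAl -scalerBr.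
      rewrite [leRHS]mulrAC.
      apply: (weighted_sum_bound hN hv) => [|j jn].
        by rewrite mulr_ge0 ?exprn_ge0 ?cabs_ge0// divr_ge0 ?mulr_ge0 ?exprn_ge0 ?divr_ge0// ltW.
      have j01 := @part_01 R n j (ltnW jn).
      apply: (@cauchy_estimate R (q (gamma (j%:R / n%:R))) (dq (gamma (j%:R / n%:R))) a (rho / 2) (3 / 2 * rho)).
      - by rewrite divr_gt0.
      - lra.
      - move=> z za; apply: hdq; first exact: gammaG.
        by apply: hrho; have := cabs_tri z a p; move: Sa; rewrite /S; lra.
      - move=> z za; apply: hB; first by exists (j%:R / n%:R).
        by have := cabs_tri z a p; move: Sa; rewrite /S; lra.
      - by have := cabs_tri b p a; rewrite (cabsB p a); move: Sa Sb; rewrite /S; lra.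
    have C0 : 0 <= 8 * B / (rho / 2) ^+ 2 * VV.
      by rewrite mulr_ge0// divr_ge0 ?mulr_ge0 ?exprn_ge0 ?divr_ge0// ltW.
    have oS : open_pred S by exact: open_ball.
    have [H1 [_ exH]] := limit_expands oS C0
      (fun w' Sw => J_along _ (q_along w' (SG w' Sw))) ex.
    have Sp : S p by rewrite /S subrr cabs0; lra.
    exists (H1 p); apply: (has_deriv_local (r := rho / 8) (f := fun w => J (fun z => q z w))).
    - lra.
    - by move=> w' /SG Gw; rewrite /H; case: pselect.
    - exact: expands_has_deriv oS exH Sp.
  have op := out_off nGp.
  have [d1 d10 h1] := off_curve_open gamma_cont op.
  have [d2 d20 h2] := curve_index_ball hv gamma01 gamma_cont op.
  pose d := Num.min d1 d2.
  have d0 : 0 < d by rewrite lt_min d10.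
  have dd1 w' : cabs (w' - p) < d -> cabs (w' - p) < d1 by rewrite lt_min => /andP[].
  have dd2 w' : cabs (w' - p) < d -> cabs (w' - p) < d2 by rewrite lt_min => /andP[].
  have far w' : cabs (w' - p) < d -> forall s, 0 <= s <= 1 -> d <= cabs (gamma s - w').
    move=> /dd1/h1 h s s01; apply: le_trans (h s s01); by rewrite ge_min lexx.
  have off w' : cabs (w' - p) < d -> off_curve gamma w' by move=> /dd2/h2[].
  have ex := kernel_sum_expands hv M0 d0 hM far.
  have C0 : 0 <= M * d^-1 ^+ 3 * VV.
    by rewrite mulr_ge0// mulr_ge0// exprn_ge0// invr_ge0 ltW.
  have [H1 [_ exH]] := limit_expands (@open_ball R p d) C0
    (fun w' wd => J_along _ (fkernel_along (off w' wd))) ex.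
  exists (H1 p); apply: (has_deriv_local d0 (f := fun w => J (fun z => f z / (z - w)))).
    move=> w' wd; rewrite H_off//; first exact: off.
    by have [_ ->] := h2 _ (dd2 _ wd); exact: curve_index_out.
  by apply: expands_has_deriv (@open_ball R p d) exH _; rewrite subrr cabs0.
have [H' hH'] := choice H_deriv.
have H0 : forall p, H p = 0.
  apply: (@liouville R H H') => [p _|e e0]; first exact: hH'.
  have [M0' far] := curve_index_far hv gamma01 gamma_cont.
  have [M1 M10 hM1] := curve_bounded gamma_cont.
  have t0 : 0 <= M * VV / e by rewrite divr_ge0 ?mulr_ge0// ltW.
  pose D := M * VV / e + 1.
  exists (`|M0'| + M1 + D) => p pM.
  have n0 := normr_ge0 M0'; have D0 : 0 < D by rewrite /D; lra.
  have [op ip] := far p ltac:(have := ler_norm M0'; lra).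
  rewrite H_off//.
  have hD s : 0 <= s <= 1 -> D <= cabs (gamma s - p).
    by move=> /hM1 h; have := cabs_dist p (gamma s); rewrite (cabsB p); lra.
  apply: (le_trans (kernel_bound hv D0 M0 hD (fkernel_along op) hM)).
  rewrite -/VV mulrAC ler_pdivrMr//.
  have -> : e * D = M * VV + e by rewrite /D; field; rewrite gt_eqF.
  by rewrite lerDl ltW.
move=> Gw ow; have := H0 w; rewrite /H; case: pselect => //= _.
by rewrite q_split// => /eqP; rewrite subr_eq0 => /eqP.
Qed.

End dixon.

(** * A curve surrounding an interval *)

Section lipschitz.
Variables (R : realType) (gamma : R -> R[i]) (K : R).
Hypothesis gammaK : forall x y, cabs (gamma x - gamma y) <= K * `|x - y|.

Let K0 : 0 <= K.
Proof. by have := gammaK 1 0; rewrite subr0 normr1 mulr1; apply: le_trans; exact: cabs_ge0. Qed.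

Lemma lipschitz_controls : controls (fun x => K * x) gamma.
Proof.
move=> x y x0 xy y1; apply: (le_trans (gammaK _ _)).
by rewrite -mulrBr ger0_norm// subr_ge0.
Qed.

Lemma lipschitz_continuous : continuous gamma.
Proof.
move=> x; apply/cvgrPdist_le => e e0.
have eE : e = (Re e)%:C by rewrite RRe_real// gtr0_real.
have e'0 : 0 < Re e by move: e0; rewrite {1}eE ltcR.
have K1 : 0 < K + 1 by have := K0; lra.
apply/nbhs_normP; exists (Re e / (K + 1)) => /=; first by rewrite divr_gt0.
move=> y /=; rewrite ltr_pdivlMr// => xy.
rewrite eE cabsE lecR; apply: (le_trans (gammaK _ _)).
have := normr_ge0 (x - y); lra.
Qed.

Lemma lipschitz_rectifiable : rectifiable gamma.
Proof.
exists K => s [ps /eqP ls].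
rewrite /curve_variation; set x := nth 1 (0 :: s).
apply: (@le_trans _ _ (\sum_(0 <= i < size s) (K * (x i.+1 - x i))%:C)).
  rewrite big_nat_cond [leRHS]big_nat_cond; apply: ler_sum => i /andP[/andP[_ hi] _].
  rewrite cabsE lecR; apply: (le_trans (gammaK _ _)).
  rewrite ger0_norm// subr_ge0 ltW//; exact: (pathP 1 ps).
rewrite -rmorph_sum lecR -mulr_sumr telescope_sumr//.
by rewrite {1}/x -(last_nth 1) ls /x /= subr0 mulr1.
Qed.

End lipschitz.

Section ellipse.
Variables (R : realType) (m M rho : R).
Hypotheses (mM : m < M) (rho0 : 0 < rho).

(** [al + be] and [al - be] are the semiaxes; the relation
    [4 * al * be = L ^+ 2] places the foci at [m] and [M], and [del] is such that
    the ellipse stays within [rho] of the interval between them. *)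
Let L := (M - m) / 2.
Let c := (m + M) / 2.
Let del := rho / (2 * L).
Let t := 1 + del.
Let al := L / 2 * t.
Let be := L / 2 / t.

Let L0 : 0 < L. Proof. by rewrite divr_gt0// subr_gt0. Qed.
Let L20 : 0 < L / 2. Proof. by apply: divr_gt0 => //; exact: L0. Qed.
Let del0 : 0 < del. Proof. by rewrite divr_gt0// mulr_gt0. Qed.
Let t1 : 1 < t. Proof. by rewrite /t; have := del0; lra. Qed.
Let t0 : 0 < t. Proof. exact: lt_trans t1. Qed.
Let al0 : 0 < al. Proof. by rewrite mulr_gt0// divr_gt0. Qed.
Let be0 : 0 < be. Proof. by rewrite divr_gt0// divr_gt0. Qed.

(** The Joukowski map sends the unit circle to the ellipse and other circles to
    confocal ellipses, so that it also describes the points on either side. *)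
Let jou (u : R[i]) : R[i] := c%:C + al%:C * u + be%:C * u^-1.

Definition ellipse (s : R) : R[i] := jou (cis (2 * pi * s)).

Let rC (x : R) : 0 < x -> x%:C != 0 :> R[i].
Proof. by move=> x0; rewrite -cabs_gt0 cabs_real gtr0_norm. Qed.

Let cis_neq0 (x : R) : cis x != 0.
Proof. by rewrite -cabs_gt0 cabs_cis. Qed.

Let cisV (x : R) : (cis x)^-1 = cis (- x).
Proof.
by apply: (mulIf (cis_neq0 x)); rewrite mulVf// -cisD addNr cis0.
Qed.

Let ellipse_lip x y : cabs (ellipse x - ellipse y) <= (al + be) * (4 * pi) * `|x - y|.
Proof.
have p0 := @pi_gt0 R.
have -> : ellipse x - ellipse y = al%:C * (cis (2 * pi * x) - cis (2 * pi * y)) +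
  be%:C * (cis (- (2 * pi * x)) - cis (- (2 * pi * y))).
  by rewrite /ellipse /jou !cisV; ring.
apply: (le_trans (cabsD _ _)); rewrite !cabsM !cabs_real (gtr0_norm al0) (gtr0_norm be0).
have E : `|2 * pi * x - 2 * pi * y| = 2 * pi * `|x - y|.
  by rewrite -mulrBr normrM ger0_norm// mulr_ge0// ltW.
have h1 := cis_lip (2 * pi * x) (2 * pi * y).
have h2 := cis_lip (- (2 * pi * x)) (- (2 * pi * y)).
have E2 : `|- (2 * pi * x) - - (2 * pi * y)| = 2 * pi * `|x - y|.
  by rewrite -opprD normrN E.
rewrite E in h1; rewrite E2 in h2.
have -> : (al + be) * (4 * pi) * `|x - y| = al * (2 * (2 * pi * `|x - y|)) +
  be * (2 * (2 * pi * `|x - y|)) by ring.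
by rewrite lerD// ler_wpM2l// ltW.
Qed.

Let ellipse01 : ellipse 0 = ellipse 1.
Proof. by rewrite /ellipse mulr0 mulr1 cis2pi cis0. Qed.

Lemma ellipse_curve : closed_rectifiable_curve ellipse.
Proof.
split; [|exact: ellipse01|exact: lipschitz_rectifiable ellipse_lip].
by apply: continuous_subspaceT; exact: lipschitz_continuous ellipse_lip.
Qed.

Let hv := lipschitz_controls ellipse_lip.
Let hcont := within_continuous_dist (let: And3 h _ _ := ellipse_curve in h).

(** The other solution [v] of [jou v = jou u]. *)
Let q u := be%:C / (u * al%:C).

Let factor (ze u : R[i]) : ze != 0 -> u != 0 ->
  jou ze - jou u = (ze - u) * (al%:C * (ze - q u) / ze).
Proof.
move=> z0 u0; have a0 := rC al0; rewrite /jou /q; field.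
by rewrite z0 a0 u0.
Qed.

Section index_of_ellipse.
Variable u : R[i].
Hypotheses (u0 : u != 0) (u1 : cabs u != 1) (qu : cabs (q u) < 1).

Let away (ze : R[i]) : cabs ze = 1 -> (ze != 0) * (ze - u != 0) * (ze - q u != 0).
Proof.
move=> z1; rewrite -[ze != 0]cabs_gt0 z1 ltr01 !subr_eq0; split; first split=> //.
  by apply: contraNneq u1 => <-; rewrite z1.
by apply: contraTneq qu => <-; rewrite z1 ltxx.
Qed.

Lemma ellipse_off : off_curve ellipse (jou u).
Proof.
move=> s _; have h := away (cabs_cis (2 * pi * s)).
by rewrite -subr_eq0 /ellipse factor ?h// !mulf_neq0 ?invr_neq0 ?h// rC.
Qed.

(** In the coordinate of the Joukowski map, the Cauchy kernel of the ellipse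
    splits into kernels at [u], at [q u] and at 0, up to the error [Er] that
    comes from the increments of the term with [be]. The averages of the three
    kernels over the roots of unity are known. *)
Let index_lim0 l : tends_to (@cabs R) (fun n => (1 - u ^+ n)^-1) l ->
  curve_index ellipse (jou u) = two_pi_i R * l.
Proof.
move=> cl.
have ow := ellipse_off.
have hlim := curve_index_lim hv hcont ow.
suff: tends_to (@cabs R) (uniform_sum (V := R[i]) ellipse (fun z => 1 / (z - jou u))) (two_pi_i R * l) by exact: (tends_to_unique (cabs_complete R) hlim).
move=> e e0.
have [B B0 hB] := off_curve_bound hcont ow.
have p0 := @pi_gt0 R.
pose A n := (1 - u ^+ n)^-1 + (1 - q u ^+ n)^-1 - 1.
have cA : tends_to (@cabs R) A l.
  have h := tends_toD cl (inv_power_lim_in qu).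
  move=> e1 /h[n hn]; exists n => i /hn; congr (cabs _ <= _).
  by rewrite /A; ring.
pose Er n := n%:R^-1 * \sum_(0 <= j < n)
  (be%:C / rou R n ^+ j / (ellipse (j%:R / n%:R) - jou u)).
have Erb n : cabs (Er n) <= be / B.
  case: n => [|n]; first by rewrite /Er big_geq// mulr0 cabs0 divr_ge0 ?ltW.
  rewrite /Er cabsM cabsV cabs_nat ler_pdivrMl ?ltr0n//.
  apply: le_trans (cabs_sum _ _ _) _.
  apply: (@le_trans _ _ (\sum_(0 <= j < n.+1) (be / B))); last first.
    by rewrite sumr_const_nat subn0 mulr_natl.
  rewrite big_nat_cond [leRHS]big_nat_cond; apply: ler_sum => j /andP[/andP[_ jn] _].
  rewrite !cabsM !cabsV cabsX cabs_rou expr1n invr1 mulr1 cabs_real gtr0_norm//.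
  rewrite ler_wpM2l ?(ltW be0)// lef_pV2 ?posrE.
  - exact/hB/part_01/ltnW.
  - by apply: lt_le_trans (hB _ (@part_01 R _ _ (ltnW jn))).
  - by [].
have E n : (0 < n)%N -> uniform_sum (V := R[i]) ellipse (fun z => 1 / (z - jou u)) n =
    n%:R * (rou R n - 1) * (A n - ((rou R n)^-1 - 1) * Er n).
  move=> n0; have n0' : (n%:R : R[i]) != 0 by rewrite pnatr_eq0 -lt0n.
  have AE : A n = n%:R^-1 * \sum_(0 <= j < n) (rou R n ^+ j / (rou R n ^+ j - u) +
      rou R n ^+ j / (rou R n ^+ j - q u) - 1).
    rewrite /A -(mean_kernel n0 u1) -(mean_kernel n0 (negbT (lt_eqF qu))).
    rewrite sumrB big_split /= sumr_const_nat subn0 mulrBr mulrDr !big_mkord.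
    by rewrite mulVf.
  rewrite AE /Er (mulrCA ((rou R n)^-1 - 1)) -mulrBr mulrACA divff// mul1r mulr_sumr -sumrB.
  rewrite mulr_sumr; apply: eq_big_nat => j /andP[_ jn]; rewrite cscaleE.
  have EJ k : ellipse (k%:R / n%:R) = jou (rou R n ^+ k).
    rewrite /ellipse /rou cisX; congr (jou (cis _)); rewrite mulrA mulrAC//.
  rewrite !EJ; set om := rou R n; set ze := om ^+ j.
  have z1 : cabs ze = 1 by rewrite cabsX cabs_rou expr1n.
  have h := away z1; have om0 : om != 0 by exact: rou_neq0.
  have a0 := rC al0.
  rewrite (@factor ze u) ?h// exprS -/ze.
  have zq : ze * u * al%:C - be%:C != 0.
    have -> : ze * u * al%:C - be%:C = (ze - q u) * (u * al%:C) by rewrite /q; field; rewrite u0 a0.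
    by rewrite !mulf_neq0 ?h.
  have hz : ze != 0 by rewrite h.
  have hzu : ze - u != 0 by rewrite h.
  rewrite /jou /q; field.
  have zq' : ze * (u * al%:C) - be%:C != 0 by rewrite mulrA.
  by rewrite hz hzu zq' u0 a0 om0.
pose Q := cabs (two_pi_i R); pose b := be / B.
have Q0 : 0 <= Q by exact: cabs_ge0.
have b0 : 0 <= b by rewrite divr_ge0// ltW.
have l0 := cabs_ge0 l.
have Qb : 0 <= Q * b by rewrite mulr_ge0.
pose W := cabs l + 1 + b + Q + Q * b + 1.
have W0 : 0 < W by rewrite /W; lra.
pose d := Num.min 1 (e / W).
have d0 : 0 < d by rewrite lt_min ltr01 divr_gt0.
have d1 : d <= 1 by rewrite ge_min lexx.
have dW : d * W <= e by rewrite -ler_pdivlMr// ge_min lexx orbT.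
have [n1 h1] := cA _ d0; have [n2 h2] := rou_lim d0.
have [n3 h3] := rou_lim_deriv d0.
exists (maxn (maxn n1 n2) (maxn n3 1)) => n.
rewrite !geq_max => /andP[/andP[/h1 a1 /h2 +] /andP[/h3 + n0]].
move=> /(_ n0) a2 /(_ n0) a3; rewrite E//.
set om := rou R n in a2 a3 *.
have om0 : om != 0 by exact: rou_neq0.
have a4 : cabs (om^-1 - 1) <= d.
  have -> : om^-1 - 1 = - (om - 1) / om by field.
  by rewrite cabsM cabsN cabsV cabs_rou invr1 mulr1.
have a5 := Erb n; rewrite -/b in a5.
have a6 : cabs ((om^-1 - 1) * Er n) <= d * b by rewrite cabsM ler_pM ?cabs_ge0.
have a7 : cabs (A n - (om^-1 - 1) * Er n) <= cabs l + 1 + b.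
  have -> : A n - (om^-1 - 1) * Er n = l + (A n - l) - (om^-1 - 1) * Er n by ring.
  apply: (le_trans (cabsD _ _)); rewrite cabsN.
  have : d * b <= 1 * b by rewrite ler_wpM2r.
  by have := cabsD l (A n - l); lra.
have -> : n%:R * (om - 1) * (A n - (om^-1 - 1) * Er n) - two_pi_i R * l =
  (n%:R * (om - 1) - two_pi_i R) * (A n - (om^-1 - 1) * Er n) +
  two_pi_i R * (A n - l) - two_pi_i R * ((om^-1 - 1) * Er n) by ring.
apply: (le_trans (cabsD _ _)); rewrite cabsN.
apply: (le_trans (lerD (cabsD _ _) (lexx _))).
rewrite !(cabsM (two_pi_i R)) [cabs (_ * (A n - _))]cabsM -/Q.
have b1 : cabs (n%:R * (om - 1) - two_pi_i R) * cabs (A n - (om^-1 - 1) * Er n) <=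
  d * (cabs l + 1 + b) by rewrite ler_pM ?cabs_ge0.
have b2 : Q * cabs (A n - l) <= Q * d by rewrite ler_wpM2l.
have b3 : Q * cabs ((om^-1 - 1) * Er n) <= Q * (d * b) by rewrite ler_wpM2l.
have : d * W = d * (cabs l + 1 + b) + Q * d + Q * (d * b) + d by rewrite /W; ring.
lra.
Qed.

Lemma ellipse_index_in : cabs u < 1 -> curve_index ellipse (jou u) = two_pi_i R.
Proof. by move=> /inv_power_lim_in/index_lim0; rewrite mulr1. Qed.

Lemma ellipse_index_out : 1 < cabs u -> curve_index ellipse (jou u) = 0.
Proof. by move=> /inv_power_lim_out/index_lim0; rewrite mulr0. Qed.

End index_of_ellipse.

(** Write [x = c + L * cos a]; then [u] is the point of argument [a] on the
    circle of radius [1 / t], which the Joukowski map folds onto the focal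
    interval. *)
Let interior_pt (x : R) : m <= x <= M ->
  exists u, [/\ u != 0, cabs u = t^-1, x%:C = jou u & cabs (q u) = t^-1].
Proof.
move=> xm; pose y := (x - c) / L.
have y1 : y ^+ 2 <= 1.
  rewrite -(expr1n _ 2) -[y ^+ 2]real_normK ?num_real// lerXn2r ?nnegrE//.
  rewrite ler_norml /y ler_pdivlMr// ler_pdivrMr// /L /c; lra.
pose e : R[i] := y +i* Num.sqrt (1 - y ^+ 2).
have e1 : cabs e = 1.
  by rewrite cabs_sqrt /= sqr_sqrtr ?subr_ge0// addrC subrK sqrtr1.
have e0 : e != 0 by rewrite -cabs_gt0 e1.
have eV : e^-1 = e^*%C by rewrite invc_norm cabsE e1 expr1n invr1 mul1r.
have tC := rC t0; have aC := rC al0.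
exists (e / t%:C); have u0 : e / t%:C != 0 by rewrite mulf_neq0// invr_neq0.
have cu : cabs (e / t%:C) = t^-1 by rewrite cabsM e1 mul1r cabsV cabs_real gtr0_norm.
split=> //.
  rewrite /jou invfM invrK.
  have -> : c%:C + al%:C * (e / t%:C) + be%:C * (e^-1 * t%:C) =
      c%:C + (L / 2)%:C * (e + e^-1).
    have -> : al%:C = (L / 2)%:C * t%:C by rewrite -rmorphM.
    have -> : be%:C = (L / 2)%:C / t%:C by rewrite -fmorph_div.
    by field; rewrite e0 tC.
  rewrite eV addcJ /e /= -(rmorph_nat (real_complex R)) -!rmorphM -rmorphD /=.
  by congr (_%:C); rewrite /y; field; rewrite gt_eqF.
rewrite /q cabsM cabsV cabsM cu !cabs_real !gtr0_norm//.
by rewrite /al /be; field; rewrite !gt_eqF.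
Qed.

(** The confocal ellipse through [jou u] has semiaxes close to [L] and to 0; the
    interval point is the image of the point of the same argument on the circle
    of radius [1 / t]. *)
Let near_interval (u : R[i]) : t^-1 <= cabs u -> cabs u <= 1 ->
  exists2 x, m <= x <= M & cabs (jou u - x%:C) < rho.
Proof.
move=> u1 u2; have tC := rC t0.
have u0 : 0 < cabs u by apply: lt_le_trans u1; rewrite invr_gt0.
have un : u != 0 by rewrite -cabs_gt0.
pose e := u / (cabs u)%:C.
have cuC : (cabs u)%:C != 0 :> R[i] by exact: rC.
have e1 : cabs e = 1 by rewrite cabsM cabsV cabs_real gtr0_norm// divff// gt_eqF.
have e0 : e != 0 by rewrite -cabs_gt0 e1.
have eV : e^-1 = e^*%C by rewrite invc_norm cabsE e1 expr1n invr1 mul1r.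
have Re1 : `|Re e| <= 1 by rewrite -e1 Re_le_cabs.
exists (c + L * Re e).
  move: Re1; rewrite ler_norml => /andP[r1 r2].
  have : L * -1 <= L * Re e by rewrite ler_wpM2l// ltW.
  have : L * Re e <= L * 1 by rewrite ler_wpM2l// ltW.
  by rewrite /L /c; lra.
pose r := t * cabs u.
have r1 : 1 <= r by rewrite /r mulrC -ler_pdivrMr// mul1r.
have r2 : r <= t by rewrite /r ler_piMr// ltW.
have r0 : 0 < r by lra.
have E : jou u - (c + L * Re e)%:C = (L / 2)%:C * ((r - 1)%:C * e + (r^-1 - 1)%:C * e^-1).
  have -> : (c + L * Re e)%:C = c%:C + (L / 2)%:C * (e + e^-1).
    rewrite eV addcJ -(rmorph_nat (real_complex R)) -!rmorphM -rmorphD /=.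
    by congr (_%:C); field.
  rewrite /jou.
  have -> : al%:C = (L / 2)%:C * t%:C by rewrite -rmorphM.
  have -> : be%:C = (L / 2)%:C / t%:C by rewrite -fmorph_div.
  have -> : (r - 1)%:C = t%:C * (cabs u)%:C - 1 by rewrite rmorphB rmorphM.
  have -> : (r^-1 - 1)%:C = (t%:C * (cabs u)%:C)^-1 - 1 by rewrite rmorphB fmorphV rmorphM.
  by rewrite /e; field; rewrite tC cuC un.
rewrite E cabsM cabs_real (gtr0_norm L20).
have i1 : r^-1 <= 1 by rewrite invf_le1.
have i0 : 0 < r^-1 by rewrite invr_gt0.
have ri : r * r^-1 = 1 by rewrite divff// gt_eqF.
have h : cabs ((r - 1)%:C * e + (r^-1 - 1)%:C * e^-1) <= 2 * del.
  apply: (le_trans (cabsD _ _)); rewrite [cabs (_%:C * e)]cabsM [cabs (_%:C * e^-1)]cabsM cabsV e1 invr1 !mulr1 !cabs_real.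
  have rd : r - 1 <= del by move: r2; rewrite /t; lra.
  rewrite ger0_norm ?subr_ge0// ler0_norm ?subr_le0//.
  have : 1 - r^-1 <= r - 1 by nra.
  by lra.
have h' := ler_wpM2l (ltW L20) h.
apply: (le_lt_trans h').
have -> : L / 2 * (2 * del) = rho / 2 by rewrite /del; field; rewrite gt_eqF.
by have := rho0; lra.
Qed.

(** The root of larger modulus of the Joukowski equation. *)
Let jou_surj w : exists u, [/\ u != 0, w = jou u & t^-1 <= cabs u].
Proof.
have aC := rC al0; have bC := rC be0; have h2 := @two_neq0 R.
pose y := w - c%:C; pose s := sqrtc (y ^+ 2 - 4 * al%:C * be%:C).
have s2 : s ^+ 2 = y ^+ 2 - 4 * al%:C * be%:C by exact: sqr_sqrtc.
have root (e : R[i]) : e ^+ 2 = 1 -> let u := (y + e * s) / (2 * al%:C) in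
    al%:C * u ^+ 2 - y * u + be%:C = 0.
  move=> e2 /=.
  have -> : al%:C * ((y + e * s) / (2 * al%:C)) ^+ 2 - y * ((y + e * s) / (2 * al%:C)) + be%:C =
    (e ^+ 2 * s ^+ 2 - y ^+ 2 + 4 * al%:C * be%:C) / (4 * al%:C).
    by field; rewrite aC.
  rewrite e2 s2 (_ : 1 * (y ^+ 2 - 4 * al%:C * be%:C) - y ^+ 2 + 4 * al%:C * be%:C = 0) ?mul0r//.
  by ring.
pose u1 := (y + 1 * s) / (2 * al%:C); pose u2 := (y + (-1) * s) / (2 * al%:C).
have m1 : (-1 : R[i]) ^+ 2 = 1 by rewrite sqrrN expr1n.
have r1 := root 1 (expr1n _ _); have r2 := root (-1) m1.
rewrite /= -/u1 in r1; rewrite /= -/u2 in r2.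
have p12 : u1 * u2 = be%:C / al%:C.
  have -> : u1 * u2 = (y ^+ 2 - s ^+ 2) / (4 * al%:C ^+ 2) by rewrite /u1 /u2; field; rewrite aC.
  by rewrite s2; field; rewrite aC.
have cp : cabs u1 * cabs u2 = t^-1 ^+ 2.
  rewrite -cabsM p12 cabsM cabsV !cabs_real !gtr0_norm//.
  by rewrite /al /be; field; rewrite !gt_eqF.
have ti : 0 < t^-1 by rewrite invr_gt0.
have fin u : al%:C * u ^+ 2 - y * u + be%:C = 0 -> t^-1 <= cabs u ->
    exists u, [/\ u != 0, w = jou u & t^-1 <= cabs u].
  move=> ru tu; have u0 : u != 0 by rewrite -cabs_gt0; apply: lt_le_trans tu.
  exists u; split=> //; rewrite /jou.
  have -> : be%:C = y * u - al%:C * u ^+ 2.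
    by apply/eqP; rewrite -subr_eq0 -ru; apply/eqP; ring.
  by rewrite /y; field.
have [h|h] := leP (t^-1) (cabs u1); first exact: fin r1 h.
apply: fin r2 _; rewrite leNgt; apply/negP => h'.
have : cabs u1 * cabs u2 < t^-1 * t^-1 by rewrite ltr_pM ?cabs_ge0.
by rewrite cp expr2 ltxx.
Qed.

Lemma ellipse_surrounds (G S : set R[i]) :
  (forall x : R, m <= x <= M -> forall w, cabs (w - x%:C) < rho -> G w) ->
  (S `<=` [set x%:C | x in `[m, M]])%classic -> surrounds G S ellipse.
Proof.
move=> hG hS; have tpi : two_pi_i R != 0.
  by rewrite mulf_neq0// ?rC ?mulr_gt0 ?pi_gt0// -cabs_gt0 cabs_i.
have ti1 : t^-1 < 1 by rewrite invf_lt1.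
split.
- exact: ellipse_curve.
- move=> _ [s _ <-].
  have [||x xm /hG] := @near_interval (cis (2 * pi * s)); rewrite ?cabs_cis ?(ltW ti1)//.
  exact.
- move=> _ /hS[x] xm <-; rewrite /= in_itv /= in xm.
  have [u [u0 cu -> cq]] := interior_pt xm.
  have u1 : cabs u < 1 by rewrite cu.
  have qu : cabs (q u) < 1 by rewrite cq.
  split; first by move=> [s /=]; rewrite in_itv /= => s01; apply/eqP/(ellipse_off u0 _ qu s01); rewrite lt_eqF.
  by rewrite /winding_number -/(curve_index _ _) ellipse_index_in// ?lt_eqF// mulVf.
- move=> w nGw; have [u [u0 wE tu]] := jou_surj w.
  have u1 : 1 < cabs u.
    rewrite ltNge; apply/negP => /(near_interval tu)[x xm]; rewrite -wE => /(hG x xm).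
    exact: nGw.
  have qu : cabs (q u) < 1.
    have cu0 : 0 < cabs u by lra.
    rewrite /q cabsM cabsV cabsM !cabs_real (gtr0_norm al0) (gtr0_norm be0).
    rewrite ltr_pdivrMr; last exact: mulr_gt0.
    rewrite mul1r; have : be < al.
      rewrite /al /be ltr_pM2l//; exact: lt_trans ti1 t1.
    have : 1 * al < cabs u * al by rewrite ltr_pM2r.
    lra.
  rewrite /outside /= wE; split.
    by move=> [s /=]; rewrite in_itv /= => s01; apply/eqP/(ellipse_off u0 _ qu s01); rewrite gt_eqF.
  by rewrite /winding_number -/(curve_index _ _) ellipse_index_out// ?gt_eqF// mulr0.
Qed.

End ellipse.

(** * Invertibility in Banach algebras *)

Section banach_algebra.
Variables (R : realType) (A : banachAlgType R[i]).
Implicit Types (x y a b h : A).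

Lemma bnorm_ge0 x : 0 <= bnorm x.
Proof.
have b0 : bnorm (0 : A) = 0 by rewrite -(scale0r 0) bnormZ normr0 mul0r.
have := bnormD x (- x); rewrite subrr b0 -scaleN1r bnormZ normrN1 mul1r -mulr2n.
by rewrite pmulrn_lge0.
Qed.

Definition rnorm x : R := Re (bnorm x).

Lemma bnormE x : bnorm x = (rnorm x)%:C.
Proof. by rewrite /rnorm RRe_real// ger0_real// bnorm_ge0. Qed.

Lemma rnorm_complete : complete_norm rnorm.
Proof.
split.
- by move=> x y; rewrite -lecR rmorphD /= -!bnormE bnormD.
- move=> a x; apply: (@complexI R); rewrite rmorphM /= -!bnormE -cabsE; exact: bnormZ.
- by move=> x x0; apply: bnorm0_eq0; rewrite bnormE x0.
move=> u cu; have [|l hl] := @bnorm_complete _ A u.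
  move=> e e0; have eE : e = (Re e)%:C by rewrite RRe_real// gtr0_real.
  have e'0 : 0 < Re e by move: e0; rewrite {1}eE ltcR.
  have [|n hn] := cu (Re e / 2); first by rewrite divr_gt0.
  exists n => i j ni nj; rewrite bnormE eE ltcR; have := hn i j ni nj; lra.
exists l => e e0; have [|n hn] := hl e%:C; first by rewrite ltcR.
by exists n => i /hn; rewrite bnormE ltcR => /ltW.
Qed.

Let hN := rnorm_complete.

Lemma rnormM x y : rnorm (x * y) <= rnorm x * rnorm y.
Proof. by rewrite -lecR rmorphM /= -!bnormE bnormM. Qed.

Lemma rnorm_ge0 x : 0 <= rnorm x. Proof. exact: cn_ge0. Qed.

Lemma rnorm1_ge1 : 1 <= rnorm (1 : A).
Proof.
have h : rnorm (1 : A) != 0.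
  by apply/eqP => /(cn0_eq0 hN)/eqP; rewrite oner_eq0.
have p : 0 < rnorm (1 : A) by rewrite lt_neqAle eq_sym h rnorm_ge0.
by have := rnormM 1 1; rewrite mulr1 -{1}[rnorm 1]mulr1 ler_pM2l.
Qed.

Lemma rnormX x n : rnorm (x ^+ n) <= rnorm (1 : A) * rnorm x ^+ n.
Proof.
elim: n => [|n ih]; first by rewrite !expr0 mulr1.
rewrite exprS; apply: (le_trans (rnormM _ _)).
by rewrite exprS mulrCA ler_wpM2l// rnorm_ge0.
Qed.

Lemma rnormXS x n : rnorm (x ^+ n.+1) <= rnorm x ^+ n.+1.
Proof.
elim: n => [|n ih]; first by rewrite !expr1.
rewrite exprS; apply: (le_trans (rnormM _ _)).
by rewrite [leRHS]exprS ler_wpM2l// rnorm_ge0.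
Qed.

Lemma neumann x : rnorm x < 1 -> 1 - x \is a GRing.unit.
Proof.
move=> x1; have x0 := rnorm_ge0 x; have N1 := rnorm1_ge1.
pose s n := \sum_(i < n) x ^+ i.
have s_step n k : rnorm (s (n + k)%N - s n) <= rnorm (1 : A) * rnorm x ^+ n / (1 - rnorm x).
  have key : rnorm (s (n + k)%N - s n) <=
      rnorm (1 : A) * (rnorm x ^+ n - rnorm x ^+ (n + k)) / (1 - rnorm x).
    elim: k => [|k ih]; first by rewrite addn0 !subrr (cn0 hN) mulr0 mul0r.
    rewrite addnS /s big_ord_recr /= -/(s _).
    have -> : s (n + k)%N + x ^+ (n + k) - s n = (s (n + k)%N - s n) + x ^+ (n + k).
      by rewrite addrAC.
    apply: (le_trans (cnD hN _ _)); apply: (le_trans (lerD ih (rnormX _ _))).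
    rewrite le_eqVlt; apply/orP; left; apply/eqP; rewrite exprS; field.
    by rewrite subr_eq0 gt_eqF.
  apply: (le_trans key); rewrite ler_pM2r ?invr_gt0 ?subr_gt0//.
  rewrite ler_wpM2l ?(le_trans ler01)//.
  by rewrite gerBl exprn_ge0.
have [l hl] : exists l, tends_to rnorm s l.
  apply: (cn_complete hN) => e e0.
  have d0 : 0 < e / 2 * (1 - rnorm x) / rnorm (1 : A).
    have Np : 0 < rnorm (1 : A) by lra.
    by rewrite divr_gt0// mulr_gt0 ?subr_gt0// divr_gt0.
  have [|n hn] := @expr_small R (rnorm x) _ _ d0; first by rewrite x0.
  have e2 i : (n <= i)%N -> rnorm (s i - s n) <= e / 2.
    move=> /subnKC <-; apply: (le_trans (s_step _ _)).
    have := hn n (leqnn n); rewrite ler_pdivlMr ?(lt_le_trans ltr01)// => h.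
    by rewrite ler_pdivrMr ?subr_gt0// mulrC.
  exists n => i j /e2 h1 /e2 h2; have := cn_tri hN (s i) (s n) (s j).
  by rewrite (cnB hN (s n)); lra.
have E1 n : (1 - x) * s n = 1 - x ^+ n.
  by have := subrX1 x n => /(congr1 -%R); rewrite -mulNr !opprB.
have E2 n : s n * (1 - x) = 1 - x ^+ n.
  rewrite -E1 /s mulr_suml mulr_sumr; apply: eq_bigr => i _.
  by rewrite mulrBr mulrBl mulr1 mul1r -exprS -exprSr.
have lim (y : A) (B : R) : 0 <= B -> (forall n, rnorm (y - (1 - x ^+ n)) <= B * rnorm (s n - l)) -> y = 1.
  move=> B0 h; apply: (cn_eq hN) => e e0.
  have [|n1 h1] := hl (e / 2 / (B + 1)); first by rewrite !divr_gt0//; lra.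
  have [||n2 h2] := @expr_small R (rnorm x) (e / 2 / rnorm (1 : A)).
  - by rewrite x0.
  - have Np : 0 < rnorm (1 : A) by lra.
    by rewrite divr_gt0// divr_gt0.
  pose n := maxn n1 n2.
  have a1 : rnorm (s n - l) * (B + 1) <= e / 2.
    by rewrite -ler_pdivlMr; [exact: h1 (leq_maxl _ _)|lra].
  have a2 : rnorm x ^+ n * rnorm (1 : A) <= e / 2.
    by rewrite -ler_pdivlMr; [exact: h2 (leq_maxr _ _)|lra].
  have a3 := h n; have a4 := rnormX x n.
  have := cn_tri hN y (1 - x ^+ n) 1.
  have -> : 1 - x ^+ n - 1 = - x ^+ n by rewrite addrAC subrr add0r.
  rewrite (cnN hN); have := rnorm_ge0 (s n - l); lra.
apply/unitrP; exists l; split.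
  apply: (lim _ (rnorm (1 - x))) => [|n]; first exact: rnorm_ge0.
  by rewrite -E2 -mulrBl (cnB hN (s n)) [leRHS]mulrC rnormM.
apply: (lim _ (rnorm (1 - x))) => [|n]; first exact: rnorm_ge0.
by rewrite -E1 -mulrBr (cnB hN (s n)) rnormM.
Qed.

Lemma neumann_bound x : rnorm x < 1 ->
  rnorm (1 - x)^-1 <= rnorm (1 : A) / (1 - rnorm x) /\
  rnorm ((1 - x)^-1 - 1) <= rnorm x * rnorm (1 - x)^-1.
Proof.
move=> x1; have u := neumann x1; set y := (1 - x)^-1.
have E : y = 1 + x * y by have := mulrV u; rewrite mulrBl mul1r => <-; rewrite subrK.
split; last by rewrite {1}E addrAC subrr add0r rnormM.
rewrite ler_pdivlMr ?subr_gt0//.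
have := cnD hN 1 (x * y); rewrite -E; have := rnormM x y; lra.
Qed.

Lemma unit_perturb a h : a \is a GRing.unit -> rnorm h * rnorm a^-1 < 1 ->
  a - h \is a GRing.unit.
Proof.
move=> ua h1; have -> : a - h = a * (1 - a^-1 * h) by rewrite mulrBr mulr1 mulVKr.
rewrite unitrMr// neumann//; apply: le_lt_trans h1; rewrite mulrC; exact: rnormM.
Qed.

Lemma inverse_continuous a (e : R) : a \is a GRing.unit -> 0 < e ->
  exists2 d : R, 0 < d & forall b, rnorm (b - a) < d ->
    b \is a GRing.unit /\ rnorm (b^-1 - a^-1) <= e.
Proof.
move=> ua e0; have N1 := rnorm1_ge1.
have k0 : 0 <= rnorm a^-1 by exact: rnorm_ge0.
set k := rnorm a^-1 in k0 *.
pose W := 2 * rnorm (1 : A) * (k + 1) * (k + 1).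
have W0 : 0 < W by rewrite /W !mulr_gt0//; lra.
exists (Num.min (1 / 2 / (k + 1)) (e / W)).
  by rewrite lt_min !divr_gt0//; lra.
move=> b; rewrite lt_min => /andP[h1 h2].
pose h := a - b; have bE : b = a - h by rewrite /h opprB addrC subrK.
have ch : rnorm (b - a) = rnorm h by rewrite /h (cnB hN).
rewrite ch in h1 h2; have h0 := rnorm_ge0 h.
have hk : rnorm h * k < 1 / 2.
  move: h1; rewrite ltr_pdivlMr; last by lra.
  have : 0 <= rnorm h * 1 by rewrite mulr1.
  by lra.
have ub : b \is a GRing.unit by rewrite bE unit_perturb// -/k; lra.
split=> //.
have E : b^-1 - a^-1 = b^-1 * h * a^-1.
  by rewrite /h mulrBr mulVr// mulrBl mul1r -mulrA mulrV// mulr1.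
have hb : rnorm b^-1 <= 2 * rnorm (1 : A) * (k + 1).
  have : rnorm b^-1 <= rnorm a^-1 + rnorm b^-1 * rnorm h * rnorm a^-1.
    have {1}-> : b^-1 = a^-1 + b^-1 * h * a^-1 by rewrite -E addrC subrK.
    apply: (le_trans (cnD hN _ _)); rewrite lerD2l.
    apply: (le_trans (rnormM _ _)); rewrite ler_wpM2r ?rnorm_ge0//; exact: rnormM.
  rewrite -/k => h3; have b0 := rnorm_ge0 b^-1.
  have : rnorm b^-1 * (rnorm h * k) <= rnorm b^-1 * (1 / 2) by rewrite ler_wpM2l// ltW.
  have : 1 * (k + 1) <= rnorm (1 : A) * (k + 1) by rewrite ler_wpM2r//; lra.
  lra.
rewrite E; apply: (le_trans (rnormM _ _)); rewrite -/k.
apply: (@le_trans _ _ (2 * rnorm (1 : A) * (k + 1) * rnorm h * (k + 1))).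
  apply: ler_pM => //; [exact: rnorm_ge0| |by lra].
  apply: (le_trans (rnormM _ _)); rewrite ler_wpM2r//.
rewrite mulrAC -/W; move: h2; rewrite ltr_pdivlMr//; lra.
Qed.

End banach_algebra.

(** * The spectral radius without complex analysis *)

Section spectral_radius.
Variables (R : realType) (A : banachAlgType R[i]).
Implicit Types (x y : A).

Let hN := rnorm_complete A.

Let resolvent_uniform y (e : R) : 0 < e ->
  (forall mu : R[i], cabs mu <= 2 -> 1 - mu *: y \is a GRing.unit) ->
  exists2 d : R, 0 < d & forall mu nu : R[i], cabs mu <= 1 -> cabs (nu - mu) < d ->
    rnorm ((1 - nu *: y)^-1 - (1 - mu *: y)^-1) <= e.
Proof.
move=> e0 hu; have e2 : 0 < e / 2 by rewrite divr_gt0.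
have [|d d0 hd] := @lebesgue_number_disc R 0 1 (fun mu nu =>
    rnorm ((1 - nu *: y)^-1 - (1 - mu *: y)^-1) <= e).
  move=> z; rewrite subr0 mulr1 => /hu uz.
  have [d d0 hd] := inverse_continuous uz e2.
  have y1 : 0 < rnorm y + 1 by have := rnorm_ge0 y; lra.
  exists (d / (rnorm y + 1)); first by rewrite divr_gt0.
  have near (x : R[i]) : cabs (x - z) < d / (rnorm y + 1) ->
      rnorm ((1 - x *: y)^-1 - (1 - z *: y)^-1) <= e / 2.
    rewrite ltr_pdivlMr// => xz; apply: (hd _ _).2.
    have -> : 1 - x *: y - (1 - z *: y) = - ((x - z) *: y).
      by rewrite scalerBl !opprB addrC addrA subrK.
    rewrite (cnN hN) (cnZ hN); have := cabs_ge0 (x - z); lra.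
  move=> mu nu /near h1 /near h2.
  have := cn_tri hN (1 - nu *: y)^-1 (1 - z *: y)^-1 (1 - mu *: y)^-1.
  by rewrite (cnB hN (1 - z *: y)^-1); lra.
by exists d => // mu nu mu1; apply: hd; rewrite subr0.
Qed.

(** By the averaging identity, [(1 - (t y) ^ n)^-1] is an average of values of
    the resolvent, hence is continuous in [t] uniformly in [n]; so the set of
    the [t] for which some power of [t y] is small can be extended by steps of
    a fixed length from [0] to [1]. *)
Lemma power_small y :
  (forall mu : R[i], cabs mu <= 2 -> 1 - mu *: y \is a GRing.unit) ->
  exists n, rnorm (y ^+ n.+1) < 1.
Proof.
move=> hu; have N1 := rnorm1_ge1 A; set N := rnorm (1 : A) in N1 *.
have N0 : 0 < N by lra.
pose e := (8 * N)^-1; have e0 : 0 < e by rewrite invr_gt0 mulr_gt0.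
have [d d0 hd] := resolvent_uniform e0 hu.
pose P (t : R) := exists n, rnorm ((t%:C *: y) ^+ n.+1) < 1.
have step t t' : 0 <= t -> t <= t' -> t' <= 1 -> t' - t < d -> P t -> P t'.
  move=> t0 tt t1 td [n0 hn0].
  have t'0 : 0 <= t' by exact: le_trans tt.
  pose s := e / (2 * N); have s0 : 0 < s by rewrite divr_gt0 ?mulr_gt0.
  have [||k hk] := @expr_small R (rnorm ((t%:C *: y) ^+ n0.+1)) (Num.min s (1 / 2)).
  - by rewrite rnorm_ge0.
  - by rewrite lt_min s0; lra.
  pose n := (n0.+1 * k.+1)%N.
  have n_gt0 : (0 < n)%N by [].
  have sm : rnorm ((t%:C *: y) ^+ n) <= Num.min s (1 / 2).
    by rewrite exprM; apply: le_trans (rnormXS _ _) _; apply: hk.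
  move: sm; rewrite le_min => /andP[sm1 sm2].
  have um (t2 : R) j : 0 <= t2 -> t2 <= 1 -> 1 - rou R n ^+ j *: (t2%:C *: y) \is a GRing.unit.
    move=> tp tl; rewrite scalerA hu// cabsM cabsX cabs_rou expr1n mul1r cabs_real ger0_norm//; lra.
  have [|u1 E1] := @mean_root R A n (rou R n) (t%:C *: y) n_gt0 (rouX R n_gt0) (@rou_prim R n).
    by move=> j _; apply: um => //; lra.
  have [|u2 E2] := @mean_root R A n (rou R n) (t'%:C *: y) n_gt0 (rouX R n_gt0) (@rou_prim R n).
    by move=> j _; apply: um.
  set r1 := (1 - (t%:C *: y) ^+ n)^-1 in E1; set r2 := (1 - (t'%:C *: y) ^+ n)^-1 in E2.
  have d12 : rnorm (r2 - r1) <= e.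
    rewrite -E1 -E2 -scalerBr -sumrB (cnZ hN) cabsV cabs_nat.
    rewrite ler_pdivrMl ?ltr0n//; apply: (le_trans (cn_sum hN _ _ _)).
    apply: (@le_trans _ _ (\sum_(j < n) e)); last by rewrite sumr_const card_ord mulr_natl.
    apply: ler_sum => j _; rewrite !scalerA; apply: hd.
      rewrite cabsM cabsX cabs_rou expr1n mul1r cabs_real ger0_norm//; lra.
    rewrite -mulrBr cabsM cabsX cabs_rou expr1n mul1r -rmorphB cabs_real ger0_norm//.
    by rewrite subr_ge0.
  have r1b : rnorm (r1 - 1) <= e.
    have [h1 h2] := neumann_bound (le_lt_trans sm2 (ltac:(lra) : (1 / 2 : R) < 1)).
    rewrite -/r1 -/N in h1 h2.
    have h3 : rnorm r1 <= 2 * N.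
      apply: (le_trans h1); rewrite ler_pdivrMr; last by lra.
      have : N * rnorm ((t%:C *: y) ^+ n) <= N * (1 / 2) by rewrite ler_wpM2l// ltW.
      lra.
    apply: (le_trans h2); have -> : e = s * (2 * N) by rewrite /s divfK// gt_eqF// mulr_gt0.
    by rewrite ler_pM ?rnorm_ge0.
  have r2b : rnorm (1 - r2) <= 1 / 4 / N.
    rewrite (cnB hN); have := cn_tri hN r2 r1 1.
    have -> : 1 / 4 / N = e + e by rewrite /e; field; rewrite gt_eqF.
    lra.
  exists n.-1; rewrite prednK//.
  have q4 : 1 / 4 / N <= 1 / 4 by rewrite ler_pdivrMr// ler_peMr.
  have [h1 h2] := neumann_bound (le_lt_trans r2b (le_lt_trans q4 (ltac:(lra) : (1 / 4 : R) < 1))).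
  rewrite subKr /r2 invrK in h1 h2; rewrite -/r2 -/N in h1 h2.
  have h3 : rnorm (1 - (t'%:C *: y) ^+ n) <= 4 / 3 * N.
    apply: (le_trans h1); rewrite ler_pdivrMr; last by lra.
    have : N * rnorm (1 - r2) <= N * (1 / 4) by rewrite ler_wpM2l ?(ltW N0)//; lra.
    lra.
  rewrite addrAC subrr add0r (cnN hN) in h2.
  apply: (le_lt_trans h2); apply: (@le_lt_trans _ _ (1 / 4 / N * (4 / 3 * N))).
    by rewrite ler_pM ?rnorm_ge0.
  have -> : 1 / 4 / N * (4 / 3 * N) = 1 / 3 by field; rewrite gt_eqF.
  lra.
have P0 : P 0 by exists 0%N; rewrite scale0r expr1 (cn0 hN).
have [m0 hm] := inv_small d0.
pose m := m0.+1; have m_gt0 : (0 : R) < m%:R by rewrite ltr0n.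
have {}hm : m%:R^-1 < d by apply: hm.
have Pk k : (k <= m)%N -> P (k%:R / m%:R).
  elim: k => [|k ih] km; first by rewrite mul0r.
  apply: step (ih (ltnW km)).
  - by rewrite divr_ge0.
  - by rewrite ler_pM2r ?invr_gt0// ler_nat.
  - by rewrite ler_pdivrMr// mul1r ler_nat.
  - by rewrite -mulrBl -natrB// subSnn mul1r.
by have [n] := Pk m (leqnn m); rewrite divff ?gt_eqF// scale1r; exists n.
Qed.

Lemma power_bounded y n : rnorm (y ^+ n.+1) < 1 ->
  exists2 C : R, 0 <= C & forall k, rnorm (y ^+ k) <= C.
Proof.
move=> yn; pose C := \sum_(i < n.+1) rnorm (y ^+ i).
have N1 := rnorm1_ge1 A.
have C0 : 0 <= C by apply: sumr_ge0 => i _; exact: rnorm_ge0.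
exists (rnorm (1 : A) * C); first by rewrite mulr_ge0//; lra.
move=> k; rewrite (divn_eq k n.+1) exprD mulnC exprM.
apply: (le_trans (rnormM _ _)); rewrite ler_pM ?rnorm_ge0//.
  apply: (le_trans (rnormX _ _)); rewrite ler_piMr ?rnorm_ge0//.
  by rewrite exprn_ile1 ?rnorm_ge0// ltW.
have lt_mod : (k %% n.+1 < n.+1)%N by rewrite ltn_mod.
rewrite /C (bigD1 (Ordinal lt_mod))//= lerDl sumr_ge0// => i _; exact: rnorm_ge0.
Qed.

Lemma unit_of_power y n : 1 - y ^+ n.+1 \is a GRing.unit -> 1 - y \is a GRing.unit.
Proof.
have := subrX1 y n.+1 => /(congr1 -%R); rewrite -mulNr !opprB => E.
pose S := \sum_(i < n.+1) y ^+ i; rewrite -/S in E.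
have cyS : y * S = S * y.
  by rewrite /S mulr_sumr mulr_suml; apply: eq_bigr => i _; rewrite -exprS -exprSr.
have E' : S * (1 - y) = 1 - y ^+ n.+1 by rewrite E mulrBr mulrBl mulr1 mul1r cyS.
move=> u; apply/unitrP; exists ((1 - y ^+ n.+1)^-1 * S).
split; first by rewrite -mulrA E' mulVr.
have c : GRing.comm (1 - y) (1 - y ^+ n.+1).
  by rewrite E; apply: commrM; [|rewrite /GRing.comm E' E].
by rewrite mulrA -[(1 - y) * _]/(_) (commrV c) -mulrA -E mulVr.
Qed.

(** Subadditivity of the spectral radius for commuting elements, with a bound on
    the norm of [x] and on the spectrum of [y]. The powers of [y] are bounded, so
    by the binomial formula those of [x + y] grow at most like [(3 / 2) ^ k]. *)
Lemma sum_resolvent x y (mu : R[i]) : x * y = y * x -> rnorm x <= 1 / 2 ->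
  (forall nu : R[i], cabs nu <= 2 -> 1 - nu *: y \is a GRing.unit) ->
  cabs mu <= 1 / 2 -> 1 - mu *: (x + y) \is a GRing.unit.
Proof.
move=> cxy x1 hu mu1.
have [n yn] := power_small hu; have [C C0 hC] := power_bounded yn.
have N1 := rnorm1_ge1 A; have N0 : 0 <= rnorm (1 : A) by lra.
have bnd k : rnorm ((mu *: (x + y)) ^+ k) <= rnorm (1 : A) * C * (3 / 4) ^+ k.
  rewrite exprZn (cnZ hN) cabsX.
  have h : rnorm ((x + y) ^+ k) <= rnorm (1 : A) * C * (3 / 2) ^+ k.
    rewrite exprDn_comm//; apply: (le_trans (cn_sum hN _ _ _)).
    have -> : (3 / 2 : R) = 1 / 2 + 1 by field.
    rewrite exprDn mulr_sumr; apply: ler_sum => i _.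
    rewrite expr1n mulr1 -scaler_nat (cnZ hN) cabs_nat -[in leRHS]mulr_natl mulrCA.
    rewrite ler_wpM2l//; apply: (le_trans (rnormM _ _)).
    rewrite mulrAC; apply: ler_pM; rewrite ?rnorm_ge0//.
    apply: (le_trans (rnormX _ _)); rewrite ler_wpM2l// lerXn2r ?nnegrE ?rnorm_ge0//; lra.
  have -> : rnorm (1 : A) * C * (3 / 4) ^+ k = (1 / 2) ^+ k * (rnorm (1 : A) * C * (3 / 2) ^+ k).
    by rewrite mulrCA -exprMn; congr (_ * _ ^+ _); field.
  apply: ler_pM; rewrite ?exprn_ge0 ?cabs_ge0 ?rnorm_ge0//.
  by rewrite lerXn2r ?nnegrE ?cabs_ge0//; lra.
have [||k hk] := @expr_small R (3 / 4) (1 / 2 / (rnorm (1 : A) * C + 1)).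
- lra.
- have : 0 <= rnorm (1 : A) * C by rewrite mulr_ge0.
  by move=> ?; rewrite divr_gt0//; lra.
apply: (@unit_of_power _ k); apply: neumann.
apply: (le_lt_trans (bnd _)); have := hk k.+1 (leqnSn k).
have NC : 0 <= rnorm (1 : A) * C by rewrite mulr_ge0.
rewrite ler_pdivlMr; last by lra.
have : 0 <= (3 / 4 : R) ^+ k.+1 by rewrite exprn_ge0.
lra.
Qed.

End spectral_radius.

(** * Positive functionals on Hermitian algebras *)

Section involution.
Variables (R : realType) (A : banachStarAlgType R[i]).
Implicit Types (x y a : A).

Lemma star1 : star (1 : A) = 1.
Proof. by rewrite -[star 1]mulr1 -{2}[1]starK -starM mulr1 starK. Qed.

Lemma star0 : star (0 : A) = 0.
Proof. by have /eqP := starD (0 : A) 0; rewrite addr0 -subr_eq0 opprD addrA subrr sub0r oppr_eq0 => /eqP. Qed.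

Lemma starN x : star (- x) = - star x.
Proof. by rewrite -scaleN1r starZ rmorphN1 scaleN1r. Qed.

Lemma starB x y : star (x - y) = star x - star y.
Proof. by rewrite starD starN. Qed.

Lemma star_unit a : a \is a GRing.unit ->
  star a \is a GRing.unit /\ star a^-1 = (star a)^-1.
Proof.
move=> ua; have h1 : star a^-1 * star a = 1 by rewrite -starM mulrV// star1.
have h2 : star a * star a^-1 = 1 by rewrite -starM mulVr// star1.
have u : star a \is a GRing.unit by apply/unitrP; exists (star a^-1).
by split=> //; rewrite -[LHS]mulr1 -(mulrV u) mulrA h1 mul1r.
Qed.

Lemma conj_real_complex (t : R) : Num.conj t%:C = t%:C.
Proof. by rewrite conj_Creal// complex_real. Qed.

Lemma star_algr (z : R[i]) : star (z%:A : A) = (Num.conj z)%:A.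
Proof. by rewrite starZ star1. Qed.

End involution.

Section positive.
Variables (R : realType) (A : banachStarAlgType R[i]).
Hypothesis hA : hermitian_algebra A.
Variable psi : {scalar A}.
Hypothesis psi_pos : positive_functional psi.
Hypothesis psi1 : psi 1 = 1.
Implicit Types (x y a e s : A).

Lemma psiZ (k : R[i]) x : psi (k *: x) = k * psi x.
Proof. exact: scalarZ. Qed.

Lemma psi_alg (k : R[i]) : psi k%:A = k.
Proof. by rewrite psiZ psi1 mulr1. Qed.

(** As the spectrum of [b - s] is real, only real [k] have to be tested for its
    nonnegativity. *)
Lemma psi_upper s (b : R) : selfadjoint s ->
  (forall k : R, b < k -> k%:C%:A - s \is a GRing.unit) -> psi s <= b%:C.
Proof.
move=> ss hu; rewrite -subr_ge0 -(psi_alg b%:C) -linearB; apply: psi_pos.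
have sa : selfadjoint (b%:C%:A - s) by rewrite /selfadjoint starB star_algr conj_real_complex ss.
split=> // z; move=> zs; have /complex_realP[l zl] := hA sa zs.
rewrite /= zl ler0c leNgt; apply/negP => l0.
move: zs; rewrite /spectrum /= zl => /negP; apply.
have -> : l%:C%:A - (b%:C%:A - s) = - ((b - l)%:C%:A - s).
  by rewrite rmorphB scalerBl !opprB addrCA.
by rewrite unitrN; apply: hu; lra.
Qed.

Lemma psi_lower s (b : R) : selfadjoint s ->
  (forall k : R, k < b -> k%:C%:A - s \is a GRing.unit) -> b%:C <= psi s.
Proof.
move=> ss hu; rewrite -lerN2 -linearN -rmorphN; apply: psi_upper.
  by rewrite /selfadjoint starN ss.
move=> k kb; rewrite -unitrN opprD opprK -scaleNr -rmorphN.
apply: hu; lra.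
Qed.

(** The involution need not be continuous, so [star e] may be large; but its
    spectrum is that of [e] up to conjugation. *)
Lemma sum_star_resolvent e (mu : R[i]) : e * star e = star e * e -> rnorm e < 1 / 2 ->
  cabs mu <= 1 / 2 -> 1 - mu *: (e + star e) \is a GRing.unit.
Proof.
move=> ne e1; apply: sum_resolvent => //; first exact: ltW.
move=> nu nu2; have -> : 1 - nu *: star e = star (1 - Num.conj nu *: e).
  by rewrite starB star1 starZ conjCK.
apply: (star_unit _).1; apply: neumann.
have -> : rnorm (Num.conj nu *: e) = cabs nu * rnorm e.
  by rewrite (cnZ (rnorm_complete A)) /cabs norm_conjC.
have : cabs nu * rnorm e <= 2 * rnorm e by rewrite ler_wpM2r ?rnorm_ge0.
lra.
Qed.

Let psi_sum_star e : e * star e = star e * e -> rnorm e < 1 / 2 ->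
  cabs (psi (e + star e)) <= 2.
Proof.
move=> ne e1; set s := e + star e.
have ss : selfadjoint s by rewrite /selfadjoint starD starK addrC.
have key (f : A) : f * star f = star f * f -> rnorm f < 1 / 2 ->
    forall k : R, 2 < k -> k%:C%:A - (f + star f) \is a GRing.unit.
  move=> nf f1 k k2; have kC : k%:C != 0 :> R[i].
    by rewrite -cabs_gt0 cabs_real gtr0_norm; lra.
  have -> : k%:C%:A - (f + star f) = k%:C *: (1 - k%:C^-1 *: (f + star f)).
    by rewrite scalerBr scalerA mulfV// scale1r.
  rewrite scaler_unit ?unitfE// sum_star_resolvent// cabsV cabs_real gtr0_norm; last by lra.
  by rewrite div1r lef_pV2 ?posrE; lra.
have up : psi s <= (2 : R)%:C by apply: psi_upper => //; exact: key.
have lo : (- 2 : R)%:C <= psi s.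
  apply: psi_lower => // k k2; rewrite -unitrN opprB.
  have -> : s - k%:C%:A = (- k)%:C%:A - (- e + star (- e)).
    by rewrite starN rmorphN scaleNr -(opprD e) opprK addrC.
  apply: key; [by rewrite starN mulrNN mulrNN| |lra].
  by rewrite (cnN (rnorm_complete A)).
move: up lo; rewrite !lecE /= => /andP[i0 u2] /andP[_ l2].
apply: (le_trans (cabs_le _)); rewrite -(eqP i0) normr0 addr0 ler_norml l2 u2//.
Qed.

(** [e] is a combination of [e + star e] and [i e + star (i e)]. *)
Lemma psi_normal_bound e : e * star e = star e * e -> rnorm e < 1 / 2 ->
  cabs (psi e) <= 2.
Proof.
move=> ne e1; have h2 := @two_neq0 R.
have a1 := psi_sum_star ne e1.
have ii : 'i%C * 'i%C = -1 :> R[i] by rewrite -expr2 sqr_i.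
have conj_i : Num.conj 'i%C = - 'i%C :> R[i] by rewrite complexiE conjCi.
have a2 : cabs (psi ('i%C *: e + star ('i%C *: e))) <= 2.
  apply: psi_sum_star.
    by rewrite starZ -scalerAl -scalerAr -[RHS]scalerAl -[in RHS]scalerAr ne !scalerA mulrC.
  by rewrite (cnZ (rnorm_complete A)) cabs_i mul1r.
have E : psi e = (psi (e + star e) - 'i%C * psi ('i%C *: e + star ('i%C *: e))) / 2.
  rewrite starZ conj_i !linearD /= !psiZ.
  have -> : psi e + psi (star e) - 'i%C * ('i%C * psi e + - 'i%C * psi (star e)) =
    psi e + psi (star e) - ('i%C * 'i%C) * (psi e - psi (star e)) by ring.
  by rewrite ii; field.
rewrite E cabs_half; have := cabsD (psi (e + star e)) (- ('i%C * psi ('i%C *: e + star ('i%C *: e)))).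
by rewrite cabsN cabsM cabs_i mul1r; lra.
Qed.

Lemma psi_normal_small e (d : R) : e * star e = star e * e -> 0 < d -> rnorm e <= d ->
  cabs (psi e) <= 8 * d.
Proof.
move=> ne d0 ed.
have dC : (4 * d)%:C != 0 :> R[i] by rewrite -cabs_gt0 cabs_real gtr0_norm; lra.
have d4 : 0 < 4 * d by lra.
have := @psi_normal_bound ((4 * d)%:C^-1 *: e).
rewrite psiZ cabsM (cnZ (rnorm_complete A)) cabsV cabs_real (gtr0_norm d4) => h.
have : (4 * d)^-1 * cabs (psi e) <= 2.
  apply: h; last by rewrite mulrC ltr_pdivrMr//; lra.
  by rewrite starZ -scalerAl -scalerAr -[RHS]scalerAl -[in RHS]scalerAr ne !scalerA mulrC.
rewrite mulrC ler_pdivrMr//; lra.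
Qed.

(** ** Rational functions of a selfadjoint element *)

Variable c : A.
Hypothesis c_sa : selfadjoint c.
Variable B : R.
Hypothesis specB : forall w, spectrum c w -> cabs w <= B.

(** If the spectrum were empty, every real number would be both an upper and a
    lower bound of [psi c]. *)
Lemma spectrum_neq0 : exists w, spectrum c w.
Proof.
apply: contrapT => h.
have hu (k : R) : k%:C%:A - c \is a GRing.unit.
  by apply/negPn/negP => nu; apply: h; exists k%:C.
have := psi_upper (b := 0) c_sa (fun k _ => hu k).
have := psi_lower (b := 1) c_sa (fun k _ => hu k).
move=> h1 /(le_trans h1); rewrite lecR ler10//.
Qed.

Lemma spectrum_real w : spectrum c w -> Num.conj w = w.
Proof. by move=> /(hA c_sa)/CrealP. Qed.

Lemma spectrumP w : spectrum c w <-> ~ (w%:A - c \is a GRing.unit).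
Proof. by rewrite /spectrum /=; split=> /negP. Qed.

Local Notation ev := (horner_alg c).

(** Factor [Q] into linear polynomials. *)
Lemma ev_unit (Q : {poly R[i]}) : (forall w, spectrum c w -> Q.[w] != 0) ->
  ev Q \is a GRing.unit.
Proof.
move=> hQ; have [w0 hw0] := spectrum_neq0.
have Q0 : Q != 0 by apply: contraNneq (hQ _ hw0) => ->; rewrite horner0.
have [rs E] := closed_field_poly_normal Q.
have lc : lead_coef Q \is a GRing.unit by rewrite unitfE lead_coef_eq0.
rewrite E linearZ /= mulr_algl scaler_unit// rmorph_prod /=.
have hr z : z \in rs -> ev ('X - z%:P) \is a GRing.unit.
  move=> zr; rewrite rmorphB /= horner_algX horner_algC -unitrN opprB.
  apply/negPn/negP => /negP/spectrumP/hQ; rewrite E hornerZ mulf_eq0 negb_or => /andP[_].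
  by rewrite -rootE root_prod_XsubC zr.
elim: rs hr {E} => [|z rs ih] hr; first by rewrite big_nil unitr1.
rewrite big_cons unitrMl; first by apply: hr; rewrite inE eqxx.
by apply: ih => y yr; apply: hr; rewrite inE yr orbT.
Qed.

(** [r] is constrained on the spectrum only, where it determines the spectrum of
    [q]. *)
Definition rational_in q (r : R[i] -> R[i]) := exists P Q : {poly R[i]},
  [/\ forall w, spectrum c w -> Q.[w] != 0,
      forall w, spectrum c w -> r w = P.[w] / Q.[w] &
      q = ev P * (ev Q)^-1].

Lemma ev_comm P Q : ev P * ev Q = ev Q * ev P.
Proof. by rewrite -!rmorphM mulrC. Qed.

Lemma evV_comm P Q : ev P * (ev Q)^-1 = (ev Q)^-1 * ev P.
Proof. exact: commrV (ev_comm P Q). Qed.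

Lemma rational_spectrum q r z : rational_in q r -> spectrum q z ->
  exists2 w, spectrum c w & z = r w.
Proof.
move=> [P [Q [hQ hr ->]]] /negP zq; apply: contrapT => h; apply: zq.
have uQ := ev_unit hQ.
have -> : z%:A - ev P * (ev Q)^-1 = ev (z *: Q - P) * (ev Q)^-1.
  by rewrite linearB linearZ /= mulrBl mulr_algl -scalerAl divrr.
rewrite unitrMl ?unitrV//; apply: ev_unit => w sw.
rewrite hornerD hornerN hornerZ; apply/eqP => zw; apply: h; exists w => //.
by rewrite hr//; apply: (mulIf (hQ w sw)); rewrite divfK ?hQ//; apply/eqP; rewrite -subr_eq0 zw.
Qed.

Lemma rational_poly P : rational_in (ev P) (horner P).
Proof.
exists P, 1; split=> [w _|w _|]; rewrite ?hornerC ?oner_eq0 ?divr1//.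
by rewrite rmorph1 invr1 mulr1.
Qed.

Lemma rationalD q1 r1 q2 r2 : rational_in q1 r1 -> rational_in q2 r2 ->
  rational_in (q1 + q2) (fun w => r1 w + r2 w).
Proof.
move=> [P1 [Q1 [h1 e1 ->]]] [P2 [Q2 [h2 e2 ->]]].
have u1 := ev_unit h1; have u2 := ev_unit h2.
exists (P1 * Q2 + P2 * Q1), (Q1 * Q2); split=> [w sw|w sw|].
- by rewrite hornerM mulf_neq0 ?h1 ?h2.
- rewrite e1// e2// hornerD !hornerM; field; rewrite h1// h2//.
have u12 : ev (Q1 * Q2) \is a GRing.unit by rewrite rmorphM unitrMl.
apply: (mulIr u12); rewrite divrK// mulrDl {1}rmorphM {1}(mulrC Q1 Q2) !rmorphM rmorphD !rmorphM /=.
by rewrite !mulrA !divrK.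
Qed.

Lemma rationalZ k q r : rational_in q r -> rational_in (k *: q) (fun w => k * r w).
Proof.
move=> [P [Q [h e ->]]]; exists (k *: P), Q; split=> // [w sw|].
  by rewrite e// hornerZ mulrA.
by rewrite linearZ /= mulr_algl scalerAl.
Qed.

Lemma rational_mulc q r : rational_in q r -> rational_in (c * q) (fun w => w * r w).
Proof.
move=> [P [Q [h e ->]]]; exists ('X * P), Q; split=> // [w sw|].
  by rewrite e// hornerM hornerX mulrA.
by rewrite rmorphM /= horner_algX mulrA.
Qed.

Lemma rational_resolvent z : z%:A - c \is a GRing.unit ->
  rational_in (z%:A - c)^-1 (fun w => (z - w)^-1).
Proof.
move=> uz; exists 1, (z%:P - 'X); split=> [w sw|w sw|].
- rewrite hornerD hornerN hornerC hornerX subr_eq0; apply/eqP => zw.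
  by move/spectrumP: sw; rewrite -zw.
- by rewrite hornerD hornerN !hornerC hornerX mul1r.
by rewrite rmorph1 mul1r rmorphB /= horner_algC horner_algX.
Qed.

Lemma rational_sum n (q : nat -> A) (r : nat -> R[i] -> R[i]) :
  (forall j, (j < n)%N -> rational_in (q j) (r j)) ->
  rational_in (\sum_(0 <= j < n) q j) (fun w => \sum_(0 <= j < n) r j w).
Proof.
elim: n => [|n ih] h.
  exists 0, 1; split=> [w _|w _|]; rewrite ?hornerC ?oner_eq0 ?big_geq ?horner0 ?mul0r//.
  by rewrite rmorph0 mul0r.
have [P [Q [h1 h2 h3]]] := rationalD (ih (fun j jn => h j (ltnW jn))) (h n (ltnSn n)).
exists P, Q; split=> // [w sw|]; first by rewrite big_nat_recr//= -h2.
by rewrite big_nat_recr.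
Qed.

Let ev_star P : star (ev P) = ev (map_poly Num.conj P).
Proof.
elim/poly_ind: P => [|P a ih]; first by rewrite !rmorph0 star0.
rewrite !rmorphD !rmorphM /= map_polyX map_polyC /= !horner_algX !horner_algC.
rewrite starD starM star_algr ih c_sa; congr (_ + _).
by rewrite -{1 4}[c](horner_algX) ev_comm.
Qed.

Let conj_horner P w : spectrum c w -> (map_poly Num.conj P).[w] = Num.conj P.[w].
Proof. by move=> sw; rewrite -{1}(spectrum_real sw) horner_map. Qed.

Lemma rational_star q r : rational_in q r ->
  rational_in (star q) (fun w => Num.conj (r w)).
Proof.
move=> [P [Q [h e ->]]]; have uQ := ev_unit h.
exists (map_poly Num.conj P), (map_poly Num.conj Q); split=> [w sw|w sw|].
- by rewrite conj_horner// conjC_eq0 h.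
- by rewrite e// !conj_horner// rmorphM fmorphV.
by rewrite starM (star_unit uQ).2 !ev_star evV_comm.
Qed.

Lemma rational_comm q r x : rational_in q r -> GRing.comm x c -> GRing.comm x q.
Proof.
move=> [P [Q [_ _ ->]]] xc.
have H (p : {poly R[i]}) : GRing.comm x (ev p).
  elim/poly_ind: p => [|p a ih]; first by rewrite rmorph0; exact: commr0.
  rewrite rmorphD rmorphM /= horner_algX horner_algC; apply: commrD.
    exact: commrM.
  by rewrite /GRing.comm -scalerAr -scalerAl mulr1 mul1r.
by apply: commrM => //; apply: commrV.
Qed.

Lemma rational_nonneg q r : rational_in q r -> selfadjoint q ->
  (forall w, spectrum c w -> 0 <= r w) -> 0 <= psi q.
Proof.
move=> qr sq r0; apply: psi_pos; split=> // z /(rational_spectrum qr)[w sw ->].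
exact: r0.
Qed.

(** The selfadjoint parts of [q] are rational functions of [c] whose values are
    the real and imaginary parts of [r]; adding [e] makes the former nonnegative,
    and the latter as well as its opposite. *)
Lemma rational_approx q r (h : R[i] -> R[i]) (e : R) : rational_in q r ->
  (forall w, spectrum c w -> 0 <= h w) ->
  (forall w, spectrum c w -> cabs (h w - r w) <= e) ->
  - e <= Re (psi q) /\ `|Im (psi q)| <= e.
Proof.
move=> qr h0 hr; have h2 := @two_neq0 R.
have qs := rational_star qr.
have const k : rational_in (k%:A) (fun=> k).
  have := rational_poly k%:P; rewrite horner_algC => -[P [Q [h1 e1 e2]]].
  by exists P, Q; split=> // w sw; rewrite -e1// hornerC.
have ii : 'i%C * 'i%C = -1 :> R[i] by rewrite -expr2 sqr_i.
have conj_i : Num.conj 'i%C = - 'i%C :> R[i] by rewrite complexiE conjCi.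
have conj2 : Num.conj (2^-1 : R[i]) = 2^-1 by rewrite fmorphV rmorph_nat.
pose u := 2^-1 *: (q + star q).
pose v := (- 'i%C / 2) *: (q - star q).
have su : star u = u by rewrite /u starZ conj2 starD starK addrC.
have sv : star v = v.
  rewrite /v starZ rmorphM /= conj2 rmorphN /= conj_i opprK starB starK -opprB scalerN -scaleNr.
  by rewrite mulNr.
have E : q = u + 'i%C *: v.
  rewrite /u /v scalerA mulrA mulrN ii opprK div1r -scalerDr addrACA subrr addr0.
  by rewrite -mulr2n -(scaler_nat 2 q) scalerA mulVf// scale1r.
have hE w : spectrum c w -> h w = (Re (h w))%:C.
  by move=> /h0/ger0_real/RRe_real.
have vals w : spectrum c w -> - e <= Re (r w) /\ `|Im (r w)| <= e.
  move=> sw; have := h0 _ sw; rewrite (hE _ sw) lecR => hw.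
  have a := hr _ sw; have := le_trans (Re_le_cabs _) a; have := le_trans (Im_le_cabs _) a.
  rewrite !raddfB /= (hE _ sw) /= sub0r normrN => -> ; rewrite ler_norml => /andP[h3 h4]; split=> //; lra.
have conjE (z : R[i]) : Num.conj z = (Re z)%:C - 'i%C * (Im z)%:C.
  by rewrite {1}(complexE z) rmorphD rmorphM /= conj_i !conj_real_complex mulNr.
have ru : rational_in u (fun w => (Re (r w))%:C).
  have := rationalZ 2^-1 (rationalD qr qs) => -[P [Q [h1 e1 e2]]].
  exists P, Q; split=> // w sw; rewrite -e1// conjE {2}(complexE (r w)).
  by field.
have rv : rational_in v (fun w => (Im (r w))%:C).
  have := rationalZ (- 'i%C / 2) (rationalD qr (rationalZ (-1) qs)) => -[P [Q [h1 e1 e2]]].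
  exists P, Q; split=> // [w sw|]; last by rewrite -e2 scaleN1r.
  rewrite -e1// conjE {2}(complexE (r w)).
  have -> : - 'i%C / 2 * ((Re (r w))%:C + 'i%C * (Im (r w))%:C +
    -1 * ((Re (r w))%:C - 'i%C * (Im (r w))%:C)) = - ('i%C * 'i%C) * (Im (r w))%:C by field.
  by rewrite ii opprK mul1r.
have shift q' r' k : rational_in q' r' -> rational_in (q' + k%:A) (fun w => r' w + k).
  by move=> qr'; exact: rationalD qr' (const k).
have sh (q' : A) (k : R) : star q' = q' -> selfadjoint (q' + k%:C%:A).
  by move=> sq'; rewrite /selfadjoint starD star_algr conj_real_complex sq'.
have pu : 0 <= psi (u + e%:C%:A).
  apply: (rational_nonneg (shift _ _ _ ru) (sh _ _ su)) => w /vals[a _].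
  by rewrite -rmorphD lecR; lra.
have pv1 : 0 <= psi (v + e%:C%:A).
  apply: (rational_nonneg (shift _ _ _ rv) (sh _ _ sv)) => w /vals[_].
  by rewrite -rmorphD lecR ler_norml => /andP[? ?]; lra.
have rNv : rational_in (-1 *: v) (fun w => -1 * (Im (r w))%:C) by exact: rationalZ.
have pv2 : 0 <= psi (-1 *: v + e%:C%:A).
  apply: (rational_nonneg (shift _ _ _ rNv)).
    by apply: sh; rewrite starZ sv rmorphN1.
  by move=> w /vals[_]; rewrite mulN1r -rmorphN -rmorphD lecR ler_norml => /andP[? ?]; lra.
have pN : psi (-1 *: v) = - psi v by rewrite psiZ mulN1r.
move: pu pv1 pv2; rewrite !linearD /= !psi_alg pN.
rewrite !lecE !raddfD /= !raddfN /= !addr0 => /andP[/eqP iu ru'] /andP[/eqP iv rv1] /andP[_ rv2].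
have EE : psi q = psi u + 'i%C * psi v.
  by rewrite -psiZ -(linearD psi u ('i%C *: v)) -E.
have ReE : Re (psi q) = Re (psi u).
  transitivity (Re (psi u) + Re ('i%C * psi v)); first by rewrite EE raddfD.
  by rewrite mulrC ReiNIm iv oppr0 addr0.
have ImE : Im (psi q) = Im (psi u) + Re (psi v).
  transitivity (Im (psi u) + Im ('i%C * psi v)); first by rewrite EE raddfD.
  by rewrite mulrC ImiRe.
rewrite ReE ImE iu add0r; split; first by lra.
rewrite ler_norml; lra.
Qed.

(** ** Approximation by rational functions *)

(** The functional calculus as a relation between elements and functions. It
    contains the Cauchy integrals and is preserved by linear combinations. *)
Definition function_of b (h : R[i] -> R[i]) := forall e : R, 0 < e ->
  exists q r, [/\ rational_in q r, rnorm (b - q) <= e &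
                  forall w, spectrum c w -> cabs (h w - r w) <= e].

Let hN := rnorm_complete A.

Lemma function_of_rational q r : rational_in q r -> function_of q r.
Proof.
move=> qr e e0; exists q, r; rewrite subrr (cn0 hN); split=> //; first exact: ltW.
by move=> w _; rewrite subrr cabs0 ltW.
Qed.

Lemma function_of_ext b h h' : (forall w, spectrum c w -> h w = h' w) ->
  function_of b h -> function_of b h'.
Proof.
move=> hh bh e /bh[q [r [qr bq hr]]]; exists q, r; split=> // w sw.
by rewrite -hh//; exact: hr.
Qed.

Lemma function_ofD b1 h1 b2 h2 : function_of b1 h1 -> function_of b2 h2 ->
  function_of (b1 + b2) (fun w => h1 w + h2 w).
Proof.
move=> H1 H2 e e0; have e2 : 0 < e / 2 by rewrite divr_gt0.
have [q1 [r1 [qr1 bq1 hr1]]] := H1 _ e2; have [q2 [r2 [qr2 bq2 hr2]]] := H2 _ e2.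
exists (q1 + q2), (fun w => r1 w + r2 w); split; first exact: rationalD.
  by rewrite opprD addrACA; apply: (le_trans (cnD hN _ _)); lra.
move=> w sw; rewrite opprD addrACA; apply: (le_trans (cabsD _ _)).
by have := hr1 w sw; have := hr2 w sw; lra.
Qed.

Lemma function_ofZ k b h : function_of b h -> function_of (k *: b) (fun w => k * h w).
Proof.
move=> H e e0; have k1 : 0 < cabs k + 1 by have := cabs_ge0 k; lra.
have [|q [r [qr bq hr]]] := H (e / (cabs k + 1)); first by rewrite divr_gt0.
have small (x : R) : 0 <= x -> x <= e / (cabs k + 1) -> cabs k * x <= e.
  by move=> x0; rewrite ler_pdivlMr//; lra.
exists (k *: q), (fun w => k * r w); split; first exact: rationalZ.
  by rewrite -scalerBr (cnZ hN) small// rnorm_ge0.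
by move=> w sw; rewrite -mulrBr cabsM small ?cabs_ge0// hr.
Qed.

Lemma function_of_mulc b h : function_of b h -> function_of (c * b) (fun w => w * h w).
Proof.
move=> H e e0; pose k := rnorm c + `|B|.
have c0 := rnorm_ge0 c; have B0 := normr_ge0 B.
have k1 : 0 < k + 1 by rewrite /k; lra.
have [|q [r [qr bq hr]]] := H (e / (k + 1)); first by rewrite divr_gt0.
have small (x y : R) : 0 <= x -> 0 <= y -> y <= k -> x <= e / (k + 1) -> y * x <= e.
  move=> x0 y0 yk; rewrite ler_pdivlMr// => h'.
  have : y * x <= k * x by rewrite ler_wpM2r.
  by lra.
exists (c * q), (fun w => w * r w); split; first exact: rational_mulc.
  rewrite -mulrBr; apply: (le_trans (rnormM _ _)).
  by apply: small; rewrite ?rnorm_ge0// /k; lra.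
move=> w sw; rewrite -mulrBr cabsM; apply: small; rewrite ?cabs_ge0 ?hr//.
by have := specB sw; have := ler_norm B; rewrite /k; lra.
Qed.

Lemma function_of_comm b h x : function_of b h -> GRing.comm x c -> GRing.comm x b.
Proof.
move=> H xc; apply: (cn_eq hN) => e e0.
have x0 := rnorm_ge0 x.
have [|q [r [qr bq _]]] := H (e / (2 * (rnorm x + 1))).
  by rewrite divr_gt0// mulr_gt0//; lra.
have qc := rational_comm qr xc.
have -> : x * b - b * x = x * (b - q) - (b - q) * x by rewrite mulrBr mulrBl qc opprB addrA subrK.
apply: (le_trans (cnD hN _ _)); rewrite (cnN hN).
have := rnormM x (b - q); have := rnormM (b - q) x.
move: bq; rewrite ler_pdivlMr; last by rewrite mulr_gt0//; lra.
have := rnorm_ge0 (b - q); lra.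
Qed.

(** The error of the approximation is a limit of rational functions of [c], hence
    commutes with [c] and with its own adjoint, so [psi_normal_small] applies to
    it. *)
Theorem function_of_nonneg b h : function_of b h ->
  (forall w, spectrum c w -> 0 <= h w) -> 0 <= psi b.
Proof.
move=> H h0.
have main (e : R) : 0 < e -> - (9 * e) <= Re (psi b) /\ `|Im (psi b)| <= 9 * e.
  move=> e0; have [q [r [qr bq hr]]] := H e e0.
  have [q1 q2] := rational_approx qr h0 hr.
  have ec x : GRing.comm x c -> GRing.comm x (b - q).
    move=> xc; apply: commrB; [exact: function_of_comm H xc|exact: rational_comm qr xc].
  have sc : GRing.comm (star (b - q)) c.
    have := congr1 star (ec c (commr_refl c)); rewrite !starM c_sa.
    by move=> h'; apply: commr_sym.
  have := psi_normal_small (esym (ec _ sc)) e0 bq.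
  rewrite linearB /= => h8.
  have := le_trans (Re_le_cabs _) h8; have := le_trans (Im_le_cabs _) h8.
  rewrite !raddfB /= !ler_norml => /andP[i1 i2] /andP[r1 r2].
  by move: q2; rewrite ler_norml => /andP[i3 i4]; split; lra.
have scale (e : R) : 9 * (e / 9) = e by field.
rewrite lecE; apply/andP; split.
  rewrite -normr_eq0 eq_le normr_ge0 andbT; apply/ler_addgt0Pr => e e0.
  have [|_] := main (e / 9); first by rewrite divr_gt0.
  by rewrite add0r scale.
apply/ler_addgt0Pr => e e0; have [|+ _] := main (e / 9); first by rewrite divr_gt0.
rewrite scale /=; lra.
Qed.

Lemma function_of1 k : function_of k%:A (fun=> k).
Proof.
apply: (function_of_ext (h := horner k%:P)) => [w _|]; first exact: hornerC.
by rewrite -(horner_algC c k); apply: function_of_rational; exact: rational_poly.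
Qed.

Lemma function_of_id : function_of c id.
Proof.
have := function_of_rational (rational_poly 'X); rewrite horner_algX.
by apply: function_of_ext => w _; exact: hornerX.
Qed.

End positive.

(** * The holomorphic functional calculus *)

Section calculus.
Variables (R : realType) (A : banachStarAlgType R[i]).
Hypothesis hA : hermitian_algebra A.
Variable psi : {scalar A}.
Hypothesis psi_pos : positive_functional psi.
Hypothesis psi1 : psi 1 = 1.
Variable c : A.
Hypothesis c_sa : selfadjoint c.
Variables (G : set R[i]) (g g' : R[i] -> R[i]).
Hypothesis oG : open_pred G.
Hypothesis hg : holomorphic G g g'.

(** Riemann sums of the integral are rational functions of [c], and their values
    at a point [w] of the spectrum are Riemann sums of the scalar Cauchy
    integral. What has to be shown is that the latter converge at a rate that
    does not depend on [w]. *)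
Lemma cauchy_integral_function_of gamma : surrounds G (spectrum c) gamma ->
  function_of c (cauchy_integral gamma g c) g.
Proof.
move=> [[gc g01 grect] trG sin Gout].
have hN := rnorm_complete A.
have [v hv] := rectifiable_control grect.
have gcont := within_continuous_dist gc.
have tpi : two_pi_i R != 0.
  rewrite mulf_neq0// -?cabs_gt0 ?cabs_i// cabs_real gtr0_norm ?mulr_gt0 ?pi_gt0//.
have tr s : 0 <= s <= 1 -> trace gamma (gamma s) by move=> s01; exists s.
have gG s : 0 <= s <= 1 -> G (gamma s) by move=> /tr/trG.
have ind w : winding_number gamma w = (two_pi_i R)^-1 * curve_index gamma w by [].
have off w : ~ trace gamma w -> off_curve gamma w.
  by move=> nt s s01; apply/eqP => E; apply: nt; rewrite -E; exact: tr.
have iout w : ~ G w -> curve_index gamma w = 0.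
  move=> /Gout[_]; rewrite ind => /eqP; rewrite mulf_eq0 invr_eq0 (negbTE tpi) /=.
  by move/eqP.
have sind w : spectrum c w -> off_curve gamma w /\ curve_index gamma w = two_pi_i R.
  move=> /sin[/off ow]; rewrite ind => h; split=> //.
  by rewrite -[LHS]mul1r -(mulfV tpi) -mulrA h mulr1.
have sG w : spectrum c w -> G w.
  move=> /sind[_ iw]; apply: contrapT => /iout; rewrite iw => /eqP; exact/negP.
have ures s : 0 <= s <= 1 -> (gamma s)%:A - c \is a GRing.unit.
  move=> s01; apply/negPn/negP => nu; have [ow _] := sind _ nu.
  by have := ow s s01; rewrite eqxx.
(* The resolvent is bounded on the curve, and by [unit_perturb] this bounds the
   distance from the curve to the spectrum from below. *)
pose res z : A := (z%:A - c)^-1.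
have res_cont s : 0 <= s <= 1 -> forall e : R, 0 < e -> exists2 d : R, 0 < d &
    forall u, 0 <= u <= 1 -> `|u - s| < d -> rnorm (res (gamma u) - res (gamma s)) <= e.
  move=> s01 e e0; have [d d0 hd] := inverse_continuous (ures s s01) e0.
  have N1 := rnorm1_ge1 A.
  have [|x x0 hx] := gcont s s01 (d / (2 * rnorm (1 : A))).
    by rewrite divr_gt0// mulr_gt0//; lra.
  exists x => // u u01 us; apply: (hd _ _).2.
  have -> : (gamma u)%:A - c - ((gamma s)%:A - c) = (gamma u - gamma s) *: 1.
    by rewrite scalerBl opprB addrA subrK.
  rewrite (cnZ hN); have := hx u u01 us; rewrite ler_pdivlMr; last by lra.
  by have := cabs_ge0 (gamma u - gamma s); lra.
have res_along : uniformly_continuous_along (@rnorm R A) gamma res.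
  by apply: pointwise_uniformly_continuous.
have [K K0 hK] := uniformly_continuous_bounded hN res_along.
have N1 := rnorm1_ge1 A.
(* The factor [rnorm 1] is there because the unit need not have norm 1. *)
pose ka := rnorm (1 : A) * (K + 1).
have ka0 : 0 < ka by rewrite mulr_gt0//; lra.
have sep s w : 0 <= s <= 1 -> spectrum c w -> cabs (gamma s - w)^-1 <= ka.
  move=> s01 sw; rewrite cabsV leNgt; apply/negP => h.
  have gw : 0 < cabs (gamma s - w) by rewrite cabs_gt0 subr_eq0 (sind _ sw).1.
  have h' : cabs (gamma s - w) * ka < 1 by rewrite -ltr_pdivlMl// mulr1.
  move: sw; rewrite /spectrum /= => /negP; apply.
  have -> : w%:A - c = ((gamma s)%:A - c) - (gamma s - w) *: 1.
    by rewrite scalerBl opprB [RHS]addrC addrA subrK.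
  apply: unit_perturb; first exact: ures.
  rewrite (cnZ hN); apply: le_lt_trans h'; rewrite -mulrA ler_wpM2l ?cabs_ge0//.
  rewrite ler_wpM2l//; first by lra.
  by have := hK s s01; rewrite /res; lra.
have g_along : uniformly_continuous_along (V := R[i]) (@cabs R) gamma g.
  by apply: (cont_along gcont) => s /gG/hg/has_deriv_cont.
have id_along : uniformly_continuous_along (V := R[i]) (@cabs R) gamma id.
  by apply: (cont_along gcont) => s _; apply: has_deriv_cont (has_deriv_id _).
have [M M0 hM] := uniformly_continuous_bounded (cabs_complete R) g_along.
have osc (e : R) : 0 < e -> exists2 d : R, 0 < d & forall w, spectrum c w ->
    oscillation_le (V := R[i]) (@cabs R) gamma (fun z => g z / (z - w)) d e.
  move=> e0.
  have [|d1 d10 h1] := g_along (e / (2 * ka)); first by rewrite divr_gt0// mulr_gt0.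
  have M1 : 0 < M + 1 by lra.
  have k2 : 0 < ka * ka by exact: mulr_gt0.
  have [|d2 d20 h2] := id_along (e / (2 * (M + 1) * (ka * ka))).
    by rewrite divr_gt0// mulr_gt0// mulr_gt0.
  exists (Num.min d1 d2); first by rewrite lt_min d10.
  move=> w sw s u s01 u01; rewrite lt_min => /andP[/(h1 _ _ s01 u01) a1 /(h2 _ _ s01 u01) a2].
  have ns : gamma s - w != 0 by rewrite subr_eq0 (sind _ sw).1.
  have nu : gamma u - w != 0 by rewrite subr_eq0 (sind _ sw).1.
  have -> : g (gamma s) / (gamma s - w) - g (gamma u) / (gamma u - w) =
    (g (gamma s) - g (gamma u)) / (gamma s - w) -
    g (gamma u) * (gamma s - gamma u) * ((gamma s - w)^-1 * (gamma u - w)^-1).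
    by field; rewrite ns nu.
  apply: (le_trans (cabsD _ _)); rewrite cabsN !cabsM.
  have ks := sep s w s01 sw; have ku := sep u w u01 sw.
  have b1 : cabs (g (gamma s) - g (gamma u)) * cabs (gamma s - w)^-1 <= e / (2 * ka) * ka.
    by rewrite ler_pM ?cabs_ge0.
  have b2 : cabs (g (gamma u)) * cabs (gamma s - gamma u) * (cabs (gamma s - w)^-1 * cabs (gamma u - w)^-1)
      <= (M + 1) * (e / (2 * (M + 1) * (ka * ka))) * (ka * ka).
    apply: ler_pM; rewrite ?mulr_ge0 ?cabs_ge0//; apply: ler_pM; rewrite ?cabs_ge0//.
    by have := hM u u01; lra.
  have e1 : e / (2 * ka) * ka = e / 2 by field; rewrite gt_eqF.
  have e2 : (M + 1) * (e / (2 * (M + 1) * (ka * ka))) * (ka * ka) = e / 2.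
    by field; rewrite !gt_eqF.
  by rewrite e1 in b1; rewrite e2 in b2; lra.
pose F z : A := g z *: res z.
have F_along : uniformly_continuous_along (@rnorm R A) gamma F.
  move=> e e0; have M1 : 0 < M + 1 by lra. have K1 : 0 < K + 1 by lra.
  have [|d1 d10 h1] := g_along (e / 2 / (K + 1)); first by rewrite !divr_gt0.
  have [|d2 d20 h2] := res_along (e / 2 / (M + 1)); first by rewrite !divr_gt0.
  exists (Num.min d1 d2); first by rewrite lt_min d10.
  move=> s u s01 u01; rewrite lt_min => /andP[/(h1 _ _ s01 u01) a1 /(h2 _ _ s01 u01) a2].
  have -> : F (gamma s) - F (gamma u) = (g (gamma s) - g (gamma u)) *: res (gamma s) +
      g (gamma u) *: (res (gamma s) - res (gamma u)).
    by rewrite /F scalerBl scalerBr addrA subrK.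
  apply: (le_trans (cnD hN _ _)); rewrite !(cnZ hN).
  have b1 : cabs (g (gamma s) - g (gamma u)) * rnorm (res (gamma s)) <= e / 2 / (K + 1) * (K + 1).
    rewrite ler_pM ?cabs_ge0 ?rnorm_ge0//; have := hK s s01; lra.
  have b2 : cabs (g (gamma u)) * rnorm (res (gamma s) - res (gamma u)) <= (M + 1) * (e / 2 / (M + 1)).
    rewrite ler_pM ?cabs_ge0 ?rnorm_ge0//; have := hM u u01; lra.
  have e1 : e / 2 / (K + 1) * (K + 1) = e / 2 by field; rewrite gt_eqF.
  have e2 : (M + 1) * (e / 2 / (M + 1)) = e / 2 by field; rewrite gt_eqF.
  by rewrite e1 in b1; rewrite e2 in b2; lra.
have bE := @bnormE R A.
have limF := curve_integral_limit hN hv bE F_along.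
move=> e e0.
set T := cabs (two_pi_i R); have T0 : 0 < T by rewrite cabs_gt0.
set VV := v 1 - v 0; have V0 : 0 <= VV := control_ge0 hv.
have [|d d0 hd] := osc (e * T / (VV + 1)); first by rewrite divr_gt0 ?mulr_gt0//; lra.
have d20 : 0 < d / 2 by rewrite divr_gt0.
have [n1 h1] := inv_small d20.
have [|n2 h2] := limF (e * T); first by rewrite mulr_gt0.
pose n := maxn (maxn n1 n2) 1.
have n0 : (0 < n)%N by rewrite /n leq_max orbT.
have n1n : (n1 <= n)%N by rewrite /n !leq_max leqnn.
have n2n : (n2 <= n)%N by rewrite /n !leq_max leqnn orbT.
pose Fw w z := g z / (z - w).
exists ((two_pi_i R)^-1 *: uniform_sum gamma F n),
  (fun w => (two_pi_i R)^-1 * uniform_sum (V := R[i]) gamma (Fw w) n); split.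
- apply: rationalZ.
  apply: (rational_sum hA psi_pos psi1 c_sa) => j jn.
  have j01 := @part_01 R _ _ (ltnW jn).
  by do 2!apply: rationalZ; apply: rational_resolvent; exact: ures.
- rewrite /cauchy_integral -scalerBr (cnZ hN) cabsV ler_pdivrMl// mulrC (cnB hN).
  exact: h2.
move=> w sw.
have uFw : uniformly_continuous_along (V := R[i]) (@cabs R) gamma (Fw w).
  by move=> e1 /osc[d' d'0 hd']; exists d' => //; exact: hd'.
have oscw : oscillation_le (V := R[i]) (@cabs R) gamma (Fw w) (2 * (d / 2)) (e * T / (VV + 1)).
  have -> : 2 * (d / 2) = d by field.
  exact: hd.
have [ow iw] := sind _ sw.
have est := curve_integral_estimate (cabs_complete R) hv (@cabsE R) uFw d20 oscw n0 (h1 n n1n n0).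
have ch := cauchy_homology hv g01 gcont oG hg gG iout (sG _ sw) ow.
rewrite /Fw ch iw in est.
have -> : g w - (two_pi_i R)^-1 * uniform_sum (V := R[i]) gamma (Fw w) n =
  (two_pi_i R)^-1 * (g w * two_pi_i R - uniform_sum (V := R[i]) gamma (Fw w) n).
  by field.
rewrite cabsM cabsV ler_pdivrMl//; apply: (le_trans est).
rewrite -/VV mulrAC ler_pdivrMr; last by lra.
rewrite (mulrC e) ler_wpM2l ?mulr_ge0 ?(ltW T0) ?(ltW e0)//; lra.
Qed.

End calculus.

(** * The Jensen gap of a convex function *)

Section convexity.
Variables (R : realType) (m M t : R).
Hypothesis tmM : m <= t <= M.
Variables F F1 : R[i] -> R[i].
Hypothesis dF : forall x : R, m <= x <= M -> has_deriv F x%:C (F1 x%:C).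

Lemma valley : F t%:C = 0 ->
  (forall x : R, m <= x <= M -> t <= x -> 0 <= F1 x%:C) ->
  (forall x : R, m <= x <= M -> x <= t -> F1 x%:C <= 0) ->
  forall x : R, m <= x <= M -> 0 <= F x%:C.
Proof.
move: tmM => /andP[mt tM] F0 up down x /andP[mx xM].
have [tx|/ltW xt] := leP t x.
  rewrite -[leRHS]subr0 -[X in _ - X]F0; apply: (@increasing_of_deriv _ F F1) => // s /andP[ts sx].
  by split; [apply: dF; lra | apply: up => //; lra].
have : 0 <= (- F t%:C) - (- F x%:C); last by rewrite F0 oppr0 sub0r opprK.
apply: (@increasing_of_deriv _ (fun w => - F w) (fun w => - F1 w)) => // s /andP[ts sx].
split; first by apply: has_derivN; apply: dF; lra.
by rewrite oppr_ge0; apply: down => //; lra.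
Qed.

Lemma increasing_sign F2 : F1 t%:C = 0 ->
  (forall x : R, m <= x <= M -> has_deriv F1 x%:C (F2 x%:C) /\ 0 <= F2 x%:C) ->
  forall x : R, m <= x <= M ->
  (t <= x -> 0 <= F1 x%:C) /\ (x <= t -> F1 x%:C <= 0).
Proof.
move: tmM => /andP[mt tM] F0 d2 x /andP[mx xM]; split=> xt.
  rewrite -[leRHS]subr0 -[X in _ - X]F0; apply: (@increasing_of_deriv _ F1 F2) => // s /andP[ts sx].
  by apply: d2; lra.
rewrite -oppr_ge0 -[leRHS]add0r -[X in X + _]F0; apply: (@increasing_of_deriv _ F1 F2) => // s /andP[ts sx].
by apply: d2; lra.
Qed.

End convexity.

Section jensen.
Variables (R : realType) (A : banachStarAlgType R[i]).
Hypothesis hA : hermitian_algebra A.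
Variable psi : {scalar A}.
Hypothesis psi_pos : positive_functional psi.
Hypothesis psi1 : psi 1 = 1.
Variable c : A.
Hypothesis c_sa : selfadjoint c.
Variables (m M : R).
Hypothesis c_sp : spectrum c `<=` [set x%:C | x in `[m, M]].

Lemma spectrum_segment w : spectrum c w -> exists2 x : R, m <= x <= M & w = x%:C.
Proof. by move=> /c_sp[x /=]; rewrite in_itv /= => h <-; exists x. Qed.

Lemma spectrum_bounded w : spectrum c w -> cabs w <= `|m| + `|M|.
Proof.
move=> /spectrum_segment[x /andP[mx xM] ->]; rewrite cabs_real.
have := ler_norm M; have := ler_norm (- m); rewrite normrN ler_norml => h1 h2.
have := normr_ge0 m; have := normr_ge0 M; lra.
Qed.

Lemma psi_in_segment : exists2 t : R, m <= t <= M & psi c = t%:C.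
Proof.
have h1 : 0 <= psi (c + (- m%:C)%:A).
  apply: (function_of_nonneg hA psi_pos psi1 c_sa
    (function_ofD hA psi_pos psi1 c_sa (function_of_id c) (function_of1 c _))).
  by move=> _ /spectrum_segment[x /andP[mx xM] ->] /=; rewrite subr_ge0 lecR.
have h2 : 0 <= psi (-1 *: c + (M%:C)%:A).
  apply: (function_of_nonneg hA psi_pos psi1 c_sa (function_ofD hA psi_pos psi1 c_sa
    (function_ofZ (-1) (function_of_id c)) (function_of1 c _))).
  by move=> _ /spectrum_segment[x /andP[mx xM] ->] /=; rewrite mulN1r addrC subr_ge0 lecR.
move: h1 h2; rewrite !linearD /= !psi_alg// psiZ mulN1r subr_ge0 addrC subr_ge0 => h1 h2.
exists (Re (psi c)).
  by move: h1 h2; rewrite !lecE /= => /andP[_ ->] /andP[_ ->].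
by move: h1; rewrite lecE /= => /andP[/eqP h _]; case: (psi c) h => a b /= ->.
Qed.

Variables (g g' g'' : R[i] -> R[i]) (b b' : A).
Hypothesis dg : forall x : R, m <= x <= M -> has_deriv g x%:C (g' x%:C).
Hypothesis dg' : forall x : R, m <= x <= M ->
  has_deriv g' x%:C (g'' x%:C) /\ 0 <= g'' x%:C.
Hypothesis bg : function_of c b g.
Hypothesis bg' : function_of c b' g'.

(** The function [F] is the difference of [g] and of its tangent at [psi c]. *)
Lemma jensen_gap_ge0 : 0 <= psi b - g (psi c).
Proof.
have [t tmM psiT] := psi_in_segment; rewrite psiT.
set T := t%:C; pose F w := g w + (- g' T * w + (g' T * T - g T)).
pose x := b + ((- g' T) *: c + (g' T * T - g T)%:A).
have xF : function_of c x F.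
  apply: (function_ofD hA psi_pos psi1 c_sa bg).
  apply: (function_ofD hA psi_pos psi1 c_sa (function_ofZ _ (function_of_id c))).
  exact: function_of1.
have -> : psi b - g T = psi x.
  by rewrite /x !linearD /= psi_alg// psiZ psiT; ring.
apply: (function_of_nonneg hA psi_pos psi1 c_sa xF) => _ /spectrum_segment[y ymM ->].
pose F1 w := g' w + (- g' T + 0).
have dF (s : R) : m <= s <= M -> has_deriv F s%:C (F1 s%:C).
  move=> sm; apply: has_derivD; first exact: dg.
  apply: has_derivD; last exact: has_deriv_cst.
  by rewrite -[X in has_deriv _ _ X]mulr1; apply: has_derivZ; exact: has_deriv_id.
have F10 : F1 t%:C = 0 by rewrite /F1 -/T; ring.
have dF1 (s : R) : m <= s <= M -> has_deriv F1 s%:C (g'' s%:C) /\ 0 <= g'' s%:C.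
  move=> sm; split; last exact: (dg' sm).2.
  rewrite -[X in has_deriv _ _ X]addr0; apply: has_derivD; first exact: (dg' sm).1.
  exact: has_deriv_cst.
have sg := increasing_sign tmM F10 dF1.
apply: (valley tmM dF) => //; first by rewrite /F -/T; ring.
  by move=> s /sg[+ _].
by move=> s /sg[_].
Qed.

(** The function [F] at [w] is the difference at [psi c] of [g] and of its
    tangent at [w]. Its derivative is [g'' w * (w - psi c)], so it has a minimum
    at [psi c] as well. *)
Lemma reverse_jensen_gap_ge0 :
  0 <= psi (c * b') - psi c * psi b' + g (psi c) - psi b.
Proof.
have [t tmM psiT] := psi_in_segment; rewrite psiT.
set T := t%:C; pose F w := w * g' w + (- T * g' w + (- 1 * g w + g T)).
pose x := c * b' + ((- T) *: b' + ((-1) *: b + (g T)%:A)).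
have xF : function_of c x F.
  apply: (function_ofD hA psi_pos psi1 c_sa (function_of_mulc spectrum_bounded bg')).
  apply: (function_ofD hA psi_pos psi1 c_sa (function_ofZ _ bg')).
  apply: (function_ofD hA psi_pos psi1 c_sa (function_ofZ _ bg)).
  exact: function_of1.
have -> : psi (c * b') - T * psi b' + g T - psi b = psi x.
  by rewrite /x !linearD /= psi_alg// !psiZ; ring.
apply: (function_of_nonneg hA psi_pos psi1 c_sa xF) => _ /spectrum_segment[y ymM ->].
pose F1 w := g'' w * (w - T).
have dF (s : R) : m <= s <= M -> has_deriv F s%:C (F1 s%:C).
  move=> sm; have [d2 _] := dg' sm; have d1 := dg sm.
  have := has_derivD (has_derivM (has_deriv_id _) d2) (has_derivD (has_derivZ (- T) d2)
    (has_derivD (has_derivZ (-1) d1) (has_deriv_cst (g T) _))).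
  by congr (has_deriv F _ _); rewrite /F1; ring.
apply: (valley tmM dF) => //; first by rewrite /F -/T; ring.
  move=> s sm ts; rewrite /F1 mulr_ge0 ?(dg' sm).2//.
  by rewrite subr_ge0 lecR.
by move=> s sm ts; rewrite /F1 mulr_ge0_le0 ?(dg' sm).2// subr_le0 lecR.
Qed.

End jensen.

(** * Open sets, analytic functions and surrounding curves *)

Section transfer.
Variable R : realType.

Lemma open_open_pred (G : set R[i]) : open G -> open_pred G.
Proof.
rewrite openE => oG p /oG /nbhs_normP[e /= e0 h].
have eE : e = (Re e)%:C by rewrite RRe_real// gtr0_real.
exists (Re e); first by rewrite -ltcR -eE.
move=> w wp; apply: h; by rewrite /ball_ /= distrC eE cabsE ltcR.
Qed.

Lemma segment_neighbourhood (G : set R[i]) (m M : R) : open_pred G -> m <= M ->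
  (forall x : R, m <= x <= M -> G x%:C) ->
  exists2 rho : R, 0 < rho &
    forall x : R, m <= x <= M -> forall w, cabs (w - x%:C) < rho -> G w.
Proof.
move=> oG mM mMG.
apply: (@cousin R m M (fun a b => exists2 rho : R, 0 < rho &
  forall x : R, a <= x <= b -> forall w, cabs (w - x%:C) < rho -> G w)) => //.
  move=> x y z _ xy yz _ [r1 r10 h1] [r2 r20 h2].
  exists (Num.min r1 r2); first by rewrite lt_min r10.
  move=> s /andP[xs sz] w; rewrite lt_min => /andP[w1 w2].
  by have [sy|/ltW ys] := leP s y; [apply: (h1 s) | apply: (h2 s)] => //; apply/andP.
move=> p /mMG/oG[d d0 hd]; exists (d / 2); first by rewrite divr_gt0.
move=> x y _ xp py _ xy; exists (d / 2); first by rewrite divr_gt0.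
move=> s /andP[xs sy] w ws; apply: hd.
have -> : w - p%:C = (w - s%:C) + (s - p)%:C by rewrite rmorphB /= addrA subrK.
apply: le_lt_trans (cabsD _ _) _; rewrite cabs_real.
have : `|s - p| < d / 2 by rewrite ltr_norml; apply/andP; lra.
by lra.
Qed.

End transfer.

(** The value is a Cauchy integral along some chosen surrounding curve; any of
    them would do, but one has to exist. *)
Lemma holo_calc_function_of (R : realType) (A : banachStarAlgType R[i])
    (psi : {scalar A}) (G : set R[i]) (g g' : R[i] -> R[i]) (c : A) gamma :
  hermitian_algebra A -> positive_functional psi -> psi 1 = 1 ->
  selfadjoint c -> open_pred G -> holomorphic G g g' ->
  surrounds G (spectrum c) gamma -> function_of c (holo_calc G g c) g.
Proof.
move=> hA psi_pos psi1 c_sa oG hg sg; rewrite /holo_calc; case: xgetP => [b _|].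
  by move=> [g1 sg1 ->]; apply: (cauchy_integral_function_of hA psi_pos psi1 c_sa oG hg).
by move=> /(_ (cauchy_integral gamma g c)) /= h; case: h; exists gamma.
Qed.

(** * The inequalities *)

Theorem corollary1 (R : realType) (A : banachStarAlgType R[i])
  (hA : hermitian_algebra A)
  (psi : {scalar A}) (psi_pos : positive_functional psi) (psi1 : psi 1 = 1)
  (G : set R[i]) (openG : open G)
  (f : R[i] -> R[i]) (f_an : analytic_on G f)
  (I : interval R) (IG : [set x%:C | x in [set` I]] `<=` G)
  (m M : R) (mM : m < M) (mMI : `[m, M] `<=` [set` I])
  (K k : R) (k_ge0 : 0 <= k) (kK : k < K)
  (hf : forall x : R, m <= x <= M ->
     k%:C <= derive1 (derive1 f) x%:C <= K%:C)
  (c : A) (c_sa : selfadjoint c)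
  (c_sp : spectrum c `<=` [set x%:C | x in `[m, M]]) :
  let var := psi (c ^+ 2) - psi c ^+ 2 in
  let fc := holo_calc G f c in
  let f'c := holo_calc G (derive1 f) c in
  let J := psi fc - f (psi c) in
  let J' := psi (c * f'c) - psi c * psi f'c + f (psi c) - psi fc in
  [/\ J \is Num.real,
      2^-1 * k%:C * var <= J <= 2^-1 * K%:C * var,
      J' \is Num.real &
      2^-1 * k%:C * var <= J' <= 2^-1 * K%:C * var].
Proof.
move=> var fc f'c J J'.
have oG := open_open_pred openG.
have GmM (x : R) : m <= x <= M -> G x%:C.
  by move=> xm; apply: IG; exists x => //; apply: mMI; rewrite /= in_itv.
have hG : holomorphic G f (derive1 f) by move=> z /f_an; exact: derivable_has_deriv.
have [f'' hG'] := holomorphic_deriv oG hG.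
have [rho rho0 nG] := segment_neighbourhood oG (ltW mM) GmM.
have sur := ellipse_surrounds mM rho0 nG c_sp.
have fcf : function_of c fc f.
  exact: (holo_calc_function_of hA psi_pos psi1 c_sa oG hG sur).
have fcf' : function_of c f'c (derive1 f).
  exact: (holo_calc_function_of hA psi_pos psi1 c_sa oG hG' sur).
have d1 (x : R) : m <= x <= M -> has_deriv f x%:C (derive1 f x%:C).
  by move=> /GmM/hG.
have d2 (x : R) : m <= x <= M -> has_deriv (derive1 f) x%:C (derive1 (derive1 f) x%:C).
  by move=> /GmM/hG' h; rewrite (has_deriv_derive1 h).
have B := spectrum_bounded c_sp.
have cid := function_of_id c.
have sq : function_of c (c * c) (fun w => w * w) := function_of_mulc B cid.
have h2 : (2 : R[i]) != 0 := @two_neq0 R.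
(* For [s = 1] and [a = - k], or [s = -1] and [a = K], the function
   [s f + a z^2 / 2] is convex on [m, M]. *)
have gap (s a : R[i]) : (forall x : R, m <= x <= M ->
    0 <= s * derive1 (derive1 f) x%:C + a) ->
  0 <= s * J + a / 2 * var /\ 0 <= s * J' + a / 2 * var.
  move=> conv.
  pose g w := s * f w + a / 2 * (w * w).
  pose g' w := s * derive1 f w + a * w.
  pose g'' w := s * derive1 (derive1 f) w + a.
  have dg (x : R) : m <= x <= M -> has_deriv g x%:C (g' x%:C).
    move=> xm; have := has_derivD (has_derivZ s (d1 x xm))
      (has_derivZ (a / 2) (has_derivM (has_deriv_id x%:C) (has_deriv_id x%:C))).
    by congr (has_deriv g _ _); rewrite /g'; field.
  have dg' (x : R) : m <= x <= M -> has_deriv g' x%:C (g'' x%:C) /\ 0 <= g'' x%:C.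
    move=> xm; split; last exact: conv.
    have := has_derivD (has_derivZ s (d2 x xm)) (has_derivZ a (has_deriv_id x%:C)).
    by congr (has_deriv g' _ _); rewrite /g'' mulr1.
  have bg : function_of c (s *: fc + (a / 2) *: (c * c)) g.
    exact: (function_ofD hA psi_pos psi1 c_sa (function_ofZ _ fcf) (function_ofZ _ sq)).
  have bg' : function_of c (s *: f'c + a *: c) g'.
    exact: (function_ofD hA psi_pos psi1 c_sa (function_ofZ _ fcf') (function_ofZ _ cid)).
  have := reverse_jensen_gap_ge0 hA psi_pos psi1 c_sa c_sp dg dg' bg bg'.
  have := jensen_gap_ge0 hA psi_pos psi1 c_sa c_sp dg dg' bg.
  rewrite mulrDr -!scalerAr !linearD /= !psiZ /g /J /J' /var expr2 => g1 g2; split.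
    by move: g1; congr (0 <= _); field.
  by move: g2; congr (0 <= _); field.
have [|k1 k2] := gap 1 (- k%:C).
  by move=> x /hf/andP[h _]; rewrite mul1r subr_ge0.
have [|K1 K2] := gap (-1) K%:C.
  by move=> x /hf/andP[_ h]; rewrite mulN1r addrC subr_ge0.
(* The variance is nonnegative, by Jensen's inequality for the square. *)
have [|v0 _] := gap 0 1.
  by move=> x _; rewrite mul0r add0r.
have kv : 0 <= 2^-1 * k%:C * var.
  have -> : 2^-1 * k%:C * var = k%:C * (0 * J + 1 / 2 * var) by field.
  by rewrite mulr_ge0// lecR.
have lo X : 0 <= 1 * X + - k%:C / 2 * var -> 2^-1 * k%:C * var <= X.
  by rewrite -[_ <= X]subr_ge0; congr (0 <= _); field.
have up X : 0 <= -1 * X + K%:C / 2 * var -> X <= 2^-1 * K%:C * var.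
  by rewrite -[X <= _]subr_ge0; congr (0 <= _); field.
split; rewrite ?lo ?up//; apply: ger0_real; apply: le_trans kv _; exact: lo.
Qed.
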